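(* Let $k\ge 1$, $m\ge 3$ and $j$ be fixed integers, and let $\alpha_0\ge 1$ and $\theta_0>0$ be constants. Let $\Omega\subset\mathbb{R}^2$ be a polygonal domain and let $\mathcal{T}_h$ be a partition of $\Omega$ into polygons such that every $T\in\mathcal{T}_h$ is convex, has at most $m$ edges, and satisfies the following regularity conditions (with $\alpha_0,\theta_0$ independent of $T$ and $h$): (i) for all edges $e_t$ and $e_s$ of $T$, $|e_s|<\alpha_0|e_t|$; (ii) for any two adjacent edges $e_t$ and $e_s$ of $T$, the angle $\theta$ between them satisfies $\theta_0<\theta<\pi-\theta_0$. Let $j_0=k+m-2$ in general, or $j_0=k+m-3$ in the case where, for every $T\in\mathcal{T}_h$, each edge of $T$ is parallel to another edge of $T$. Suppose that the weak gradient $\nabla_w$ is computed in polynomials of degree $j$ (that is, $\nabla_w v|_T\in[P_j(T)]^2$ for every $T\in\mathcal{T}_h$) with $j\ge j_0$. Then there exist two constants $C_1,C_2>0$, depending (for the fixed integers $k,m,j$) only on $\alpha_0$ and $\theta_0$, such that for every $v=\{v_0,v_b\}\in V_h$, $$C_1\|v\|_{1,h}\le |||v|||\le C_2\|v\|_{1,h}.$$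
   Context: For $T\in\mathcal{T}_h$, $h_T$ denotes the diameter of $T$, and $h=\max_{T\in\mathcal{T}_h}h_T$. $|e|$ denotes the length of an edge $e$. $P_k(T)$ (resp. $P_k(e)$) is the space of polynomials of degree at most $k$ on the polygon $T$ (resp. on the edge $e$). $(\cdot,\cdot)_T$ and $\langle\cdot,\cdot\rangle_{\partial T}$ are the $L^2$ inner products on $T$ and on $\partial T$, and $\|\cdot\|_T$, $\|\cdot\|_{\partial T}$ are the corresponding $L^2$ norms. The weak Galerkin finite element space is $$V_h=\{v=\{v_0,v_b\}:\ v_0|_T\in P_k(T),\ v_b|_e\in P_k(e),\ e\subset\partial T,\ T\in\mathcal{T}_h\},$$ where $e$ ranges over edges of $T$. Here $v_0$ represents the interior value of $v$ on each $T$, and $v_b$ its edge value on each edge $e$; $v_b$ is not required to be the trace of $v_0$. For $v=\{v_0,v_b\}\in V_h$ the weak gradient $\nabla_w v$ of degree $j\ge k$ is defined on each $T\in\mathcal{T}_h$ as the unique element $\nabla_w v\in[P_j(T)]^2$ satisfying $$(\nabla_w v,\mathbf{q})_T=-(v_0,\nabla\cdot\mathbf{q})_T+\langle v_b,\mathbf{q}\cdot\mathbf{n}\rangle_{\partial T}\qquad\text{for all }\mathbf{q}\in[P_j(T)]^2,$$ where $\mathbf{n}$ is the unit outward normal vector of $\partial T$. The quantities $|||\cdot|||\ge 0$ and $\|\cdot\|_{1,h}\ge 0$ are defined by $$|||v|||^2=\sum_{T\in\mathcal{T}_h}\|\nabla_w v\|_T^2,\qquad \|v\|_{1,h}^2=\sum_{T\in\mathcal{T}_h}\left(\|\nabla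 v_0\|_T^2+h_T^{-1}\|v_0-v_b\|_{\partial T}^2\right),$$ where in $\|v_0-v_b\|_{\partial T}$ the trace on $\partial T$ of $v_0|_T$ is used. *)

(* Defs.v *)
(* MathComp-Analysis, with bivariate polynomials from multinomials: mpoly is
   imported without its notations, which clash with those of the analysis
   library. *)
From mathcomp Require Import all_boot all_order all_algebra.
From mathcomp Require Import all_classical all_reals all_analysis.
From mathcomp Require Import -(notations) mpoly.

Set Implicit Arguments.
Unset Strict Implicit.
Unset Printing Implicit Defensive.

Import Order.TTheory GRing.Theory Num.Theory.
Import numFieldNormedType.Exports.

Local Open Scope classical_set_scope.
Local Open Scope ring_scope.

(* The norm that the library puts on R * R is the max norm; it is only used
   here through the topology. Lengths, angles and diameters are Euclidean. *)
Section plane.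
Variable R : realType.
Implicit Types (x y u v : R * R) (e : (R * R) * (R * R)) (T : set (R * R)).

Definition dot u v : R := u.1 * v.1 + u.2 * v.2.
Definition enorm u : R := Num.sqrt (dot u u).

(* a segment is given by its two end points *)
Definition dir e : R * R := e.2 - e.1.
Definition len e : R := enorm (dir e).
Definition seg_point e (t : R) : R * R := e.1 + t *: dir e.
Definition closed_segment e : set (R * R) := [set seg_point e t | t in `[0, 1]].
Definition open_segment e : set (R * R) := [set seg_point e t | t in `]0, 1[].

Definition parallel e e' : Prop :=
  (dir e).1 * (dir e').2 - (dir e).2 * (dir e').1 = 0.

(* angle at the common vertex e.2 = e'.1 of two consecutive edges *)
Definition edge_angle e e' : R :=
  acos (dot (e.1 - e.2) (e'.2 - e'.1) / (len e * len e')).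

Definition diam T : R := sup [set enorm (z.1 - z.2) | z in T `*` T].

Definition frontier T : set (R * R) := closure T `\` T°.

Definition polygonal_domain (Omega : set (R * R)) : Prop :=
  [/\ Omega !=set0, open Omega, connected Omega, bounded_set Omega &
      exists E : seq ((R * R) * (R * R)),
        (forall e, e \in E -> e.1 != e.2) /\
        frontier Omega = \bigcup_(e in [set` E]) closed_segment e].

(* the edges of the closed polygonal line with successive vertices s *)
Definition edges_of (s : seq (R * R)) : seq ((R * R) * (R * R)) :=
  zip s (rot 1 s).

Definition simple_closed (s : seq (R * R)) : Prop :=
  forall e e', e \in edges_of s -> e' \in edges_of s -> e != e' ->
    closed_segment e `&` closed_segment e' `<=`
      [set e.1; e.2] `&` [set e'.1; e'.2].

(* By the Jordan curve theorem, a compact set with nonempty interior whose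
   frontier is a simple closed polygonal line is the closed region enclosed by
   that line. *)
Record polygon := Polygon {
  vertices : seq (R * R);
  region : set (R * R);
  polygonP : [/\ (3 <= size vertices)%N && uniq vertices, simple_closed vertices,
                compact region, region° !=set0 &
                frontier region =
                  \bigcup_(e in [set` edges_of vertices]) closed_segment e] }.

Definition edges (P : polygon) : seq ((R * R) * (R * R)) :=
  edges_of (vertices P).

Definition is_outward_normal T e (n : R * R) : Prop :=
  [/\ enorm n = 1, dot n (dir e) = 0 &
      forall x, open_segment e x -> \forall t \near 0^'+, ~ T (x + t *: n)].

Definition outward_normal T e : R * R := xget 0 [set n | is_outward_normal T e n].

Definition integral_on T (f : R * R -> R) : R :=
  \int[(lebesgue_measure \x lebesgue_measure)%E]_(x in T) f x.

(* integral with respect to arc length *)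
Definition edge_integral e (f : R * R -> R) : R :=
  len e * \int[lebesgue_measure]_(t in `[0, 1]) f (seg_point e t).

(* zip pairs each edge with the next one along the boundary, i.e. enumerates
   the pairs of adjacent edges. *)
Definition shape_regular (alpha0 theta0 : R) (P : polygon) : Prop :=
  (forall et es, et \in edges P -> es \in edges P -> len es < alpha0 * len et)
  /\ (forall et es, (et, es) \in zip (edges P) (rot 1 (edges P)) ->
        theta0 < edge_angle et es < pi - theta0).

Definition parallel_edges (P : polygon) : Prop :=
  forall e, e \in edges P ->
    exists e', [/\ e' \in edges P, e' != e & parallel e e'].

Definition is_partition (Omega : set (R * R)) (N : nat) (Th : 'I_N -> polygon)
    : Prop :=
  [/\ closure Omega = \bigcup_i region (Th i),
      forall i, (region (Th i))° `<=` Omega &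
      trivIset setT (fun i => (region (Th i))°)].

End plane.

Section weak_galerkin.
Variable R : realType.

Definition bipoly : Type := mpoly 2 R.

Definition peval (p : bipoly) (x : R * R) : R :=
  meval (fun i : 'I_2 => if i == ord0 then x.1 else x.2) p.
Definition dx (p : bipoly) : bipoly := mderiv ord0 p.
Definition dy (p : bipoly) : bipoly := mderiv ord_max p.

(* total degree at most k *)
Definition deg_le (k : nat) (p : bipoly) : Prop := (msize p <= k.+1)%N.

(* Interior values are stored as one polynomial per element. Edge values form a
   function on the union of all edges; only its values on the relative
   interiors of the edges matter, so nothing is imposed at the vertices, where
   several edges meet. *)
Record wg_function (N : nat) := WGFunction {
  interior_value : 'I_N -> bipoly;
  edge_value : R * R -> R }.

Definition in_Vh (k N : nat) (Th : 'I_N -> polygon R) (v : wg_function N)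
    : Prop :=
  (forall i, deg_le k (interior_value v i)) /\
  (forall i e, e \in edges (Th i) ->
     exists p : {poly R}, (size p <= k.+1)%N /\
       forall t, 0 < t < 1 -> edge_value v (seg_point e t) = p.[t]).

Definition is_weak_gradient (j : nat) (P : polygon R) (v0 : bipoly)
    (vb : R * R -> R) (w : bipoly * bipoly) : Prop :=
  [/\ deg_le j w.1, deg_le j w.2 &
   forall q : bipoly * bipoly, deg_le j q.1 -> deg_le j q.2 ->
     integral_on (region P)
       (fun x => peval w.1 x * peval q.1 x + peval w.2 x * peval q.2 x) =
     - integral_on (region P)
         (fun x => peval v0 x * (peval (dx q.1) x + peval (dy q.2) x)) +
     \sum_(e <- edges P) edge_integral e
         (fun x => vb x * dot (peval q.1 x, peval q.2 x)
                              (outward_normal (region P) e))].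

Definition weak_gradient (j : nat) (P : polygon R) (v0 : bipoly)
    (vb : R * R -> R) : bipoly * bipoly :=
  xget (0, 0) [set w | is_weak_gradient j P v0 vb w].

Definition wg_norm (j N : nat) (Th : 'I_N -> polygon R) (v : wg_function N)
    : R :=
  Num.sqrt (\sum_(i < N)
    let w := weak_gradient j (Th i) (interior_value v i) (edge_value v) in
    integral_on (region (Th i))
      (fun x => peval w.1 x ^+ 2 + peval w.2 x ^+ 2)).

Definition norm_1h (N : nat) (Th : 'I_N -> polygon R) (v : wg_function N) : R :=
  Num.sqrt (\sum_(i < N)
    let v0 := interior_value v i in
    (integral_on (region (Th i))
       (fun x => peval (dx v0) x ^+ 2 + peval (dy v0) x ^+ 2) +
     (diam (region (Th i)))^-1 *
       \sum_(e <- edges (Th i)) edge_integral e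
          (fun x => (peval v0 x - edge_value v x) ^+ 2))).

Definition j0 (k m N : nat) (Th : 'I_N -> polygon R) : nat :=
  if `[< forall i, parallel_edges (Th i) >] then (k + m - 3)%N
  else (k + m - 2)%N.

End weak_galerkin.

(* Main.v *)
Require Import Defs.
From mathcomp Require Import all_boot all_order all_algebra.
From mathcomp Require Import all_classical all_reals all_analysis.
From mathcomp Require Import -(notations) mpoly.
From mathcomp Require Import measurable_realfun.
From mathcomp Require Import ring lra.

Set Implicit Arguments.
Unset Strict Implicit.
Unset Printing Implicit Defensive.

Import Order.TTheory GRing.Theory Num.Theory.
Import numFieldNormedType.Exports.

Local Open Scope classical_set_scope.
Local Open Scope ring_scope.

(** Let T be an element with diameter h, and let g_e be the polynomial v_b - v_0 on
the edge e, with outward normal n_e. Undoing the integration by parts that defines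
the weak gradient w gives, for all q in [P_j]^2,

   (w, q)_T = (grad v_0, q)_T + sum_e <g_e, q . n_e>_e.            (1)

The two norms are compared element by element: by [norm_equivalence], the square of
|w|_T is comparable to that of |grad v_0|_T plus h^-1 sum_e |g_e|_e^2, with constants
that depend only on m, j, alpha_0 and theta_0. Summation over the elements then gives the
theorem.

With q = w and q = - grad v_0 in (1), Young's inequality bounds each of |w| and
|grad v_0| by the other one and the jumps ([energy_upper], [energy_lower]). The
boundary values of q are handled by an inverse estimate ([sup_region]): on
polynomials of bounded degree, the supremum over T is controlled by the L2 norm on a
square inside T whose side is comparable to h.

What remains is to bound each jump g_e by w; this is what determines the degree j. Let
t be the unit vector along the edge that follows e and let Lam be the product of the
heights above all edges other than e that are not parallel to t. A field q = Lam r t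
has no flux through any edge but e ([tangential_test]). Choosing for r the height
above e times the derivative of v_0 along t makes the last flux vanish too, so that
(1) bounds this derivative by w ([tangential_weighted]). Choosing for r the extension
of g_e to T that is constant along n_e turns the sum in (1) into (t . n_e) times the
integral of Lam g_e^2 over e, which is therefore bounded by w and by the derivative of
v_0 along t, thus by w alone ([weighted_jump_bound]). The angle condition bounds
t . n_e away from 0. The edge e and the edge along t are left out of Lam, and so is
any further edge parallel to t; hence Lam r has degree at most k + m - 2, or k + m - 3
if every edge has a parallel one.

For the constants to depend on the shape parameters only, Lam must be bounded below on
a fixed part of e and on a square inside T. Both follow from one fact about
shape-regular convex polygons ([mid_height]): the midpoint of an edge is at distance
at least c h from the line of every other edge.

The boundary is given as a simple closed polygonal line that is the frontier of a
compact set T, so convexity must first be turned into the description of T by half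
planes ([outward_normalP], [regionE]). Green's formula ([green]) is proved from it by
integration over horizontal and vertical lines: all but finitely many of those that
meet T cut out a chord whose ends are interior to two edges ([line_chord]). *)

(** * Polynomials of one variable on an interval *)

Section univariate.
Variable R : realType.
Implicit Types (p q : {poly R}) (a b c x t : R).

(** Integrals of polynomials are evaluated through a polynomial primitive; the
coefficient at index 0 is 0 because division by zero gives 0. *)
Definition antideriv p : {poly R} :=
  \poly_(i < (size p).+1) (p`_i.-1 / i%:R).

Lemma deriv_antideriv p : (antideriv p)^`() = p.
Proof.
apply/polyP => i; rewrite coef_deriv coef_poly ltnS.
case: ltnP => [ip|pi]; last by rewrite mul0rn nth_default.
by rewrite /= -[LHS]mulr_natr -mulrA mulVf ?mulr1 // pnatr_eq0.
Qed.

Definition pint (a b : R) p : R := \int[lebesgue_measure]_(t in `[a, b]) p.[t].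

Lemma pint_integrable a b p :
  (@lebesgue_measure R).-integrable `[a, b] (EFin \o horner p).
Proof.
apply: continuous_compact_integrable; first exact: segment_compact.
by apply: continuous_subspaceT => x; exact: continuous_horner.
Qed.

Lemma pintE a b p q : a <= b -> q^`() = p -> pint a b p = q.[b] - q.[a].
Proof.
rewrite le_eqVlt => /predU1P[<- _|ab qp].
  by rewrite /pint set_itv1 Rintegral_set1 subrr.
rewrite /pint /Rintegral (@continuous_FTC2 _ _ (horner q))//=.
- by apply: continuous_subspaceT => x; exact: continuous_horner.
- split => [x _||]; first exact: derivable_horner.
  + by apply: cvg_at_right_filter; exact: continuous_horner.
  + by apply: cvg_at_left_filter; exact: continuous_horner.
- by move=> x _; rewrite -qp derivE.
Qed.

Lemma pintD a b p q : a <= b -> pint a b (p + q) = pint a b p + pint a b q.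
Proof.
move=> ab; rewrite (pintE ab (deriv_antideriv p)) (pintE ab (deriv_antideriv q)).
rewrite (@pintE _ _ _ (antideriv p + antideriv q) ab); last first.
  by rewrite derivD !deriv_antideriv.
by rewrite !hornerD; ring.
Qed.

Lemma pintZ a b c p : a <= b -> pint a b (c *: p) = c * pint a b p.
Proof.
move=> ab; rewrite (pintE ab (deriv_antideriv p)).
rewrite (@pintE _ _ _ (c *: antideriv p) ab); last first.
  by rewrite derivZ !deriv_antideriv.
by rewrite !hornerZ; ring.
Qed.

Lemma le_pint a b p q :
  (forall t, a <= t <= b -> p.[t] <= q.[t]) -> pint a b p <= pint a b q.
Proof.
move=> pq; apply: le_Rintegral => //.
- exact: pint_integrable.
- exact: pint_integrable.
Qed.

Lemma pint_ge0 a b p :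
  (forall t, a <= t <= b -> 0 <= p.[t]) -> 0 <= pint a b p.
Proof.
by move=> p0; apply: Rintegral_ge0 => t /=; rewrite in_itv /=; exact: p0.
Qed.

Lemma pint0 a b : a <= b -> pint a b 0 = 0.
Proof. by move=> ab; rewrite -(scale0r 0) pintZ // mul0r. Qed.

Lemma pint_const c : pint 0 1 c%:P = c.
Proof.
rewrite (@pintE _ _ _ (c *: 'X)) ?ler01 //; last by rewrite derivZ derivX alg_polyC.
by rewrite !hornerE; ring.
Qed.

Lemma eq_pint p q : (forall t, 0 <= t <= 1 -> p.[t] = q.[t]) ->
  pint 0 1 p = pint 0 1 q.
Proof.
by move=> pq; apply/eqP; rewrite eq_le; apply/andP; split; apply: le_pint => t /pq ->.
Qed.

Lemma pint_cat a b c p : a <= b -> b <= c ->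
  pint a c p = pint a b p + pint b c p.
Proof.
move=> ab bc; rewrite (pintE ab (deriv_antideriv _)).
rewrite (pintE bc (deriv_antideriv _)) (pintE (le_trans ab bc) (deriv_antideriv _)).
by ring.
Qed.

Lemma pint_sub a b c d p : a <= c -> c <= d -> d <= b ->
  (forall t, a <= t <= b -> 0 <= p.[t]) -> pint c d p <= pint a b p.
Proof.
move=> ac cd db p0.
rewrite (@pint_cat a c b) // ?(le_trans cd) // (@pint_cat c d b) //.
have h1 : 0 <= pint a c p.
  by apply: pint_ge0 => t tac; apply: p0; lra.
have h2 : 0 <= pint d b p.
  by apply: pint_ge0 => t tac; apply: p0; lra.
by lra.
Qed.

Lemma pint_mvt a b p : a < b ->
  exists2 c, a < c < b & pint a b p = p.[c] * (b - a).
Proof.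
move=> ab.
have [||c cab E] := @MVT R (horner (antideriv p)) (horner p) a b ab.
- by move=> x _; rewrite -{2}(deriv_antideriv p); exact: is_derive_poly.
- by apply: continuous_subspaceT => x; exact: continuous_horner.
exists c; first by move: cab; rewrite in_itv.
by rewrite (pintE (ltW ab) (deriv_antideriv _)) E.
Qed.

Lemma pint_affine a d p : 0 <= d ->
  pint a (a + d) p = d * pint 0 1 (p \Po (a%:P + d *: 'X)).
Proof.
move=> d0; rewrite (@pintE _ _ _ (antideriv p)) ?deriv_antideriv ?lerDl //.
rewrite -pintZ // (@pintE _ _ _ (antideriv p \Po (a%:P + d *: 'X))) //.
  by rewrite !horner_comp !hornerE.
rewrite deriv_comp deriv_antideriv derivD derivC derivZ derivX add0r.
by rewrite alg_polyC mulrC mul_polyC.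
Qed.

Lemma pint_affineN a d p : d <= 0 ->
  pint (a + d) a p = - d * pint 0 1 (p \Po (a%:P + d *: 'X)).
Proof.
move=> d0; rewrite (@pintE _ _ _ (antideriv p)) ?deriv_antideriv ?gerDl //.
rewrite -pintZ // (@pintE _ _ _ (- (antideriv p \Po (a%:P + d *: 'X)))) //.
  by rewrite !hornerN !horner_comp !hornerE opprK addrC.
rewrite derivN deriv_comp deriv_antideriv derivD derivC derivZ derivX add0r.
by rewrite alg_polyC mulrC mul_polyC scaleNr.
Qed.

(** Lagrange interpolation at the d + 1 nodes y i: each of the d factors
(x - y j) / (y i - y j) of a basis polynomial is at most K. *)
Lemma lagrange_bound (d : nat) p (y : nat -> R) (delta K B x : R) :
  (size p <= d.+1)%N -> 0 < delta ->
  (forall i j, (i <= d)%N -> (j <= d)%N -> i != j -> delta <= `|y i - y j|) ->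
  (forall i, (i <= d)%N -> `|x - y i| <= K * delta) ->
  (forall i, (i <= d)%N -> `|p.[y i]| <= B) ->
  `|p.[x]| <= d.+1%:R * K ^+ d * B.
Proof.
move=> sp d0 sep near_x bnd.
pose L (i : 'I_d.+1) : {poly R} :=
  \prod_(j < d.+1 | j != i) ((y i - y j)^-1 *: ('X - (y j)%:P)).
have Lx (i : 'I_d.+1) t : (L i).[t] =
    \prod_(j < d.+1 | j != i) ((y i - y j)^-1 * (t - y j)).
  by rewrite horner_prod; apply: eq_bigr => j _; rewrite !hornerE.
have sep0 (i j : 'I_d.+1) : j != i -> y i - y j != 0.
  move=> ji; rewrite -normr_gt0 (lt_le_trans d0) // sep // ?leq_ord //.
  by rewrite eq_sym.
pose q := \sum_(i < d.+1) p.[y i] *: L i.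
have sL i : (size (L i) <= d.+1)%N.
  rewrite (leq_trans (size_poly_prod_leq _ _)) //.
  rewrite leq_subLR (@leq_trans (\sum_(j < d.+1 | j != i) 2).+1) //.
    rewrite ltnS; apply: leq_sum => j _.
    by rewrite (leq_trans (size_scale_leq _ _)) // size_XsubC.
  rewrite sum_nat_const muln2 -addnn -addnS leq_add2l.
  by rewrite cardC1 card_ord.
(* p and its Lagrange interpolant agree at d + 1 distinct points *)
have pq : p = q.
  apply/eqP; rewrite -subr_eq0; apply/eqP.
  apply: (@roots_geq_poly_eq0 _ _ [seq y i | i <- iota 0 d.+1]).
  - apply/allP => z /mapP[i]; rewrite mem_iota add0n => /= id ->{z}.
    rewrite rootE hornerD hornerN horner_sum subr_eq0.
    rewrite (bigD1 (Ordinal (id : (i < d.+1)%N))) //= big1 ?addr0.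
      rewrite hornerZ Lx big1 ?mulr1 // => j ji.
      by rewrite mulVf // sep0.
    move=> k ki; rewrite hornerZ Lx (bigD1 (Ordinal (id : (i < d.+1)%N))) /=.
      by rewrite subrr mulr0 mul0r mulr0.
    by rewrite eq_sym.
  - rewrite map_inj_in_uniq ?iota_uniq // => i j.
    rewrite !mem_iota !add0n !ltnS => /= id jd yij.
    apply/eqP; apply: contraLR isT => ij /=.
    have := sep _ _ id jd ij; rewrite yij subrr normr0 leNgt d0 //.
  - rewrite size_map size_iota (leq_trans (size_polyD _ _)) // geq_max sp size_polyN.
    apply: (leq_trans (size_sum _ _ _)); apply/bigmax_leqP => i _.
    by rewrite (leq_trans (size_scale_leq _ _)).
have K0 : 0 <= K.
  have := near_x 0%N isT => /(le_trans (normr_ge0 _)).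
  by rewrite pmulr_lge0.
rewrite {1}pq horner_sum (le_trans (ler_norm_sum _ _ _)) //.
have -> : d.+1%:R * K ^+ d * B = \sum_(i < d.+1) (K ^+ d * B).
  by rewrite sumr_const card_ord -[RHS]mulr_natl mulrA.
apply: ler_sum => i _; rewrite hornerZ normrM mulrC.
apply: ler_pM => //; last by apply: bnd; exact: leq_ord.
rewrite Lx normr_prod.
have -> : K ^+ d = \prod_(j < d.+1 | j != i) K.
  by rewrite prodr_const cardC1 card_ord.
apply: ler_prod => j ji; rewrite normr_ge0 /= normrM normfV mulrC.
rewrite ler_pdivrMr ?normr_gt0 ?sep0 // (le_trans (near_x _ (leq_ord j))) //.
by rewrite ler_wpM2l // sep // ?leq_ord // eq_sym.
Qed.

(** Square of the Lagrange factor d.+1 * K ^+ d for nodes delta apart with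
K * delta = (M + 1) * l, times l / delta, where delta = l / (2 * d.+1). *)
Definition sup_const (d : nat) (M : R) : R :=
  (d.+1%:R * ((M + 1) * (2 * d.+1%:R)) ^+ d) ^+ 2 * (2 * d.+1%:R).

(** Inverse estimate: on polynomials of bounded degree the supremum over an interval
enlarged by a fixed factor M is controlled by the L2 norm on the interval. *)
Lemma poly_sup (d : nat) (M : R) p a l x :
  (size p <= d.+1)%N -> 0 < l -> `|x - a| <= M * l ->
  p.[x] ^+ 2 * l <= sup_const d M * pint a (a + l) (p ^+ 2).
Proof.
move=> sp l0 xa; set I := pint _ _ _.
have d1 : 0 < d.+1%:R :> R by rewrite ltr0n.
pose dl := l / (2 * d.+1%:R).
have dl0 : 0 < dl by rewrite divr_gt0 // mulr_gt0.
have dlE : 2 * d.+1%:R * dl = l by rewrite /dl mulrC divfK // gt_eqF // mulr_gt0.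
have p2 t : 0 <= (p ^+ 2).[t] by rewrite horner_exp sqr_ge0.
have region_int0 : 0 <= I by apply: pint_ge0 => t _.
(* Interpolation nodes: cut the interval into 2 (d + 1) pieces of length dl and
   take in every other piece a point where p^2 equals its mean over the piece,
   so that distinct nodes are at least dl apart. *)
have /choice[y yP] : forall i : nat, exists y, (i <= d)%N ->
    a + 2 * i%:R * dl < y < a + (2 * i%:R + 1) * dl /\ p.[y] ^+ 2 * dl <= I.
  move=> i; have [|c cab E] := @pint_mvt (a + 2 * i%:R * dl)
    (a + (2 * i%:R + 1) * dl) (p ^+ 2).
    by rewrite ltrD2l ltr_pM2r // ltrDl.
  exists c => id; split => //.
  have -> : p.[c] ^+ 2 * dl = pint (a + 2 * i%:R * dl)
    (a + (2 * i%:R + 1) * dl) (p ^+ 2) by rewrite E horner_exp; ring.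
  have i0 : 0 <= i%:R :> R by rewrite ler0n.
  apply: pint_sub => //.
  - by rewrite lerDl mulr_ge0 // ?ltW // mulr_ge0.
  - by rewrite lerD2l ler_pM2r // lerDl.
  - rewrite lerD2l -dlE ler_pM2r //.
    by have : i%:R + 1 <= d.+1%:R :> R; [rewrite -natr1 lerD2r ler_nat|lra].
have M0 : 0 <= M by have := le_trans (normr_ge0 _) xa; rewrite pmulr_lge0.
have key : `|p.[x]| <= d.+1%:R * ((M + 1) * (2 * d.+1%:R)) ^+ d * Num.sqrt (I / dl).
  apply: (@lagrange_bound d p y dl) => //.
  - move=> i j; wlog ij : i j / (i < j)%N.
      move=> H id jd; rewrite neq_ltn => /orP[] ij.
        by apply: H => //; rewrite neq_ltn ij.
      by rewrite distrC; apply: H => //; rewrite neq_ltn ij.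
    move=> id jd _; have [/andP[_ y1] _] := yP i id.
    have [/andP[y2 _] _] := yP j jd.
    have ijR : i%:R + 1 <= j%:R :> R by rewrite natr1 ler_nat.
    rewrite distrC (le_trans _ (ler_norm _)) //.
    have : 0 <= (j%:R - i%:R - 1) * dl by rewrite mulr_ge0 ?(ltW dl0) //; lra.
    nra.
  - move=> i id; have [/andP[y1 y2] _] := yP i id.
    have -> : (M + 1) * (2 * d.+1%:R) * dl = (M + 1) * l by rewrite -mulrA dlE.
    have : `|a - y i| <= l.
      have : 0 <= i%:R * dl by rewrite mulr_ge0 // ltW.
      have : (d%:R - i%:R) * dl >= 0 by rewrite mulr_ge0 ?(ltW dl0) // subr_ge0 ler_nat.
      by move: dlE; rewrite -natr1 ler_norml => *; apply/andP; split; nra.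
    have -> : x - y i = (x - a) + (a - y i) by ring.
    move=> ay; apply: (le_trans (ler_normD _ _)).
    by rewrite mulrDl mul1r lerD.
  - move=> i id; have [_ y1] := yP i id.
    by rewrite -sqrtr_sqr ler_wsqrtr // ler_pdivlMr.
have := key; rewrite -(ler_pXn2r (n := 2)) ?nnegrE ?normr_ge0 //; last first.
  rewrite !mulr_ge0 ?sqrtr_ge0 // exprn_ge0 // !mulr_ge0 //; lra.
rewrite -normrX ger0_norm ?sqr_ge0 // exprMn sqr_sqrtr; last first.
  by rewrite divr_ge0 // ltW.
move=> h; rewrite /sup_const -dlE.
have -> : p.[x] ^+ 2 * (2 * d.+1%:R * dl) =
  (p.[x] ^+ 2 * dl) * (2 * d.+1%:R) by ring.
have -> (c : R) : c * (2 * d.+1%:R) * I = c * I * (2 * d.+1%:R) by ring.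
by rewrite ler_pM2r ?mulr_gt0 // -ler_pdivlMr // -mulrA.
Qed.

Lemma young a b c : 0 < c -> a * b <= c * a ^+ 2 + b ^+ 2 / (4 * c).
Proof.
move=> c0; rewrite -subr_ge0.
have -> : c * a ^+ 2 + b ^+ 2 / (4 * c) - a * b = c * (a - b / (2 * c)) ^+ 2.
  by field; rewrite gt_eqF.
by rewrite mulr_ge0 ?sqr_ge0 // ltW.
Qed.

Lemma sup_const_gt0 d M : 0 <= M -> 0 < sup_const d M.
Proof.
move=> M0; have d1 : 0 < d.+1%:R :> R by rewrite ltr0n.
have M1 : 0 < M + 1 by lra.
by rewrite /sup_const !(mulr_gt0, exprn_gt0).
Qed.
End univariate.

(** * Bivariate polynomials and their restrictions to lines *)

Section bivariate.
Variable R : realType.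
Implicit Types (p q : bipoly R) (a u x : R * R) (k l : nat).

(** The restriction of p to the line through a with direction u, as a polynomial in
the parameter. *)
Definition line_poly p a u : {poly R} :=
  mmap polyC (fun i : 'I_2 => if i == ord0 then a.1%:P + u.1 *: 'X
                              else a.2%:P + u.2 *: 'X) p.

Lemma peval_sum p x :
  peval p x = \sum_(m <- msupp p) mcoeff m p * (x.1 ^+ m ord0 * x.2 ^+ m ord_max).
Proof.
rewrite /peval mevalE; apply: eq_bigr => m _; congr (_ * _).
by rewrite big_ord_recl big_ord1 /=; congr (_ ^+ _ * _ ^+ m _); exact/val_inj.
Qed.

Lemma pevalD p q x : peval (p + q) x = peval p x + peval q x.
Proof. exact: mevalD. Qed.
Lemma pevalB p q x : peval (p - q) x = peval p x - peval q x.
Proof. exact: mevalB. Qed.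
Lemma pevalN p x : peval (- p) x = - peval p x.
Proof. exact: mevalN. Qed.
Lemma pevalM p q x : peval (p * q) x = peval p x * peval q x.
Proof. exact: mevalM. Qed.
Lemma pevalZ c p x : peval (c *: p) x = c * peval p x.
Proof. exact: mevalZ. Qed.
Lemma peval0 x : peval (0 : bipoly R) x = 0.
Proof. exact: meval0. Qed.
Lemma peval1 x : peval (1 : bipoly R) x = 1.
Proof. exact: meval1. Qed.
Lemma pevalX p k x : peval (p ^+ k) x = peval p x ^+ k.
Proof.
elim: k => [|k IH]; first by rewrite !expr0 peval1.
by rewrite !exprS pevalM IH.
Qed.
Lemma peval_suml I (r : seq I) (F : I -> bipoly R) x :
  peval (\sum_(i <- r) F i) x = \sum_(i <- r) peval (F i) x.
Proof. by elim/big_ind2 : _ => [|? ? ? ? <- <-|//]; rewrite ?peval0 ?pevalD. Qed.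
Lemma peval_prod I (r : seq I) (F : I -> bipoly R) x :
  peval (\prod_(i <- r) F i) x = \prod_(i <- r) peval (F i) x.
Proof. by elim/big_ind2 : _ => [|? ? ? ? <- <-|//]; rewrite ?peval1 ?pevalM. Qed.

Lemma line_poly_sum p a u : line_poly p a u = \sum_(m <- msupp p)
  mcoeff m p *: ((a.1%:P + u.1 *: 'X) ^+ m ord0 * (a.2%:P + u.2 *: 'X) ^+ m ord_max).
Proof.
rewrite /line_poly /mmap; apply: eq_bigr => m _.
rewrite mul_polyC /mmap1 big_ord_recl big_ord1 /=; congr (_ *: (_ ^+ _ * _ ^+ m _)).
exact/val_inj.
Qed.

Lemma line_poly_eval p a u t : (line_poly p a u).[t] = peval p (a + t *: u).
Proof.
rewrite line_poly_sum peval_sum horner_sum; apply: eq_bigr => m _.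
by rewrite !(hornerZ, hornerM, horner_exp, hornerE) (mulrC _ t) (mulrC _ t).
Qed.

Lemma size_line_poly k p a u : deg_le k p -> (size (line_poly p a u) <= k.+1)%N.
Proof.
move=> pk; rewrite line_poly_sum (leq_trans (size_sum _ _ _)) //.
rewrite big_seq; apply/bigmax_leqP_seq => m _ mp.
rewrite (leq_trans (size_scale_leq _ _)) //.
have s1 (b v : R) : (size (b%:P + v *: 'X)%R <= 2)%N.
  rewrite (leq_trans (size_polyD _ _)) // geq_max (leq_trans (size_polyC_leq1 _)) //=.
  by rewrite (leq_trans (size_scale_leq _ _)) // size_polyX.
have s2 n (b v : R) : (size ((b%:P + v *: 'X) ^+ n)%R <= n.+1)%N.
  rewrite (leq_trans (size_poly_exp_leq _ _)) // ltnS.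
  rewrite -[leqRHS]mul1n leq_mul2r; apply/orP; right.
  by have := s1 b v; case: size.
rewrite (leq_trans (size_polyMleq _ _)) //.
have := msize_mdeg_lt mp => /leq_trans/(_ pk).
have -> : mdeg m = (m ord0 + m ord_max)%N.
  rewrite mdegE big_ord_recl big_ord1; congr (_ + m _)%N; exact/val_inj.
have := s2 (m ord0) a.1 u.1; have := s2 (m ord_max) a.2 u.2.
move: (size _) (size _) => s3 s4; move: (m ord0) (m ord_max) => m0 m1.
rewrite !ltnS => h1 h2 h3.
by rewrite -subn1 leq_subLR add1n (leq_trans (leq_add h2 h1)) // addSn addnS !ltnS.
Qed.

Lemma line_poly_morph p q a u c :
  (line_poly (c *: p + q) a u = c *: line_poly p a u + line_poly q a u) *
  (line_poly (p * q) a u = line_poly p a u * line_poly q a u).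
Proof.
(* over an infinite field a polynomial is determined by its values *)
have ext (f g : {poly R}) : (forall t, f.[t] = g.[t]) -> f = g.
  move=> fg; apply/eqP; rewrite -subr_eq0; apply/eqP.
  apply: (@roots_geq_poly_eq0 _ _ [seq i%:R | i <- iota 0 (size (f - g))]).
  - by apply/allP => t _; rewrite rootE !hornerE fg subrr.
  - by rewrite map_inj_uniq ?iota_uniq // => i j /eqP; rewrite eqr_nat => /eqP.
  - by rewrite size_map size_iota.
by split; apply: ext => t; rewrite ?(hornerD, hornerM, hornerZ) !line_poly_eval
  ?pevalD ?pevalM ?pevalZ.
Qed.

Lemma line_polyD p q a u : line_poly (p + q) a u = line_poly p a u + line_poly q a u.
Proof. by have [+ _] := line_poly_morph p q a u 1; rewrite !scale1r. Qed.
Lemma line_polyZ c p a u : line_poly (c *: p) a u = c *: line_poly p a u.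
Proof.
have [+ _] := line_poly_morph p 0 a u c; rewrite addr0 => ->.
by rewrite [line_poly 0 _ _]raddf0 addr0.
Qed.
Lemma line_polyM p q a u : line_poly (p * q) a u = line_poly p a u * line_poly q a u.
Proof. by have [_] := line_poly_morph p q a u 1. Qed.

(** Chain rule. *)
Lemma deriv_line_poly p a u :
  (line_poly p a u)^`() = u.1 *: line_poly (dx p) a u + u.2 *: line_poly (dy p) a u.
Proof.
elim/mpolyind: p => [|c m p _ _ IH].
  by rewrite /dx /dy !mderiv0 [line_poly 0 _ _]raddf0 deriv0 !scaler0 addr0.
have lX (m' : multinom 2) : line_poly (mpolyX R m') a u =
   (a.1%:P + u.1 *: 'X) ^+ m' ord0 * (a.2%:P + u.2 *: 'X) ^+ m' ord_max.
  rewrite /line_poly mmapX /mmap1 big_ord_recl big_ord1 /=; congr (_ ^+ _ * _ ^+ m' _).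
  exact/val_inj.
rewrite line_polyD line_polyZ derivD IH derivZ lX.
rewrite /dx /dy !mderivD !mderivZ !mderivX !line_polyD !line_polyZ !lX !mnmBE !mnm1E /=.
rewrite !subn0 !subn1 derivM !deriv_exp !derivD !derivC !derivZ !derivX !add0r.
rewrite -[_ *+ m ord0]mulr_natl -[_ *+ m ord_max]mulr_natl -!mul_polyC.
move: (line_poly _ _ _) (line_poly _ _ _) (_ ^+ _) (_ ^+ _) (_ ^+ _) (_ ^+ _) => l1
  l2 e1 e2 e3 e4.
by rewrite !polyC_natr; ring.
Qed.

Definition affine_poly (c : R) (v : R * R) : bipoly R :=
  mpolyC 2 c + (v.1 *: mpolyX R (mnm1 ord0) + v.2 *: mpolyX R (mnm1 ord_max)).

Lemma affine_poly_eval c v x : peval (affine_poly c v) x = c + dot v x.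
Proof. by rewrite /affine_poly /peval !mevalD !mevalZ mevalC !mevalXU. Qed.

Lemma deg_leW k l p : (k <= l)%N -> deg_le k p -> deg_le l p.
Proof. by move=> kl /leq_trans; apply; rewrite ltnS. Qed.

Lemma deg_leD k p q : deg_le k p -> deg_le k q -> deg_le k (p + q).
Proof.
move=> pk qk; rewrite /deg_le (leq_trans (msizeD_le _ _)) // geq_max.
exact/andP.
Qed.

Lemma deg_leZ k c p : deg_le k p -> deg_le k (c *: p).
Proof. exact/leq_trans/msizeZ_le. Qed.

Lemma deg_leM k l p q : deg_le k p -> deg_le l q -> deg_le (k + l) (p * q).
Proof.
rewrite /deg_le; have [->|p0] := eqVneq p 0; first by rewrite mul0r msize0.
have [->|q0] := eqVneq q 0; first by rewrite mulr0 msize0.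
move=> pk ql; rewrite msizeM //; have := leq_add pk ql.
by rewrite addnS addSn; case: addn.
Qed.

Lemma deg_le0 k : deg_le k (0 : bipoly R).
Proof. by rewrite /deg_le msize0. Qed.

Lemma deg_le1 k : deg_le k (1 : bipoly R).
Proof. by rewrite /deg_le msize1. Qed.

Lemma deg_le_affine_poly c v : deg_le 1 (affine_poly c v).
Proof.
apply: deg_leD; first by rewrite /deg_le msizeC; case: eqP.
by apply: deg_leD; apply: deg_leZ; rewrite /deg_le msizeX mdeg1.
Qed.

Lemma deg_le_prod I (r : seq I) (F : I -> bipoly R) :
  (forall i, deg_le 1 (F i)) -> deg_le (size r) (\prod_(i <- r) F i).
Proof.
move=> F1; elim: r => [|i r IH]; first by rewrite big_nil; exact: deg_le1.
by rewrite big_cons /= -[(size r).+1]add1n; apply: deg_leM.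
Qed.

Lemma deg_le_sum I (r : seq I) (P : pred I) (F : I -> bipoly R) k :
  (forall i, P i -> deg_le k (F i)) -> deg_le k (\sum_(i <- r | P i) F i).
Proof.
move=> Fk; apply: (big_ind (deg_le k)) => //; first exact: deg_le0.
by move=> *; exact: deg_leD.
Qed.

Lemma deg_le_mderiv k (i : 'I_2) p : deg_le k p -> deg_le k.-1 (mderiv i p).
Proof.
move=> pk; rewrite {1}(mpolyE p) raddf_sum /= big_seq; apply: deg_le_sum => m mp.
rewrite mderivZ; apply: deg_leZ; rewrite mderivX.
have [->|m0] := eqVneq (m i) 0%N; first by rewrite scale0r; exact: deg_le0.
apply: deg_leZ; rewrite /deg_le msizeX.
have := leq_trans (msize_mdeg_lt mp) pk.
rewrite -{1}(@submK _ (mnm1 i) m) ?lep1mP // mdegD mdeg1 addn1.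
by case: k {pk}.
Qed.

(** The composition of g with an affine coordinate tau extends g from the line on
which tau is the parameter to the plane, without raising the degree. *)
Definition extend (g : {poly R}) (tau : bipoly R) : bipoly R :=
  \sum_(i < size g) g`_i *: tau ^+ i.

Lemma peval_extend g tau x : peval (extend g tau) x = g.[peval tau x].
Proof.
rewrite /extend peval_suml horner_coef; apply: eq_bigr => i _.
by rewrite pevalZ pevalX.
Qed.

Lemma deg_le_extend k (g : {poly R}) tau : (size g <= k.+1)%N -> deg_le 1 tau ->
  deg_le k (extend g tau).
Proof.
move=> gk t1; apply: deg_le_sum => i _; apply: deg_leZ.
apply: (@deg_leW i); first by rewrite -ltnS (leq_trans (ltn_ord i)).
elim: (nat_of_ord i) => [|n IH]; first by rewrite expr0; exact: deg_le1.
by rewrite exprS -add1n; exact: deg_leM.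
Qed.

Lemma peval_bounded p (B : R) : exists K : R, forall x,
  `|x.1| <= B -> `|x.2| <= B -> `|peval p x| <= K.
Proof.
exists (\sum_(m <- msupp p) `|mcoeff m p| * (B ^+ m ord0 * B ^+ m ord_max)).
move=> x x1 x2; rewrite peval_sum (le_trans (ler_norm_sum _ _ _)) //.
apply: ler_sum => m _; rewrite !normrM !normrX.
by rewrite ler_wpM2l // ler_pM ?exprn_ge0 // lerXn2r ?nnegrE // (le_trans _ x1).
Qed.

Lemma measurable_peval p : measurable_fun setT (peval p).
Proof.
have -> : peval p = (fun x => \sum_(m <- msupp p)
    mcoeff m p * (x.1 ^+ m ord0 * x.2 ^+ m ord_max)).
  by apply/funext => x; rewrite peval_sum.
apply: measurable_sum => m.
apply: measurable_funM; first exact: measurable_cst.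
by apply: measurable_funM; apply: measurable_funX.
Qed.
End bivariate.

(** * The Euclidean plane *)

Section plane_topology.
Variable R : realType.
Implicit Types (x y u v n : R * R) (e f : (R * R) * (R * R))
  (T : set (R * R)) (t a b c : R).

Lemma dotDl u v n : dot (u + v) n = dot u n + dot v n.
Proof. by rewrite /dot /=; ring. Qed.
Lemma dotDr n u v : dot n (u + v) = dot n u + dot n v.
Proof. by rewrite /dot /=; ring. Qed.
Lemma dotZl c u n : dot (c *: u) n = c * dot u n.
Proof. by rewrite /dot /= /GRing.scale /=; ring. Qed.
Lemma dotZr c u n : dot u (c *: n) = c * dot u n.
Proof. by rewrite /dot /= /GRing.scale /=; ring. Qed.
Lemma dotNl u n : dot (- u) n = - dot u n.
Proof. by rewrite /dot /=; ring. Qed.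
Lemma dotNr u n : dot u (- n) = - dot u n.
Proof. by rewrite /dot /=; ring. Qed.
Lemma dotBr n u v : dot n (u - v) = dot n u - dot n v.
Proof. by rewrite dotDr dotNr. Qed.
Lemma dotBl u v n : dot (u - v) n = dot u n - dot v n.
Proof. by rewrite dotDl dotNl. Qed.
Lemma dotC u v : dot u v = dot v u.
Proof. by rewrite /dot; ring. Qed.
Lemma dot_ge0 u : 0 <= dot u u.
Proof. by rewrite /dot -!expr2 addr_ge0 ?sqr_ge0. Qed.
Lemma enorm_ge0 u : 0 <= enorm u.
Proof. exact: sqrtr_ge0. Qed.
Lemma enorm_sqr u : enorm u ^+ 2 = dot u u.
Proof. by rewrite sqr_sqrtr // dot_ge0. Qed.
Lemma dot_eq0 u : dot u u = 0 -> u = 0.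
Proof.
case: u => a b; rewrite /dot /= => h.
have a0 : a = 0 by nra.
have b0 : b = 0 by nra.
by rewrite a0 b0.
Qed.
Lemma enorm_eq0 u : enorm u = 0 -> u = 0.
Proof. by move=> h; apply: dot_eq0; rewrite -enorm_sqr h expr0n. Qed.
Lemma enorm_gt0 u : u != 0 -> 0 < enorm u.
Proof.
move=> u0; rewrite lt_neqAle enorm_ge0 andbT eq_sym.
by apply: contraNneq u0 => /enorm_eq0 ->.
Qed.
Lemma enormZ c u : enorm (c *: u) = `|c| * enorm u.
Proof.
rewrite /enorm dotZl dotZr mulrA -expr2 sqrtrM ?sqr_ge0 //.
by rewrite sqrtr_sqr.
Qed.
Lemma enormN u : enorm (- u) = enorm u.
Proof. by rewrite /enorm dotNl dotNr opprK. Qed.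
Lemma cauchy_schwarz u v : `|dot u v| <= enorm u * enorm v.
Proof.
rewrite -(ler_pXn2r (n := 2)) ?nnegrE ?mulr_ge0 ?enorm_ge0 //.
rewrite -normrX ger0_norm ?sqr_ge0 // exprMn !enorm_sqr /dot.
have : 0 <= (u.1 * v.2 - u.2 * v.1) ^+ 2 by exact: sqr_ge0.
by nra.
Qed.
Lemma enormD u v : enorm (u + v) <= enorm u + enorm v.
Proof.
rewrite -(ler_pXn2r (n := 2)) ?nnegrE ?addr_ge0 ?enorm_ge0 //.
rewrite sqrrD !enorm_sqr dotDl !dotDr.
have /ler_normlP[_] := cauchy_schwarz u v; rewrite (dotC v u).
by rewrite -mulr_natl; lra.
Qed.
Lemma enorm_coord u : (`|u.1| <= enorm u) * (`|u.2| <= enorm u).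
Proof.
split; rewrite -(ler_pXn2r (n := 2)) ?nnegrE ?enorm_ge0 //
  -normrX ger0_norm ?sqr_ge0 // enorm_sqr /dot -!expr2.
  by rewrite lerDl sqr_ge0.
by rewrite lerDr sqr_ge0.
Qed.
Lemma enorm_le u a : `|u.1| <= a -> `|u.2| <= a -> enorm u <= 2 * a.
Proof.
move=> u1 u2; have a0 : 0 <= a by apply: le_trans u1.
rewrite -(ler_pXn2r (n := 2)) ?nnegrE ?enorm_ge0 ?mulr_ge0 // enorm_sqr /dot.
have := lerXn2r 2 (normr_ge0 u.1) a0 u1; have := lerXn2r 2 (normr_ge0 u.2) a0 u2.
rewrite -!normrX !ger0_norm ?sqr_ge0 //; nra.
Qed.

Lemma seg_pointE e t : seg_point e t = e.1 + t *: dir e.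
Proof. by []. Qed.
Lemma seg_point0 e : seg_point e 0 = e.1.
Proof. by rewrite /seg_point scale0r addr0. Qed.
Lemma seg_point1 e : seg_point e 1 = e.2.
Proof. by rewrite /seg_point scale1r /dir addrC subrK. Qed.

Lemma interior_box T x : T° x <-> exists2 eps : R, 0 < eps &
  forall y, `|y.1 - x.1| < eps -> `|y.2 - x.2| < eps -> T y.
Proof.
rewrite /interior -nbhs_ballE; split=> [[eps /= e0 xT]|[eps e0 xT]].
  exists eps => // y y1 y2; apply: xT.
  by split => /=; rewrite /ball /= distrC.
exists eps => //= y [y1 y2]; apply: xT.
  by rewrite distrC.
by rewrite distrC.
Qed.

Lemma interior_line T x u : T° x -> exists2 eps : R, 0 < eps &
  forall t, `|t| < eps -> T (x + t *: u).
Proof.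
move=> /interior_box[eps e0 H].
have k0 : 0 < 1 + enorm u by rewrite ltr_pwDl ?enorm_ge0.
exists (eps / (1 + enorm u)); first by rewrite divr_gt0.
move=> t; rewrite ltr_pdivlMr // => te.
have h c : `|c| <= enorm u -> `|t * c| < eps.
  move=> cu; rewrite normrM; apply: le_lt_trans te.
  by rewrite ler_wpM2l // (le_trans cu) // lerDr.
by apply: H => /=; rewrite addrC addKr; apply: h; rewrite enorm_coord.
Qed.

Lemma convex_line T x y t : convex_set T -> T x -> T y -> 0 <= t <= 1 ->
  T (x + t *: (y - x)).
Proof.
move=> cT Tx Ty /andP[t0 t1].
have := cT y x (Itv01 t0 t1); rewrite !inE => /(_ Ty Tx).
suff -> : conv (Itv01 t0 t1) (y : convex_lmodType (R * R)%type) x =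
  x + t *: (y - x) by [].
by rewrite /conv /= /unstable.onem scalerBl scale1r scalerBr addrCA.
Qed.

Definition lnormal e : R * R := (len e)^-1 *: (- (dir e).2, (dir e).1).

Lemma len_gt0 e : e.1 != e.2 -> 0 < len e.
Proof. by move=> e12; apply: enorm_gt0; rewrite /dir subr_eq0 eq_sym. Qed.

Lemma lnormal_unit e : e.1 != e.2 -> dot (lnormal e) (lnormal e) = 1.
Proof.
move=> /len_gt0 l0; have := enorm_sqr (dir e); rewrite -/(len e).
rewrite /lnormal dotZl dotZr => h.
have -> : dot (- (dir e).2, (dir e).1) (- (dir e).2, (dir e).1) = len e ^+ 2.
  by rewrite h; case: (dir e) => a b; rewrite /dot /=; ring.
by field; rewrite gt_eqF.
Qed.

Lemma lnormal_dir e : dot (lnormal e) (dir e) = 0.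
Proof. by rewrite /lnormal dotZl /dot /=; ring. Qed.

(** Coordinates in the orthogonal frame with origin e.1 and axes dir e, n. *)
Lemma normal_decomp e n x : e.1 != e.2 -> dot n n = 1 -> dot n (dir e) = 0 ->
  x = e.1 + (dot (x - e.1) (dir e) / len e ^+ 2) *: dir e + dot (x - e.1) n *: n.
Proof.
move=> e12 n1 nd; have l0 := len_gt0 e12; have := enorm_sqr (dir e).
rewrite -/(len e) => h.
suff : forall z, z = (dot z (dir e) / len e ^+ 2) *: dir e + dot z n *: n.
  by move=> /(_ (x - e.1)) hz; rewrite -addrA -hz addrC subrK.
have l2 : len e ^+ 2 != 0 by rewrite expf_neq0 // gt_eqF.
move=> z; apply/eqP; rewrite -subr_eq0; set r := z - _; apply/eqP.
have rd : dot r (dir e) = 0.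
  rewrite /r dotDl dotNl dotDl !dotZl nd mulr0 addr0 -h divfK ?subrr //.
have rn : dot r n = 0.
  by rewrite /r dotDl dotNl dotDl !dotZl (dotC (dir e)) nd n1; ring.
move: rd rn nd n1 h; case: (r) => a b; case: (n) => n1 n2; case: (dir e) => d1 d2.
rewrite /dot /= => rd rn nd nn h.
have D : (d1 * n2 - d2 * n1) ^+ 2 = len e ^+ 2.
  have -> : (d1 * n2 - d2 * n1) ^+ 2 =
   (d1*d1+d2*d2)*(n1*n1+n2*n2) - (n1*d1+n2*d2)^+2 by ring.
  by rewrite nn nd -h; ring.
have D0 : d1 * n2 - d2 * n1 != 0 by rewrite -sqrf_eq0 D.
have ha : a * (d1 * n2 - d2 * n1) = 0.
  have -> : a * (d1 * n2 - d2 * n1) =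
    (a * d1 + b * d2) * n2 - (a * n1 + b * n2) * d2 by ring.
  by rewrite rd rn; ring.
have hb : b * (d1 * n2 - d2 * n1) = 0.
  have -> : b * (d1 * n2 - d2 * n1) =
    (a * n1 + b * n2) * d1 - (a * d1 + b * d2) * n1 by ring.
  by rewrite rd rn; ring.
by move/eqP: ha; rewrite mulf_eq0 (negbTE D0) orbF => /eqP ->;
   move/eqP: hb; rewrite mulf_eq0 (negbTE D0) orbF => /eqP ->.
Qed.

Lemma normal_decompv e n z : e.1 != e.2 -> dot n n = 1 -> dot n (dir e) = 0 ->
  z = (dot z (dir e) / len e ^+ 2) *: dir e + dot z n *: n.
Proof.
move=> e12 n1 nd; have := normal_decomp (e.1 + z) e12 n1 nd.
by rewrite (addrC e.1 z) addrK (addrC z) -addrA => /addrI.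
Qed.

(** By convexity T contains the triangle with base e and apex x, hence a small box
with one side on e around its midpoint; the sign of b selects the side of x. *)
Lemma triangle_nbhd T e n x : convex_set T -> e.1 != e.2 -> dot n n = 1 ->
  dot n (dir e) = 0 -> T e.1 -> T e.2 -> T x -> dot (x - e.1) n != 0 ->
  exists2 dlt : R, 0 < dlt & forall a b, `|a - 2^-1| <= dlt ->
    0 <= b / dot (x - e.1) n <= dlt -> T (e.1 + a *: dir e + b *: n).
Proof.
move=> cT e12 n1 nd T1 T2 Tx; have := normal_decomp x e12 n1 nd.
set al := _ / _; set be := dot _ n => xE be0.
have al0 := normr_ge0 al.
exists (2 * (2 + `|al|))^-1; first by rewrite invr_gt0; lra.
move=> a b; set dlt := (2 * _)^-1; set s := b / be => ha /andP[s0 s1].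
have dltE : dlt * (2 + `|al|) = 2^-1.
  by rewrite /dlt invfM -mulrA mulVf ?mulr1 // gt_eqF //; lra.
have d0 : 0 <= dlt by apply: le_trans s1.
have sal : `|s * al| <= dlt * `|al|.
  by rewrite normrM ler_wpM2r // ger0_norm.
have s12 : s <= 2^-1 by nra.
have s1' : 1 - s != 0 by apply/eqP; lra.
(* The target point divides the segment from the point of parameter tau on e to
   x in the ratio s : 1 - s. *)
pose tau := (a - s * al) / (1 - s).
have tau01 : 0 <= tau <= 1.
  move: ha sal; rewrite !ler_norml => /andP[h1 h2] /andP[h3 h4].
  by rewrite /tau; apply/andP; split; [rewrite divr_ge0 //; nra|rewrite ler_pdivrMr; nra].
have Ty : T (seg_point e tau).
  have := convex_line cT T1 T2 tau01; rewrite /seg_point /dir.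
  by [].
have s01 : 0 <= s <= 1 by lra.
have := convex_line cT Ty Tx s01; rewrite {1}xE.
have bE : b = s * be by rewrite /s divfK.
have -> : e.1 + a *: dir e + b *: n = seg_point e tau + s *:
  (e.1 + al *: dir e + be *: n - seg_point e tau); last by [].
rewrite /seg_point bE.
have taE : a = tau * (1 - s) + s * al by rewrite /tau divfK // subrK.
clearbody tau s; rewrite taE; move: (dir e) (e.1) => [d1 d2] [e1 e2]; case: (n) => m1 m2.
by congr pair; rewrite /= /GRing.scale /=; ring.
Qed.
End plane_topology.

(** * The boundary of a convex polygon *)

Section edge_list.
Variable (R : realType).
Implicit Types (s : seq (R * R)) (e : (R * R) * (R * R)).

Lemma nth_rot1 (A : eqType) (x : A) (s : seq A) i : (i < size s)%N ->
  nth x (rot 1 s) i = nth x s (i.+1 %% size s).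
Proof.
case: s => // a s; rewrite /= rot1_cons nth_rcons ltnS leq_eqVlt => /predU1P[->|i_s].
  by rewrite ltnn eqxx modnn.
by rewrite i_s modn_small // ltnS.
Qed.

Lemma size_edges_of s : size (edges_of s) = size s.
Proof. by rewrite /edges_of size_zip size_rot minnn. Qed.

Lemma nth_edges_of s i (d : R * R) : (i < size s)%N ->
  nth (d, d) (edges_of s) i = (nth d s i, nth d s (i.+1 %% size s)).
Proof.
by move=> i_s; rewrite /edges_of nth_zip ?size_rot // nth_rot1.
Qed.

Lemma next_edge s e : e \in edges_of s -> exists e',
  [/\ e' \in edges_of s, (e, e') \in zip (edges_of s) (rot 1 (edges_of s)) & e'.1 = e.2].
Proof.
move=> /(nthP (0, 0))[i]; rewrite size_edges_of => i_s eE.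
have n0 : (0 < size s)%N by apply: leq_trans i_s.
exists (nth (0, 0) (edges_of s) (i.+1 %% size s)); split.
- by rewrite mem_nth // size_edges_of ltn_mod.
- apply/(nthP ((0, 0), (0, 0))); exists i.
    by rewrite size_zip size_rot minnn size_edges_of.
  by rewrite nth_zip ?size_rot // nth_rot1 ?size_edges_of // eE.
- by rewrite -eE !nth_edges_of // ltn_mod.
Qed.

Lemma prev_edge s e : e \in edges_of s -> exists e',
  [/\ e' \in edges_of s, (e', e) \in zip (edges_of s) (rot 1 (edges_of s)) & e'.2 = e.1].
Proof.
move=> /(nthP (0, 0))[i]; rewrite size_edges_of => i_s eE.
have n0 : (0 < size s)%N by apply: leq_trans i_s.
pose k := ((i + (size s).-1) %% size s)%N.
have ki : (k.+1 %% size s = i)%N.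
  rewrite /k -addn1 modnDml addn1 -addnS prednK // addnC.
  by rewrite -[X in (X + i)%N]mul1n modnMDl modn_small.
have ks : (k < size s)%N by rewrite ltn_mod.
exists (nth (0, 0) (edges_of s) k); split.
- by rewrite mem_nth // size_edges_of.
- apply/(nthP ((0, 0), (0, 0))); exists k.
    by rewrite size_zip size_rot minnn size_edges_of.
  by rewrite nth_zip ?size_rot // nth_rot1 ?size_edges_of // ki eE.
- by rewrite -eE !nth_edges_of //= ki.
Qed.

Lemma edge_neq s e : (3 <= size s)%N -> uniq s -> e \in edges_of s -> e.1 != e.2.
Proof.
move=> s3 us /(nthP (0, 0))[i]; rewrite size_edges_of => i_s <-.
rewrite nth_edges_of //= nth_uniq // ?ltn_mod ?(leq_trans _ s3) //.
have : (i.+1 <= size s)%N by [].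
rewrite leq_eqVlt => /predU1P[h|h]; last by rewrite modn_small // neq_ltn leqnn.
by rewrite h modnn; move: s3; rewrite -h; case: (i).
Qed.

Lemma uniq_edges_of s : uniq s -> uniq (edges_of s).
Proof.
move=> us; have : uniq (unzip1 (edges_of s)) by rewrite unzip1_zip // size_rot.
exact: map_uniq.
Qed.
End edge_list.

Lemma half01 (R : realType) : (0 : R) <= (2^-1 : R) <= 1.
Proof. by rewrite invr_ge0 ler0n invf_le1 ?ler1n. Qed.

Lemma seg_pointB (R : realType) (e : (R * R) * (R * R)) (t : R) :
  seg_point e t - e.1 = t *: dir e.
Proof. by rewrite /seg_point addrC addKr. Qed.

Section convex_polygon.
Variables (R : realType) (P : polygon R).
Implicit Types (x y u v n : R * R) (e f : (R * R) * (R * R)) (t a b c : R).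
Let T := region P.
Let E := edges P.
Hypothesis cT : convex_set T.

Lemma edge_ne e : e \in E -> e.1 != e.2.
Proof.
by have [/andP[s3 us] _ _ _ _] := polygonP P; exact: edge_neq.
Qed.

Lemma uniq_edges : uniq E.
Proof. by have [/andP[s3 us] _ _ _ _] := polygonP P; exact: uniq_edges_of. Qed.

Lemma region_closed : closed T.
Proof.
by have [_ _ cpt _ _] := polygonP P; apply: compact_closed.
Qed.

Lemma frontierE x : frontier T x <-> T x /\ ~ T° x.
Proof.
by rewrite /frontier; have /closure_id <- := region_closed.
Qed.

Lemma frontier_edge x : frontier T x <-> exists e t, [/\ e \in E, 0 <= t <= 1 &
  x = seg_point e t].
Proof.
have [_ _ _ _ fE] := polygonP P; rewrite -/T in fE; rewrite fE; split.
  move=> [e /= eE [t /=]]; rewrite in_itv /= => t01 <-.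
  by exists e, t.
move=> [e [t [eE t01 ->]]]; by exists e => //; exists t.
Qed.

Lemma edge_in e t : e \in E -> 0 <= t <= 1 -> T (seg_point e t) /\ ~ T° (seg_point e t).
Proof.
move=> eE t01; apply/frontierE/frontier_edge; by exists e, t.
Qed.

Lemma edge_end e : e \in E -> T e.1 /\ T e.2.
Proof.
move=> eE; split; [rewrite -(seg_point0 e)|rewrite -(seg_point1 e)];
  by apply: (edge_in eE _).1; rewrite ?lexx ?ler01.
Qed.

Lemma region_bounded : exists B : R, forall x, T x -> `|x.1| <= B /\ `|x.2| <= B.
Proof.
have [_ _ cpt _ _] := polygonP P.
have [M [_ H]] := compact_bounded cpt.
exists (M + 1) => x Tx; have := H (M + 1); rewrite ltrDl ltr01 => /(_ isT x Tx).
by rewrite /Num.norm /= ge_max => /andP[].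
Qed.

Lemma edges_simple e f x : e \in E -> f \in E -> e != f ->
  closed_segment e x -> closed_segment f x ->
  (x = e.1 \/ x = e.2) /\ (x = f.1 \/ x = f.2).
Proof.
move=> eE fE ef ex fx; have [_ sc _ _ _] := polygonP P.
by have /(_ (conj ex fx)) [] := sc e f eE fE ef x.
Qed.

(** An edge line supports the region: with points of T on both sides of it, two
triangles over e would make the midpoint of e an interior point, whereas edges
consist of frontier points. *)
Lemma one_side e x y : e \in E -> T x -> T y ->
  0 < dot (x - e.1) (lnormal e) -> dot (y - e.1) (lnormal e) < 0 -> False.
Proof.
move=> eE Tx Ty bx by_; have e12 := edge_ne eE; have [T1 T2] := edge_end eE.
have l0 := len_gt0 e12.
have nn := lnormal_unit e12; have nd := lnormal_dir e.
have [d1 d10 H1] := triangle_nbhd cT e12 nn nd T1 T2 Tx (lt0r_neq0 bx).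
have [d2 d20 H2] := triangle_nbhd cT e12 nn nd T1 T2 Ty (ltr0_neq0 by_).
have half : (0 : R) <= (2^-1 : R) <= 1 by exact: half01.
apply: (edge_in eE half).2; apply/interior_box.
move: bx by_ H1 H2; set b1 := dot (x - _) _; set b2 := dot (y - _) _.
move=> b10 b20 H1 H2.
exists (Num.min (Num.min d1 d2 * len e) (Num.min (d1 * b1) (d2 * - b2)) / 2).
  by rewrite divr_gt0 // !lt_min !mulr_gt0 ?lt_min ?d10 ?oppr_gt0.
set ep := _ / 2 => z z1 z2.
have ep1 : 2 * ep <= d1 * len e.
  by rewrite /ep mulrC divfK // !ge_min ler_pM2r // ge_min lexx.
have ep2 : 2 * ep <= d2 * len e.
  by rewrite /ep mulrC divfK // !ge_min ler_pM2r // ge_min lexx orbT.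
have ep3 : 2 * ep <= d1 * b1.
  by rewrite /ep mulrC divfK // !ge_min lexx orbT.
have ep4 : 2 * ep <= d2 * - b2.
  by rewrite /ep mulrC divfK // !ge_min lexx !orbT.
have nz : enorm (z - seg_point e 2^-1) <= 2 * ep.
  by apply: enorm_le; exact: ltW.
(* z is reached from the triangle over e with apex x or from the one with apex
   y, according to the side of e on which it lies. *)
rewrite (normal_decomp z e12 nn nd).
set a := dot _ _ / _; set b := dot _ _.
have lnu : enorm (lnormal e) = 1 by rewrite /enorm nn sqrtr1.
have zE : z - seg_point e 2^-1 = (z - e.1) - 2^-1 *: dir e.
  by rewrite /seg_point opprD addrA.
have bE : b = dot (z - seg_point e 2^-1) (lnormal e).
  by rewrite zE (dotBl (z - e.1)) dotZl (dotC (dir e)) nd mulr0 subr0.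
have aE : a - 2^-1 = dot (z - seg_point e 2^-1) (dir e) / len e ^+ 2.
  rewrite zE (dotBl (z - e.1)) dotZl -enorm_sqr mulrBl -/(len e).
  by rewrite mulfK // expf_neq0 // gt_eqF.
have ba : `|b| <= 2 * ep.
  by rewrite bE (le_trans (cauchy_schwarz _ _)) // lnu mulr1.
have aa : `|a - 2^-1| * len e <= 2 * ep.
  rewrite aE normrM normfV normrX (gtr0_norm l0).
  apply: le_trans nz; rewrite expr2 invfM mulrA divfK ?gt_eqF //.
  by rewrite ler_pdivrMr // cauchy_schwarz.
have [b0|b0] := leP 0 b.
  apply: H1.
    by rewrite -(ler_pM2r l0) (le_trans aa).
  rewrite divr_ge0 //=; last exact: ltW.
  by rewrite ler_pdivrMr // (le_trans _ ep3) // (le_trans (ler_norm _)).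
apply: H2.
  by rewrite -(ler_pM2r l0) (le_trans aa).
rewrite -[b]opprK -[b2]opprK invrN mulrNN divr_ge0 /= ?oppr_ge0; [|exact: ltW..].
rewrite ler_pdivrMr ?oppr_gt0 // (le_trans _ ep4) // (le_trans _ ba) //.
by rewrite -normrN ler_norm.
Qed.

Notation nrm e := (outward_normal T e).

Lemma interior_point : exists x, T° x.
Proof. by have [_ _ _ [x xT] _] := polygonP P; exists x. Qed.

(** The pointwise condition that defines an outward normal gives, on a convex
region, a half plane that contains the region; this is the form used from now on. *)
Lemma outward_normalP e : e \in E ->
  [/\ dot (nrm e) (nrm e) = 1, dot (nrm e) (dir e) = 0 &
      forall x, T x -> dot (nrm e) (x - e.1) <= 0].
Proof.
move=> eE; have e12 := edge_ne eE; have [T1 T2] := edge_end eE.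
have nn := lnormal_unit e12; have nd := lnormal_dir e.
have [n [n1 n2 nT]] : exists n, [/\ dot n n = 1, dot n (dir e) = 0 &
    forall x, T x -> dot n (x - e.1) <= 0].
  have [H|/existsNP[x /not_implyP[Tx /negP]]] :=
      pselect (forall x, T x -> dot (x - e.1) (lnormal e) <= 0).
    by exists (lnormal e); split => // x Tx; rewrite dotC; exact: H.
  rewrite -ltNge => xx; exists (- lnormal e); split.
  - by rewrite dotNl dotNr opprK.
  - by rewrite dotNl nd oppr0.
  - move=> y Ty; rewrite dotNl oppr_le0 dotC leNgt; apply/negP => yy.
    exact: one_side eE Tx Ty xx yy.
have ex : is_outward_normal T e n.
  split => //; first by rewrite /enorm n1 sqrtr1.
  move=> _ [s /= _ <-]; near=> t => Tx.
  have t0 : 0 < t by near: t; exact: nbhs_right_gt.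
  have := nT _ Tx; rewrite addrAC seg_pointB.
  by rewrite dotDr !dotZr n2 n1 mulr0 add0r mulr1 leNgt t0.
have [N1 N2 N3] : is_outward_normal T e (nrm e) by exact: (xgetPex 0 (ex_intro _ n ex)).
have NN : dot (nrm e) (nrm e) = 1 by rewrite -enorm_sqr N1 expr1n.
split => // x Tx.
(* The chosen normal is n or - n. The second is impossible: T has points
   arbitrarily close to the middle of e on the side of - n. *)
have Nn : nrm e = dot (nrm e) n *: n.
  have := normal_decomp (e.1 + nrm e) e12 n1 n2.
  by rewrite [e.1 + nrm e]addrC addrK N2 mul0r scale0r addr0 addrC => /addrI.
suff c0 : 0 <= dot (nrm e) n by rewrite Nn dotZl mulr_ge0_le0 // nT.
rewrite leNgt; apply/negP => c0.
have [z /interior_subset Tz] := interior_point.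
have [z0 iz0] := interior_point.
have zpos : dot (z0 - e.1) n < 0.
  have [eps eps0 H] := interior_line n iz0.
  have := nT _ (H (eps / 2) _); rewrite gtr0_norm ?divr_gt0 // ltr_pdivrMr //
    ltr_pMr // ltr1n.
  move=> /(_ isT); rewrite addrAC dotDr dotZr n1 mulr1 dotC;
    have : 0 < eps / 2 by rewrite divr_gt0.
  by lra.
have Tz0 := interior_subset iz0.
have [d1 d10 H1] := triangle_nbhd cT e12 n1 n2 T1 T2 Tz0 (ltr0_neq0 zpos).
have half : open_segment e (seg_point e 2^-1).
  by exists 2^-1 => //=; rewrite in_itv /= invr_gt0 ltr0n invf_lt1 ?ltr1n.
have [t [t0 t1 Ht]] : exists t, [/\ 0 < t,
  t * - dot (nrm e) n <= d1 * - dot (z0 - e.1) n &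
   ~ T (seg_point e 2^-1 + t *: nrm e)].
  near (0 : R)^'+ => t; exists t; split.
  - by near: t; exact: nbhs_right_gt.
  - rewrite -ler_pdivlMr ?oppr_gt0 //; near: t; apply: nbhs_right_le.
    by rewrite divr_gt0 ?oppr_gt0 // mulr_gt0 // oppr_gt0.
  - by near: t; exact: N3.
apply: Ht; rewrite Nn scalerA; apply: H1.
  by rewrite subrr normr0 ltW.
rewrite -mulrNN -invrN -mulrN divr_ge0 ?mulr_ge0 ?oppr_ge0 ?(ltW c0) ?(ltW zpos)
  ?(ltW t0) //=.
by rewrite ler_pdivrMr ?oppr_gt0.
Unshelve. all: by end_near.
Qed.
End convex_polygon.

(** * Heights above the edges *)

Section heights.
Variables (R : realType) (P : polygon R).
Implicit Types (x y u v n : R * R) (e f : (R * R) * (R * R)) (t a b c : R).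

(** Distance from x to the line of e, counted positively inside. *)
Definition height e x : R := dot (outward_normal (region P) e) (e.1 - x).

Let T := region P.
Let E := edges P.
Hypothesis cT : convex_set T.

Lemma height_shift e x u : height e (x + u) = height e x - dot (outward_normal T e) u.
Proof. by rewrite /height opprD addrA (dotBr _ (e.1 - x)). Qed.

Lemma height_line e x y t : height e (x + t *: (y - x)) =
  (1 - t) * height e x + t * height e y.
Proof. by rewrite height_shift dotZr /height -/T !dotBr; ring. Qed.

Lemma height_ge0 e x : e \in E -> T x -> 0 <= height e x.
Proof.
move=> eE Tx; have [_ _ /(_ x Tx)] := outward_normalP cT eE.
by rewrite -(opprB e.1 x) dotNr oppr_le0.
Qed.

Lemma height_int e x : e \in E -> T° x -> 0 < height e x.
Proof.
move=> eE /(interior_line (outward_normal T e))[eps e0 H].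
have [nn _ _] := outward_normalP cT eE.
have h : 0 < eps / 2 by rewrite divr_gt0.
have := height_ge0 eE (H (eps / 2) _).
rewrite height_shift dotZr nn mulr1 gtr0_norm // ltr_pdivrMr // ltr_pMr // ltr1n.
by move=> /(_ isT); rewrite subr_ge0; exact: lt_le_trans.
Qed.

Lemma height_edge e t : e \in E -> height e (seg_point e t) = 0.
Proof.
move=> eE; have [_ nd _] := outward_normalP cT eE.
by rewrite height_shift dotZr nd mulr0 subr0 /height subrr -(scale0r 0) dotZr mul0r.
Qed.

Lemma height_fst e : e \in E -> height e e.1 = 0.
Proof. by move=> eE; rewrite -[X in height _ X](seg_point0 e) height_edge. Qed.

Lemma height_snd e : e \in E -> height e e.2 = 0.
Proof. by move=> eE; rewrite -[X in height _ X](seg_point1 e) height_edge. Qed.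

Lemma height_lip e x y : e \in E -> height e x - enorm (y - x) <= height e y.
Proof.
move=> eE; have [nn _ _] := outward_normalP cT eE.
rewrite -{2}(subrK x y) addrC [y - x + x]addrC height_shift addrC lerD2l lerN2.
rewrite (le_trans (ler_norm _)) // (le_trans (cauchy_schwarz _ _)) //.
by rewrite {1}/enorm nn sqrtr1 mul1r.
Qed.

(** The last point of a ray in T exists since T is compact; it is on the frontier. *)
Lemma ray_exit x u : T x -> u != 0 -> exists t : R, [/\ 0 <= t, T (x + t *: u),
  ~ T° (x + t *: u) & forall s, t < s -> ~ T (x + s *: u)].
Proof.
move=> Tx u0; pose A : set R := [set t | 0 <= t /\ T (x + t *: u)].
have A0 : A 0 by split => //; rewrite scale0r addr0.
have [B HB] := region_bounded P.
have Aub : has_ubound A.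
  have nu := enorm_gt0 u0.
  exists (2 * (`|B| + enorm x) / enorm u) => t [t0 /HB[t1 t2]].
  rewrite ler_pdivlMr // -(ger0_norm t0) -enormZ.
  have -> : t *: u = (x + t *: u) - x by rewrite addrC addKr.
  rewrite (le_trans (enormD _ _)) // enormN.
  have := enorm_le (le_trans t1 (ler_norm _)) (le_trans t2 (ler_norm _)).
  have := enorm_ge0 x; lra.
have supA : has_sup A by split => //; exists 0.
have s0 : 0 <= sup A by exact: (ub_le_sup Aub A0).
have Ts : T (x + sup A *: u).
  apply: region_closed => B2 /nbhs_ballP[eps /= e0 H2].
  have k0 : 0 < 1 + enorm u by rewrite ltr_pwDl ?enorm_ge0.
  have [|t [t0 Tt] ht] := @sup_adherent _ A (eps / (1 + enorm u)) _ supA.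
    by rewrite divr_gt0.
  exists (x + t *: u); split => //.
  apply: H2; have tA : t <= sup A by apply: ub_le_sup => //; split.
  have hc c : `|c| <= enorm u -> `|(sup A - t) * c| < eps.
    move=> cu; rewrite normrM.
    have : `|sup A - t| < eps / (1 + enorm u).
      by rewrite ger0_norm ?subr_ge0 //; lra.
    rewrite ltr_pdivlMr //; apply: le_lt_trans.
    by rewrite ler_wpM2l // (le_trans cu) // lerDr.
  have [c1 c2] := enorm_coord u.
  have := hc _ c1; have := hc _ c2.
  split; rewrite /ball /= /GRing.scale /=.
    by rewrite (_ : _ - _ = (sup A - t) * u.1) //; ring.
  by rewrite (_ : _ - _ = (sup A - t) * u.2) //; ring.
exists (sup A); split => //.
  move=> /(interior_line u)[eps e0 H].
  have e2 : 0 < eps / 2 by rewrite divr_gt0.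
  have : A (sup A + eps / 2).
    split; first by rewrite addr_ge0 // ltW.
    rewrite scalerDl addrA; apply: H.
    by rewrite gtr0_norm // ltr_pdivrMr // ltr_pMr // ltr1n.
  by move=> /(ub_le_sup Aub); lra.
move=> s ss Tss; have : A s by split => //; apply: le_trans s0 (ltW ss).
by move=> /(ub_le_sup Aub); lra.
Qed.

(** A convex polygon is the intersection of its supporting half planes. *)
Lemma regionE x : T x <-> forall e, e \in E -> 0 <= height e x.
Proof.
split; first by move=> Tx e eE; exact: height_ge0.
move=> H; have [z iz] := interior_point P.
have Tz := interior_subset iz.
have [->//|xz] := eqVneq x z.
(* Were x outside, the segment from the interior point z to x would leave T on
   some edge, where the height of that edge changes sign. *)
have [|t [t0 Tt nTt Ht]] := @ray_exit z (x - z) Tz; first by rewrite subr_eq0.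
have [t1|t1] := leP 1 t.
  have t00 : t != 0 by rewrite gt_eqF // (lt_le_trans _ t1).
  have := @convex_line _ _ _ _ t^-1 cT Tz Tt.
  rewrite (addrC z (t *: _)) addrK scalerA mulVf // scale1r addrC subrK; apply.
  by rewrite invr_ge0 t0 invf_le1 // (lt_le_trans _ t1).
have /frontier_edge[e [s [eE s01 zE]]] : frontier T (z + t *: (x - z)) by apply/frontierE.
have := height_edge s eE; rewrite -zE height_line.
have := height_int eE iz; have := H _ eE; nra.
Qed.

Lemma normal_colinear e x : e \in E -> dot x (dir e) = 0 ->
  x = dot x (outward_normal T e) *: outward_normal T e.
Proof.
move=> eE xd; have [nn nd _] := outward_normalP cT eE.
by rewrite {1}(normal_decompv x (edge_ne eE) nn nd) xd mul0r scale0r add0r.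
Qed.

Lemma normal_ortho e x : e \in E -> dot (outward_normal T e) x = 0 ->
  x = (dot x (dir e) / len e ^+ 2) *: dir e.
Proof.
move=> eE xd; have [nn nd _] := outward_normalP cT eE.
rewrite {1}(normal_decompv x (edge_ne eE) nn nd).
by rewrite (dotC x (outward_normal _ _)) xd scale0r addr0.
Qed.
End heights.

(** * Consequences of shape regularity *)

Section shape.
Variables (R : realType) (P : polygon R).
Implicit Types (x y u v n : R * R) (e f : (R * R) * (R * R)) (t a b c : R).
Let T := region P.
Let E := edges P.
Hypothesis cT : convex_set T.

Notation nrm e := (outward_normal T e).

(** Lower bound for the sine of an angle between theta0 and pi - theta0. No such
angle exists when pi / 2 <= theta0, and then any positive value does. *)
Definition sin_bound (theta0 : R) : R := if theta0 < pi / 2 then sin theta0 else 1.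

Lemma sin_bound_gt0 th : 0 < th -> 0 < sin_bound th.
Proof.
move=> th0; rewrite /sin_bound; case: ifP => // h; apply: sin_gt0_pi.
by rewrite th0 (lt_le_trans h) // ler_pdivrMr // ler_pMr ?pi_gt0 // ler1n.
Qed.

Lemma cos_bound th c : 0 < th -> `|c| <= 1 -> th < acos c < pi - th ->
  c ^+ 2 <= 1 - sin_bound th ^+ 2.
Proof.
move=> th0 c1 /andP[h1 h2].
have c11 : c \in `[-1, 1] by rewrite in_itv /= -ler_norml.
have h3 : th < pi / 2 by lra.
have p0 := pi_gt0 R.
rewrite /sin_bound h3 -(@cos2sin2 _ th).
rewrite -(ger0_norm (sqr_ge0 c)) -(ger0_norm (sqr_ge0 (cos th))) !normrX.
rewrite lerXn2r ?nnegrE //.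
have ac : acos c \in `[0, pi] by rewrite in_itv /= acos_ge0 ?acos_lepi // -ler_norml.
have c0 : 0 <= cos th by apply: cos_ge0_pihalf; lra.
rewrite (ger0_norm c0) ler_norml -(acosK c11); apply/andP; split.
  have -> : - cos th = cos (pi - th) by rewrite addrC cosDpi cosN.
  by apply: ltW; rewrite ltr_cos // in_itv /=; lra.
by apply: ltW; rewrite ltr_cos // in_itv /=; lra.
Qed.

(** The component of w along n is its norm times the sine of its angle with e; the
hypothesis bounds the square of the cosine by 1 - s ^+ 2. *)
Lemma normal_component e n w s : e.1 != e.2 -> dot n n = 1 -> dot n (dir e) = 0 ->
  0 <= s -> dot (dir e) w ^+ 2 <= (1 - s ^+ 2) * (len e ^+ 2 * enorm w ^+ 2) ->
  s * enorm w <= `|dot n w|.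
Proof.
move=> e12 n1 nd s0 h; have l0 := len_gt0 e12.
have l2 : 0 < len e ^+ 2 by rewrite exprn_gt0.
have wE := normal_decompv w e12 n1 nd.
have pars : enorm w ^+ 2 * len e ^+ 2 = dot (dir e) w ^+ 2 + dot n w ^+ 2 * len e ^+ 2.
  rewrite enorm_sqr {1}wE dotDl !dotZl (dotC w n) (dotC w (dir e)).
  by rewrite mulrDl mulrAC divfK ?gt_eqF // -!expr2.
rewrite -(ler_pXn2r (n := 2)) ?nnegrE ?mulr_ge0 ?enorm_ge0 //.
rewrite -normrX ger0_norm ?sqr_ge0 // exprMn -(ler_pM2r l2).
by rewrite -mulrA; lra.
Qed.

Variables al0 th0 : R.
Hypotheses (al01 : 1 <= al0) (th00 : 0 < th0) (reg : shape_regular al0 th0 P).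
Let s := sin_bound th0.

Lemma adjacent_dot e e' : (e, e') \in zip E (rot 1 E) -> e \in E -> e' \in E ->
  e'.1 = e.2 ->
  dot (dir e) (dir e') ^+ 2 <= (1 - s ^+ 2) * (len e ^+ 2 * len e' ^+ 2).
Proof.
move=> adj eE eE' e12; have := reg.2 e e' adj; rewrite /edge_angle.
have l1 := len_gt0 (edge_ne eE); have l2 := len_gt0 (edge_ne eE').
set c := _ / _ => ang.
have cE : c * (len e * len e') = - dot (dir e) (dir e').
  rewrite /c divfK ?mulf_neq0 ?gt_eqF // -dotNl; congr dot.
  by rewrite /dir opprB.
have c1 : `|c| <= 1.
  rewrite -(ler_pM2r (mulr_gt0 l1 l2)) mul1r -{1}(gtr0_norm (mulr_gt0 l1 l2)).
  by rewrite -normrM cE normrN cauchy_schwarz.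
have := cos_bound th00 c1 ang.
rewrite -(sqrrN (dot _ _)) -cE -exprMn (exprMn _ c) => h.
by rewrite ler_wpM2r // sqr_ge0.
Qed.

Lemma next_height e e' : (e, e') \in zip E (rot 1 E) -> e \in E -> e' \in E ->
  e'.1 = e.2 -> s * len e' <= height P e e'.2.
Proof.
move=> adj eE eE' e12; have [nn nd _] := outward_normalP cT eE.
have s0 := sin_bound_gt0 th00.
have := normal_component (edge_ne eE) nn nd (ltW s0) (adjacent_dot adj eE eE' e12).
have -> : dot (nrm e) (dir e') = - height P e e'.2.
  rewrite -[X in height _ _ X](seg_point1 e') /seg_point scale1r height_shift -/T.
  by rewrite e12 height_snd // sub0r opprK.
rewrite normrN ger0_norm //; apply: (height_ge0 cT) => //.
by case: (edge_end eE').
Qed.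

Lemma prev_height e e' : (e', e) \in zip E (rot 1 E) -> e \in E -> e' \in E ->
  e'.2 = e.1 -> s * len e' <= height P e e'.1.
Proof.
move=> adj eE eE' e12; have [nn nd _] := outward_normalP cT eE.
have s0 := sin_bound_gt0 th00.
have adj' := adjacent_dot adj eE' eE (esym e12).
rewrite dotC (mulrC (len e' ^+ 2)) in adj'.
have := normal_component (edge_ne eE) nn nd (ltW s0) adj'.
have -> : dot (nrm e) (dir e') = height P e e'.1.
  have := height_shift P e e'.1 (1 *: dir e'); rewrite -/(seg_point e' 1) seg_point1.
  by rewrite e12 height_fst // scale1r -/T => /eqP; rewrite eq_sym subr_eq0 => /eqP.
rewrite ger0_norm //; apply: (height_ge0 cT) => //.
by case: (edge_end eE').
Qed.

Lemma mid_notin e f : e \in E -> f \in E -> e != f ->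
  ~ closed_segment f (seg_point e 2^-1).
Proof.
move=> eE fE ef fm.
have em : closed_segment e (seg_point e 2^-1).
  by exists 2^-1 => //=; rewrite in_itv /= half01.
have d0 : dir e != 0 by rewrite /dir subr_eq0 eq_sym (edge_ne eE).
have [h _] := edges_simple eE fE ef em fm.
have {}h : seg_point e 2^-1 = seg_point e 0 \/ seg_point e 2^-1 = seg_point e 1.
  by rewrite seg_point0 seg_point1.
case: h => /addrI /eqP; rewrite -subr_eq0 -scalerBl scaler_eq0 (negbTE d0) orbF.
  by rewrite subr0 invr_eq0 pnatr_eq0.
by rewrite subr_eq0 invr_eq1 => /eqP; lra.
Qed.

(** If z is parallel to e, the height above z is, up to a factor, the height above e
minus the height of the line of z. As T has a point N1 higher above e than Z, the
factor is positive. *)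
Lemma level_normal e z Z N1 C : e \in E -> z \in E ->
  dot (nrm z) (dir e) = 0 -> height P z Z = 0 ->
  height P e N1 > height P e Z -> T N1 ->
  height P z N1 <> 0 /\ (T C -> height P e Z <= height P e C).
Proof.
move=> eE zE zd zZ hN TN.
have [nn nd _] := outward_normalP cT zE.
have nE := normal_colinear cT eE zd.
set c := dot (nrm z) (nrm e); rewrite -/T -/c in nE.
have c0 : c != 0.
  apply: contra_eq_neq nn => c0; rewrite nE c0 scale0r /dot /= !mulr0 addr0.
  by rewrite eq_sym oner_neq0.
have hz x : height P z x = c * (height P e x - height P e Z).
  have -> : x = Z + (x - Z) by rewrite addrC subrK.
  by rewrite !height_shift zZ -/T nE dotZl; ring.
have h0 : 0 < c.
  have := height_ge0 cT zE TN; rewrite hz pmulr_lge0 ?subr_gt0 // => h.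
  by rewrite lt_neqAle h eq_sym c0.
split; first by move=> /eqP; rewrite hz mulf_eq0 (negbTE c0) subr_eq0 gt_eqF.
move=> TC; have := height_ge0 cT zE TC.
by rewrite hz pmulr_rge0 // subr_ge0.
Qed.

(** Suppose that the midpoint M of f is lower above e than the far ends of both
neighbours of e. The line through M parallel to e then meets these neighbours at P1
and P2, and of the three distinct frontier points M, P1, P2 one lies strictly
between the two others. The edge through that one is thus on this line, which
convexity and the simplicity of the boundary exclude. *)
Lemma mid_height_far e f ep em : e \in E -> f \in E -> ep \in E -> em \in E ->
  ep.1 = e.2 -> em.2 = e.1 -> f != e -> f != ep -> f != em ->
  Num.min (height P e em.1) (height P e ep.2) <= height P e (seg_point f 2^-1).
Proof.
move=> eE fE pE mE p12 m12 fe fp fm; rewrite leNgt; apply/negP.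
set M := seg_point f _; set eps := height P e M.
rewrite lt_min => /andP[h1 h2].
have [nn nd _] := outward_normalP cT eE.
have TM : T M by apply: (edge_in fE _).1; exact: half01.
have eps0 : 0 <= eps by exact: height_ge0.
have h1p := le_lt_trans eps0 h1; have h2p := le_lt_trans eps0 h2.
set H1 := height P e em.1 in h1 h1p; set H2 := height P e ep.2 in h2 h2p.
have [Tm1 Tm2] := edge_end mE; have [Tp1 Tp2] := edge_end pE.
have H1n := lt0r_neq0 h1p; have H2n := lt0r_neq0 h2p.
(* P1 and P2 are the points at height eps on em and on ep. *)
pose t1 := 1 - eps / H1; pose t2 := eps / H2.
have t10 : 0 < t1 <= 1.
  by rewrite /t1 subr_gt0 ltr_pdivrMr // mul1r h1 /= gerBl divr_ge0 // ltW.
have t20 : 0 <= t2 < 1.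
  by rewrite /t2 ltr_pdivrMr // mul1r h2 andbT divr_ge0 // ltW.
set P1 := seg_point em t1; set P2 := seg_point ep t2.
have t10' : 0 <= t1 <= 1 by case/andP: t10 => /ltW -> ->.
have t20' : 0 <= t2 <= 1 by case/andP: t20 => -> /ltW ->.
have cs1 : closed_segment em P1 by exists t1 => //=; rewrite in_itv.
have cs2 : closed_segment ep P2 by exists t2 => //=; rewrite in_itv.
have TP1 : T P1 by apply: (edge_in mE _).1.
have TP2 : T P2 by apply: (edge_in pE _).1.
have hP1 : height P e P1 = eps.
  rewrite /P1 /seg_point /dir height_line -/H1 m12 height_fst // mulr0 addr0.
  by rewrite /t1 subKr divfK.
have hP2 : height P e P2 = eps.
  rewrite /P2 /seg_point /dir height_line -/H2 p12 height_snd // mulr0 add0r.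
  by rewrite /t2 divfK.
have MP1 : M != P1.
  by apply: contraPneq cs1 => <-; exact: mid_notin.
have MP2 : M != P2.
  by apply: contraPneq cs2 => <-; exact: mid_notin.
have P12 : P1 != P2.
  apply/eqP => P12.
  have emp : em != ep.
    by apply/negP => /eqP emp; move: h1p; rewrite /H1 emp p12 height_snd // ltxx.
  rewrite P12 in cs1.
  have [[k1|k1] [k2|k2]] := edges_simple mE pE emp cs1 cs2.
  - by move: h1; rewrite /H1 -k1 hP2 ltxx.
  - by move: h1; rewrite /H1 -k1 hP2 ltxx.
  - by have /eqP := edge_ne eE; rewrite -p12 -m12 -k1 -k2.
  - by move: h2; rewrite /H2 -k2 hP2 ltxx.
have lev X Y : height P e X = eps -> height P e Y = eps ->
    exists c : R, Y = X + c *: dir e.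
  move=> hX hY; have : dot (nrm e) (Y - X) = 0.
    have := height_shift P e X (Y - X); rewrite addrC subrK hX hY -/T => h.
    lra.
  move=> /(normal_ortho cT eE); set c := _ / _ => h; exists c.
  by rewrite -h addrC subrK.
have [p pE1] := lev P1 M hP1 erefl.
have [q qE1] := lev P1 P2 hP1 hP2.
have p0 : p != 0 by apply: contraNneq MP1 => p0; rewrite pE1 p0 scale0r addr0.
have q0 : q != 0 by apply: contraNneq P12 => q0; rewrite qE1 q0 scale0r addr0.
have pq : p != q by apply: contraNneq MP2 => pq; rewrite pE1 qE1 pq.
(* If a point of an edge z lies strictly between two points of T at the same
   height above e, then z is parallel to e, hence on the line at height eps. By
   level_normal, T lies on one side of that line, which leaves only eps = 0. *)
have middle z t X Y a b : z \in E -> 0 <= t <= 1 -> height P e (seg_point z t) = eps ->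
    T X -> T Y -> X = seg_point z t + a *: dir e -> Y = seg_point z t + b *: dir e ->
    a * b < 0 ->
    [/\ dot (nrm z) (dir e) = 0, height P z em.1 <> 0, height P z ep.2 <> 0 & eps = 0].
  move=> zE t01 hz TX TY XE YE ab.
  have zd : dot (nrm z) (dir e) = 0.
    have := height_ge0 cT zE TX; have := height_ge0 cT zE TY.
    rewrite XE YE !(height_shift _ _ (seg_point z t)) (height_edge cT) // !dotZr -/T.
    rewrite !sub0r !oppr_ge0 => bd ad; apply/eqP; apply: contraTT ab => d0.
    have : 0 <= (a * b) * dot (nrm z) (dir e) ^+ 2.
      by rewrite expr2 mulrACA mulr_le0.
    by rewrite pmulr_lge0 ?exprn_even_gt0 // -leNgt.
  have hz0 : height P z (seg_point z t) = 0 by exact: height_edge.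
  have hN1 : height P e (seg_point z t) < height P e em.1 by rewrite hz.
  have hN2 : height P e (seg_point z t) < height P e ep.2 by rewrite hz.
  have [n1 n2] := level_normal e.1 eE zE zd hz0 hN1 Tm1.
  have [n3 _] := level_normal e.1 eE zE zd hz0 hN2 Tp2.
  split => //; apply/eqP; rewrite eq_le eps0 andbT -hz.
  by rewrite -(height_fst cT eE) n2 //; case: (edge_end eE).
have [pq0|pq0] := ltP (p * q) 0.
  (* P1 lies between M and P2 *)
  have [_ k _ _] := middle em t1 M P2 p q mE t10' hP1 TM TP2 pE1 qE1 pq0.
  by apply: k; exact: height_fst.
have [pq1|pq1] := ltP (p * (p - q)) 0.
  (* M lies between P1 and P2: then eps = 0, so P1 and P2 are the end points of e
     and M is a point of e. *)
  have [|||_ _ _ e0] := middle f 2^-1 P1 P2 (- p) (q - p) fE (half01 R) erefl TP1 TP2.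
  - by rewrite -/M pE1 scaleNr addrK.
  - by rewrite -/M pE1 qE1 scalerBl addrACA subrr addr0 addrC.
  - by lra.
  have P1E : P1 = e.1 by rewrite /P1 /t1 e0 mul0r subr0 seg_point1 m12.
  have P2E : P2 = e.2 by rewrite /P2 /t2 e0 mul0r seg_point0 p12.
  have q1 : q = 1.
    have : q *: dir e = 1 *: dir e.
      by rewrite scale1r; apply: (@addrI _ P1); rewrite -qE1 P1E P2E /dir addrC subrK.
    move=> /eqP; rewrite -subr_eq0 -scalerBl scaler_eq0 => /orP[|].
      by rewrite subr_eq0 => /eqP.
    by rewrite /dir subr_eq0 eq_sym (negbTE (edge_ne eE)).
  apply: (mid_notin fE eE fe); rewrite -/M; exists p.
    rewrite /= in_itv /=; rewrite q1 in pq1; apply/andP; split; nra.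
  by rewrite pE1 P1E.
(* P2 lies between P1 and M *)
have [|||_ _ k _] := middle ep t2 P1 M (- q) (p - q) pE t20' hP2 TP1 TM.
- by rewrite -/P2 qE1 scaleNr addrK.
- by rewrite -/P2 pE1 qE1 scalerBl addrACA subrr addr0 addrC.
- have : 0 < p ^+ 2 by rewrite exprn_even_gt0.
  have : 0 < q ^+ 2 by rewrite exprn_even_gt0.
  have : 0 < (p - q) ^+ 2 by rewrite exprn_even_gt0 //= subr_eq0.
  nra.
by apply: k; exact: height_snd.
Qed.

(** The bound only involves the two angles at the ends of e and the edge lengths. *)
Lemma mid_height l0 e f : 0 <= l0 -> (forall g, g \in E -> l0 <= len g) ->
  e \in E -> f \in E -> f != e -> s * l0 / 2 <= height P e (seg_point f 2^-1).
Proof.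
move=> l00 hl eE fE fe.
have s0 : 0 < s by exact: sin_bound_gt0.
have sl : 0 <= s * l0 by rewrite mulr_ge0 // ltW.
have [ep [pE adjp p12]] := next_edge eE; have [em [mE adjm m12]] := prev_edge eE.
have hp := next_height adjp eE pE p12; have hm := prev_height adjm eE mE m12.
have {}hp : s * l0 <= height P e ep.2 by rewrite (le_trans _ hp) // ler_pM2l // hl.
have {}hm : s * l0 <= height P e em.1 by rewrite (le_trans _ hm) // ler_pM2l // hl.
have [->|fp] := eqVneq f ep.
  by rewrite /seg_point /dir height_line p12 height_snd //; lra.
have [->|fm] := eqVneq f em.
  by rewrite /seg_point /dir height_line m12 height_fst //; lra.
apply: le_trans (mid_height_far eE fE pE mE p12 m12 fe fp fm).
by rewrite le_min; apply/andP; split; lra.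
Qed.

(** The middle of the segment that joins the midpoints of two edges is far from every
edge, since each edge is far from at least one of the two midpoints. *)
Lemma inner_center l0 : 0 <= l0 -> (forall g, g \in E -> l0 <= len g) ->
  exists xc, T xc /\ forall e, e \in E -> s * l0 / 4 <= height P e xc.
Proof.
move=> l00 hl; have s0 : 0 < s by exact: sin_bound_gt0.
have sl : 0 <= s * l0 by rewrite mulr_ge0 // ltW.
have [e1 e1E] : exists e1, e1 \in E.
  have [/andP[s3 _] _ _ _ _] := polygonP P; exists (nth (0, 0) E 0).
  by rewrite mem_nth // size_edges_of (leq_trans _ s3).
have [e2 [e2E _ e12]] := next_edge e1E.
have e21 : e2 != e1.
  by apply/eqP => e21; have := edge_ne e1E; rewrite -e12 e21 eqxx.
have T1 := (edge_in e1E (half01 R)).1; have T2 := (edge_in e2E (half01 R)).1.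
exists (seg_point e1 2^-1 + 2^-1 *: (seg_point e2 2^-1 - seg_point e1 2^-1)).
split; first by apply: convex_line => //; exact: half01.
move=> e eE; rewrite height_line.
have h1 := height_ge0 cT eE T1; have h2 := height_ge0 cT eE T2.
have [ee|ee] := eqVneq e e1.
  have e2e : e2 != e by rewrite ee.
  by have := mid_height l00 hl eE e2E e2e; lra.
rewrite eq_sym in ee.
by have := mid_height l00 hl eE e1E ee; lra.
Qed.

Section diameter.
Variable L : R.
Hypotheses (L0 : 0 <= L) (hL : forall g, g \in E -> len g <= L).
Let v0 := nth (0 : R * R) (vertices P) 0.

Lemma vertex_dist i : (i < size (vertices P))%N ->
  enorm (nth 0 (vertices P) i - v0) <= i%:R * L.
Proof.
elim: i => [|i IH] i_s.
  by rewrite /v0 subrr mul0r /enorm /dot /= !mulr0 addr0 sqrtr0.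
rewrite -natr1 mulrDl mul1r.
have -> : nth 0 (vertices P) i.+1 - v0 =
  (nth 0 (vertices P) i - v0) + (nth 0 (vertices P) i.+1 - nth 0 (vertices P) i).
  by rewrite [RHS]addrC addrA subrK.
apply: (le_trans (enormD _ _)); apply: lerD; first by apply: IH; exact: ltnW.
have : nth (0, 0) E i \in E by rewrite mem_nth // size_edges_of ltnW.
by move=> /hL; rewrite nth_edges_of ?(ltnW i_s) // modn_small.
Qed.

Lemma edge_dist f : f \in E ->
  enorm (f.1 - v0) <= (size E)%:R * L /\ enorm (f.2 - v0) <= (size E)%:R * L.
Proof.
move=> fE; have aux g : g \in E -> enorm (g.1 - v0) <= (size E)%:R * L.
  move=> /(nthP (0, 0))[i]; rewrite size_edges_of => i_s <-.
  rewrite nth_edges_of //= (le_trans (vertex_dist i_s)) //.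
  by rewrite ler_wpM2r // ler_nat ltnW.
split; first exact: aux.
by have [g [gE _ <-]] := next_edge fE; exact: aux.
Qed.

(** A linear form is bounded on T by its values at the vertices: follow the direction
of the form until T is left. *)
Lemma region_halfwidth x u : T x -> enorm u = 1 -> dot u (x - v0) <= (size E)%:R * L.
Proof.
move=> Tx u1; have u0 : u != 0.
  by apply: contra_eq_neq u1 => ->;
    rewrite /enorm /dot /= !mulr0 addr0 sqrtr0 eq_sym oner_neq0.
have [t [t0 Tt nT _]] := ray_exit Tx u0.
have /frontier_edge[f [r [fE /andP[r0 r1] xE]]] : frontier T (x + t *: u)
  by apply/frontierE.
have uu : dot u u = 1 by rewrite -enorm_sqr u1 expr1n.
have [d1 d2] := edge_dist fE.
have b (w : R * R) : enorm w <= (size E)%:R * L -> dot u w <= (size E)%:R * L.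
  move=> h; rewrite (le_trans (ler_norm _)) // (le_trans (cauchy_schwarz _ _)) //.
  by rewrite u1 mul1r.
have h : dot u (x + t *: u - v0) = dot u (x - v0) + t.
  by rewrite addrAC (dotDr u (x - v0)) dotZr uu mulr1.
have h2 : dot u (x + t *: u - v0) = (1 - r) * dot u (f.1 - v0) + r * dot u (f.2 - v0).
  rewrite xE /seg_point /dir !(dotBr, dotDr, dotZr); ring.
have := b _ d1; have := b _ d2; move: h2; rewrite h; nra.
Qed.

Lemma region_dist x y : T x -> T y -> enorm (x - y) <= 2 * (size E)%:R * L.
Proof.
move=> Tx Ty; have [->|xy] := eqVneq x y.
  rewrite subrr {1}/enorm /dot /= !mulr0 addr0 sqrtr0 !mulr_ge0 //.
have d0 : 0 < enorm (x - y) by rewrite enorm_gt0 // subr_eq0.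
pose u := (enorm (x - y))^-1 *: (x - y).
have u1 : enorm u = 1.
  by rewrite enormZ gtr0_norm ?invr_gt0 // mulVf // gt_eqF.
have : dot u (x - y) = enorm (x - y).
  by rewrite /u dotZl -enorm_sqr expr2 mulrA mulVf ?gt_eqF // mul1r.
have -> : x - y = (x - v0) - (y - v0) by rewrite opprB addrA subrK.
rewrite dotBr => <-.
have := region_halfwidth Tx u1; have := @region_halfwidth y (- u) Ty.
by rewrite enormN dotNl => /(_ u1); lra.
Qed.

Lemma diam_le : diam T <= 2 * (size E)%:R * L.
Proof.
apply: ge_sup.
  have [z /interior_subset Tz] := interior_point P.
  by exists (enorm (z - z)); exists (z, z).
by move=> _ [[x y] /= [Tx Ty] <-]; exact: region_dist.
Qed.

Lemma le_diam x y : T x -> T y -> enorm (x - y) <= diam T.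
Proof.
move=> Tx Ty; apply: ub_le_sup; last by exists (x, y).
by exists (2 * (size E)%:R * L) => _ [[a b] /= [Ta Tb] <-]; exact: region_dist.
Qed.
End diameter.

Lemma edge_len_ub e g : e \in E -> g \in E -> len g <= al0 * len e.
Proof. by move=> eE gE; apply: ltW; exact: reg.1. Qed.

(** Every vertex is reached from a fixed one through at most m edges, and all edges have
comparable lengths. *)
Lemma diam_len (m : nat) e : (size E <= m)%N -> e \in E ->
  diam T <= 2 * m%:R * al0 * len e.
Proof.
move=> Em eE; have l0 := len_gt0 (edge_ne eE).
have L0 : 0 <= al0 * len e by rewrite mulr_ge0 ?ltW // (lt_le_trans _ al01).
apply: (le_trans (diam_le L0 (fun g gE => edge_len_ub eE gE))).
by rewrite mulrA ler_pM2r // ler_pM2r ?(lt_le_trans _ al01) // ler_pM2l // ler_nat.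
Qed.

Lemma dist_diam x y : T x -> T y -> enorm (x - y) <= diam T.
Proof.
have [e eE] : exists e1, e1 \in E.
  have [/andP[s3 _] _ _ _ _] := polygonP P; exists (nth (0, 0) E 0).
  by rewrite mem_nth // size_edges_of (leq_trans _ s3).
have l0 := len_gt0 (edge_ne eE).
have L0 : 0 <= al0 * len e by rewrite mulr_ge0 ?ltW // (lt_le_trans _ al01).
exact: (le_diam L0 (fun g gE => edge_len_ub eE gE)).
Qed.
End shape.

(** * Integrals of polynomials over bounded sets *)

Section bounded_set.
Variables (R : realType) (T : set (R * R)) (c : R * R) (h : R).
Hypothesis mT : measurable (T : set (measurableTypeR R * measurableTypeR R)).
Hypothesis hT : forall x, T x -> `|x.1 - c.1| <= h /\ `|x.2 - c.2| <= h.
Implicit Types (p q : bipoly R) (x : R * R).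

Let mu := (@lebesgue_measure R \x @lebesgue_measure R)%E.
Notation I p := (integral_on T (peval p)).

Let box : set (R * R) := `[c.1 - h, c.1 + h] `*` `[c.2 - h, c.2 + h].

Lemma measurable_box : measurable (box : set (measurableTypeR R * measurableTypeR R)).
Proof. exact: measurableX. Qed.

Lemma sub_box : T `<=` box.
Proof.
move=> x /hT[x1 x2]; split => /=; rewrite in_itv /=.
  by rewrite -ler_distlC distrC.
by rewrite -ler_distlC distrC.
Qed.

Lemma measure_box : 0 <= h -> mu box = (4 * h ^+ 2)%:E.
Proof.
move=> h0; have Ei a : lebesgue_measure (`[a - h, a + h] : set R) = (2 * h)%:E.
  rewrite lebesgue_measure_itv /= lte_fin ltrD2l; case: ltP => hh.
    by rewrite EFinN -EFinD; congr (_%:E); ring.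
  by have -> : h = 0; [lra|rewrite mulr0].
rewrite /mu /box product_measure1E //.
transitivity ((2 * h)%:E * (2 * h)%:E)%E; first by congr (_ * _)%E; exact: Ei.
by rewrite -EFinM; congr (_%:E); ring.
Qed.

Lemma set_integrable p : mu.-integrable T (EFin \o peval p).
Proof.
apply: measurable_bounded_integrable => //.
- have [h0|h0] := leP 0 h.
    apply: (@le_lt_trans _ _ (mu box)).
      by apply: le_measure; rewrite ?inE //; [exact: measurable_box|exact: sub_box].
    by rewrite measure_box // ltry.
  rewrite (_ : T = set0) ?measure0 // -subset0 => x /hT[+ _].
  by move=> /(le_trans (normr_ge0 _)); rewrite leNgt h0.
- by apply: measurable_funTS; exact: measurable_peval.
- have [K HK] := peval_bounded p (`|c.1| + `|c.2| + h).
  exists K; split => [|M KM x Tx]; first exact: num_real.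
  apply: (le_trans _ (ltW KM)); apply: HK; have [x1 x2] := hT Tx.
    rewrite -(subrK c.1 x.1) (le_trans (ler_normD _ _)) //.
    have := normr_ge0 c.2; lra.
  rewrite -(subrK c.2 x.2) (le_trans (ler_normD _ _)) //.
  have := normr_ge0 c.1; lra.
Qed.

Lemma integralD p q : I (p + q) = I p + I q.
Proof.
rewrite /integral_on -RintegralD //; [|exact: set_integrable..].
by apply: eq_Rintegral => x _; rewrite pevalD.
Qed.

Lemma integralZ a p : I (a *: p) = a * I p.
Proof.
rewrite /integral_on -RintegralZl //; last exact: set_integrable.
by apply: eq_Rintegral => x _; rewrite pevalZ.
Qed.

Lemma le_integral_on p q : (forall x, T x -> peval p x <= peval q x) -> I p <= I q.
Proof. by move=> pq; apply: le_Rintegral => //; exact: set_integrable. Qed.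

Lemma integral_ub p B : 0 <= h -> 0 <= B -> (forall x, T x -> peval p x <= B) ->
  I p <= B * (4 * h ^+ 2).
Proof.
move=> h0 B0 pB.
have le1 : (mu T <= (4 * h ^+ 2)%:E)%E.
  rewrite -measure_box //; apply: le_measure; rewrite ?inE //;
    [exact: measurable_box|exact: sub_box].
have fin : mu T \is a fin_num.
  by rewrite ge0_fin_numE // (le_lt_trans le1) // ltry.
apply: (@le_trans _ _ (\int[mu]_(x in T) B)).
  apply: le_Rintegral => //; first exact: set_integrable.
  have := set_integrable (B *: 1); congr (integrable _ _ _).
  by apply/funext => x /=; rewrite pevalZ peval1 mulr1.
rewrite Rintegral_cst //; apply: ler_wpM2l => //.
by rewrite -lee_fin fineK.
Qed.

(** Two-dimensional inverse estimate with a weight Om that is bounded below on a square: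
the one-dimensional estimate is iterated through Tonelli's theorem. *)
Lemma sup_square d M l a b p Om kap x :
  0 < l -> deg_le d p -> 0 <= kap -> (forall z, T z -> 0 <= peval Om z) ->
  (forall z, a <= z.1 <= a + l -> b <= z.2 <= b + l -> T z /\ kap <= peval Om z) ->
  `|x.1 - a| <= M * l -> `|x.2 - b| <= M * l ->
  kap * (peval p x ^+ 2 * l ^+ 2) <= sup_const d M ^+ 2 * I (Om * p ^+ 2).
Proof.
move=> l0 pd kap0 Om0 sq x1 x2.
have M0 : 0 <= M by have := le_trans (normr_ge0 _) x1; rewrite pmulr_lge0.
have C0 := sup_const_gt0 d M0; set C := sup_const d M in C0 *.
pose S : set (R * R) := `[a, a + l] `*` `[b, b + l].
have mS : measurable (S : set (measurableTypeR R * measurableTypeR R)).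
  exact: measurableX.
have ST : S `<=` T.
  by move=> z [/=]; rewrite !in_itv /= => z1 z2; have [] := sq z z1 z2.
pose f := (fun z => (peval (p ^+ 2) z)%:E) \_ S.
have f0 z : (0 <= f z)%E.
  by rewrite /f patchE; case: ifP => // _; rewrite lee_fin pevalX sqr_ge0.
have mf : measurable_fun setT f.
  apply/(measurable_restrictT _ mS); apply/measurable_EFinP.
  by apply: measurable_funTS; exact: measurable_peval.
pose line_x := line_poly p (0, x.2) (1, 0).
have line_xE t : line_x.[t] = peval p (t, x.2).
  rewrite line_poly_eval; congr peval; congr pair; rewrite /= /GRing.scale /=; ring.
pose line_y t := line_poly p (t, 0) (0, 1).
have line_yE t s : (line_y t).[s] = peval p (t, s).
  rewrite line_poly_eval; congr peval; congr pair; rewrite /= /GRing.scale /=; ring.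
(* the one-dimensional bound on vertical lines, then on the horizontal line
   through x *)
have F_lb t : a <= t <= a + l ->
    (((l / C) * line_x.[t] ^+ 2)%:E <= fubini_F (@lebesgue_measure R) f t)%E.
  move=> tab; rewrite /fubini_F.
  have -> : (\int[lebesgue_measure]_y f (t, y) =
    \int[lebesgue_measure]_(y in `[b, (b + l)%R]) ((line_y t ^+ 2).[y])%:E)%E.
    rewrite [RHS]integral_mkcond; apply: eq_integral => y _.
    rewrite /f !patchE /S; congr (if _ then _ else _).
      apply/idP/idP; rewrite !inE /=; first by case.
      by move=> yb; split => //; rewrite in_itv.
    by rewrite horner_exp line_yE pevalX.
  have := @poly_sup _ d M (line_y t) b l x.2 (size_line_poly _ _ pd) l0 x2.
  rewrite line_yE -line_xE -/C => hp.
  rewrite -(@fineK _ (\int[lebesgue_measure]_(y in `[b,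
    (b + l)%R]) ((line_y t ^+ 2).[y])%:E)%E).
    by rewrite lee_fin mulrAC ler_pdivrMr // (mulrC l) (mulrC _ C).
  by apply: integrable_fin_num => //; exact: pint_integrable.
have pT q : mu.-integrable T (EFin \o peval q) by exact: set_integrable.
have pS q : mu.-integrable S (EFin \o peval q) by exact: integrableS (pT q).
have mF : measurable_fun setT (fubini_F (@lebesgue_measure R) f).
  exact: measurable_fun_fubini_tonelli_F.
have F0 t : (0 <= fubini_F (@lebesgue_measure R) f t)%E.
  by apply: integral_ge0 => y _; exact: f0.
have key : l / C * pint a (a + l) (line_x ^+ 2) <= \int[mu]_(z in S) peval (p ^+ 2) z.
  have lC : 0 <= l / C by rewrite divr_ge0 // ltW.
  rewrite -lee_fin /Rintegral (fineK (integrable_fin_num mS (pS _))).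
  rewrite integral_mkcond -/f /mu fubini_tonelli1 // -pintZ; last by rewrite lerDl ltW.
  rewrite /pint /Rintegral.
  rewrite (fineK (integrable_fin_num _ (pint_integrable _ _ _))) //.
  apply: (@le_trans _ _ (\int[lebesgue_measure]_(t in `[a, (a + l)%R])
      fubini_F (@lebesgue_measure R) f t)%E); last first.
    by apply: ge0_subset_integral.
  apply: ge0_le_integral => //.
  - by move=> t _; rewrite lee_fin hornerZ horner_exp mulr_ge0 ?sqr_ge0.
  - exact: (measurable_int (@lebesgue_measure R) (pint_integrable _ _ _)).
  - exact: measurable_funTS.
  - by move=> t; rewrite /= in_itv /= hornerZ horner_exp; exact: F_lb.
have step1 : kap * (\int[mu]_(z in S) peval (p ^+ 2) z) <=
  \int[mu]_(z in S) peval (Om * p ^+ 2) z.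
  rewrite -RintegralZl //.
  apply: le_Rintegral => //.
    by have := pS (kap *: p ^+ 2); congr (integrable _ _ _); apply/funext => z /=;
      rewrite pevalZ.
  move=> z [/=]; rewrite !in_itv /= => z1 z2;
    rewrite pevalM ler_wpM2r ?pevalX ?sqr_ge0 //.
  by have [] := sq z z1 z2.
have step2 : \int[mu]_(z in S) peval (Om * p ^+ 2) z <= I (Om * p ^+ 2).
  rewrite -lee_fin /integral_on /Rintegral (fineK (integrable_fin_num mS (pS _))).
  rewrite (fineK (integrable_fin_num mT (pT _))).
  apply: ge0_subset_integral => //.
    exact: measurable_int (pT _).
  by move=> z Tz; rewrite lee_fin pevalM mulr_ge0 ?Om0 // pevalX sqr_ge0.
have := @poly_sup _ d M line_x a l x.1 (size_line_poly _ _ pd) l0 x1.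
rewrite line_xE -surjective_pairing -/C => hp.
have lC : 0 <= l / C by rewrite divr_ge0 // ltW.
apply: (le_trans _ (ler_wpM2l (sqr_ge0 C) step2)).
apply: (le_trans _ (ler_wpM2l (sqr_ge0 C) step1)).
rewrite (mulrCA (C ^+ 2)); apply: ler_wpM2l => //.
apply: (le_trans _ (ler_wpM2l (sqr_ge0 C) key)).
have -> : C ^+ 2 * (l / C * pint a (a + l) (line_x ^+ 2)) =
  l * (C * pint a (a + l) (line_x ^+ 2)) by field; rewrite gt_eqF.
by rewrite expr2 mulrA mulrC; apply: ler_wpM2l => //; exact: ltW.
Qed.

End bounded_set.

(** * A line crossing a convex polygon *)

Section line_section.
Variables (R : realType) (P : polygon R).
Implicit Types (x y u v n b : R * R) (e f : (R * R) * (R * R)) (t a c : R).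
Let T := region P.
Let E := edges P.
Hypothesis cT : convex_set T.
Notation nrm e := (outward_normal T e).

Definition cross u v : R := u.1 * v.2 - u.2 * v.1.

(** Parameter on the line of e of its crossing with the line through b along u; it is 0
when the two lines are parallel, so that such an edge is never counted as hit. *)
Definition hit_param (b u : R * R) e : R := cross (b - e.1) u / cross (dir e) u.

(** Contribution of the edge e to a primitive evaluated between the two ends of the
chord cut out by the line: plus where the line leaves the region, minus where it
enters. *)
Definition crossing_term (q : bipoly R) (b u : R * R) e : R :=
  if 0 < hit_param b u e < 1
  then Num.sg (dot (nrm e) u) * peval q (seg_point e (hit_param b u e)) else 0.

Lemma crossB x y u : cross (x - y) u = cross x u - cross y u.
Proof. by rewrite /cross /=; ring. Qed.
Lemma crossZ c x u : cross (c *: x) u = c * cross x u.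
Proof. by rewrite /cross /= /GRing.scale /=; ring. Qed.
Lemma crossD x y u : cross (x + y) u = cross x u + cross y u.
Proof. by rewrite /cross /=; ring. Qed.
Lemma crossxx u : cross u u = 0.
Proof. by rewrite /cross; ring. Qed.

Lemma cross_seg e b u t : cross (seg_point e t - b) u =
  t * cross (dir e) u - cross (b - e.1) u.
Proof. by rewrite /seg_point !(crossB, crossD, crossZ); ring. Qed.

Lemma cross0_line b u x : u != 0 -> cross (x - b) u = 0 -> exists t, x = b + t *: u.
Proof.
move=> u0 h; exists (dot (x - b) u / dot u u).
have uu : dot u u != 0 by apply: contra_neq u0; exact: dot_eq0.
apply: (@addIr _ (- b)); rewrite [RHS]addrAC subrr add0r.
move: h uu; case: (x - b) => x1 x2; case: u {u0} => u1 u2; rewrite /cross /dot /= => h uu.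
congr pair; rewrite /= /GRing.scale /=; apply: (mulIf uu).
  rewrite [RHS]mulrAC divfK //.
  have -> : x1 * (u1 * u1 + u2 * u2) =
    (x1 * u2 - x2 * u1) * u2 + (x1 * u1 + x2 * u2) * u1 by ring.
  by rewrite h mul0r add0r.
rewrite [RHS]mulrAC divfK //.
have -> : x2 * (u1 * u1 + u2 * u2) =
  (x1 * u1 + x2 * u2) * u2 - (x1 * u2 - x2 * u1) * u1 by ring.
by rewrite h mul0r subr0.
Qed.

Lemma normal_cross e u : e \in E -> cross (dir e) u != 0 -> dot (nrm e) u != 0.
Proof.
move=> eE; apply: contra_neq => h; rewrite {1}(normal_ortho cT eE h).
by rewrite [LHS](_ : _ = - cross ((dot u (dir e) / len e ^+ 2) *: dir e) (dir e));
  [rewrite crossZ crossxx mulr0 oppr0|rewrite /cross; ring].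
Qed.

Lemma line_shift b u t s : b + s *: u = b + t *: u + (s - t) *: u.
Proof. by rewrite -addrA -scalerDl (addrC t) subrK. Qed.

Variables (b u : R * R).
Hypothesis u0 : u != 0.
Hypothesis generic : forall e, e \in E ->
  cross (e.1 - b) u != 0 /\ cross (e.2 - b) u != 0.

Lemma hit_line e t : e \in E -> 0 <= t <= 1 -> cross (seg_point e t - b) u = 0 ->
  [/\ 0 < t < 1, cross (dir e) u != 0, hit_param b u e = t & dot (nrm e) u != 0].
Proof.
move=> eE /andP[t0 t1] ht; have [g1 g2] := generic eE.
have h : t * cross (dir e) u = cross (b - e.1) u.
  by apply/eqP; rewrite -subr_eq0 -cross_seg ht.
have g1' : cross (b - e.1) u != 0.
  by rewrite -opprB -scaleN1r crossZ mulN1r oppr_eq0.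
have d0 : cross (dir e) u != 0.
  by apply: contra_neq g1' => d0; rewrite -h d0 mulr0.
split => //; last exact: normal_cross.
  rewrite !lt_neqAle t0 t1 !andbT; apply/andP; split.
    by rewrite eq_sym; apply: contra_neq g1' => t00; rewrite -h t00 mul0r.
  by apply: contra_neq g2 => t11; rewrite -(seg_point1 e) -t11 ht.
by rewrite /hit_param -h mulfK.
Qed.

Lemma hit_on e : 0 < hit_param b u e < 1 -> cross (dir e) u != 0 /\
  exists t, seg_point e (hit_param b u e) = b + t *: u.
Proof.
move=> h01; have d0 : cross (dir e) u != 0.
  by apply/eqP => d0; move: h01; rewrite /hit_param d0 invr0 mulr0 ltxx.
split => //; apply: cross0_line => //.
by rewrite cross_seg /hit_param divfK // subrr.
Qed.

(** A line that avoids the vertices cuts out of T a chord that enters through one edge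
and leaves through another one, transversally to both. *)
Lemma line_chord t0 : T (b + t0 *: u) -> exists e1 e2 t1 t2,
  [/\ e1 \in E, e2 \in E, t1 < t2,
   forall t, T (b + t *: u) <-> t1 <= t <= t2 &
   [/\ 0 < hit_param b u e1 < 1, 0 < hit_param b u e2 < 1,
   seg_point e1 (hit_param b u e1) = b + t1 *: u,
   seg_point e2 (hit_param b u e2) = b + t2 *: u &
   dot (nrm e1) u < 0 < dot (nrm e2) u]].
Proof.
move=> Tt0.
have uN0 : - u != 0 by rewrite oppr_eq0.
have [s2 [s20 Ts2 nTs2 H2]] := ray_exit Tt0 u0.
have [s1 [s10 Ts1 nTs1 H1]] := ray_exit Tt0 uN0.
have E2 s : b + t0 *: u + s *: u = b + (t0 + s) *: u by rewrite scalerDl addrA.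
have E1 s : b + t0 *: u + s *: - u = b + (t0 - s) *: u.
  by rewrite scalerN scalerBl addrA.
rewrite E2 in Ts2 nTs2; rewrite E1 in Ts1 nTs1.
set t2 := t0 + s2 in Ts2 nTs2; set t1 := t0 - s1 in Ts1 nTs1.
have chordE t : T (b + t *: u) <-> t1 <= t <= t2.
  split=> [Tt|/andP[h1 h2]].
    apply/andP; split; rewrite leNgt; apply/negP => h.
      by apply: (H1 (t0 - t)); [move: h; rewrite /t1; lra|rewrite E1 subKr].
    by apply: (H2 (t - t0)); [move: h; rewrite /t2; lra|rewrite E2 [t0 + _]addrC subrK].
  have [t12|t12] := eqVneq t1 t2.
    by rewrite (_ : t = t1) //; apply/eqP; rewrite eq_le h1 t12 h2.
  have t12' : t1 < t2 by rewrite lt_neqAle t12 (le_trans h1).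
  have l01 : 0 <= (t - t1) / (t2 - t1) <= 1.
    by rewrite divr_ge0 ?subr_ge0 // ?(ltW t12') // ler_pdivrMr ?subr_gt0 // mul1r lerD2r.
  have := convex_line cT Ts1 Ts2 l01.
  have -> : b + t2 *: u - (b + t1 *: u) = (t2 - t1) *: u.
    by rewrite (line_shift b u t1 t2) addrC addKr.
  rewrite scalerA divfK.
    by rewrite -line_shift.
  by rewrite subr_eq0 eq_sym.
have /frontier_edge[e1 [r1 [e1E r101 z1E]]] : frontier T (b + t1 *: u) by apply/frontierE.
have /frontier_edge[e2 [r2 [e2E r201 z2E]]] : frontier T (b + t2 *: u) by apply/frontierE.
have on t : cross (b + t *: u - b) u = 0.
  by rewrite addrAC subrr add0r crossZ crossxx mulr0.
have [] := @hit_line e1 r1 e1E r101; first by rewrite -z1E.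
move=> r1s d10 hit1 n10.
have [] := @hit_line e2 r2 e2E r201; first by rewrite -z2E.
move=> r2s d20 hit2 n20.
(* The chord is not reduced to a point of e1: join an interior point X to an end
   V of e1 on the other side of the line; the crossing point is in T and off e1. *)
have t12 : t1 < t2.
  have [X iX] := interior_point P; have TX := interior_subset iX.
  have hX := height_int cT e1E iX.
  suff [t [Tt ht]] : exists t, T (b + t *: u) /\ 0 < height P e1 (b + t *: u).
    have /chordE/andP[h1 h2] := Tt.
    rewrite lt_neqAle (le_trans h1) // andbT; apply/eqP => t12.
    have tt1 : t = t1 by apply/eqP; rewrite eq_le h1 t12 h2.
    by move: ht; rewrite tt1 z1E height_edge // ltxx.
  have [V [TV hV cV]] : exists V, [/\ T V, height P e1 V = 0 &
      cross (X - b) u * cross (V - b) u <= 0 /\ cross (V - b) u != 0].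
    have [g1 g2] := generic e1E; have [T1 T2] := edge_end e1E.
    have rel : (1 - r1) * cross (e1.1 - b) u + r1 * cross (e1.2 - b) u = 0.
      have := on t1; rewrite z1E cross_seg => <-.
      rewrite /dir !crossB; ring.
    have opp : cross (e1.1 - b) u * cross (e1.2 - b) u <= 0.
      case/andP: r1s => ra rb.
      have ? : 0 < 1 - r1 by lra.
      have : (1 - r1) * (cross (e1.1 - b) u * cross (e1.2 - b) u) =
        - r1 * cross (e1.2 - b) u ^+ 2.
        have -> : (1 - r1) * (cross (e1.1 - b) u * cross (e1.2 - b) u) =
          ((1 - r1) * cross (e1.1 - b) u + r1 * cross (e1.2 - b) u) * cross (e1.2 - b) u
          - r1 * cross (e1.2 - b) u ^+ 2 by ring.
        by rewrite rel mul0r add0r mulNr.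
      move=> h; rewrite -(pmulr_rle0 _ (_ : 0 < 1 - r1)) // h mulNr oppr_le0.
      by rewrite mulr_ge0 ?sqr_ge0 // ltW.
    have [c1|c1] := leP (cross (X - b) u * cross (e1.1 - b) u) 0.
      by exists e1.1; split => //; exact: height_fst.
    exists e1.2; split => //; first exact: height_snd.
    split => //; rewrite leNgt; apply/negP => c2.
    have := mulr_gt0 c1 c2; rewrite mulrACA -expr2 => h.
    have : 0 <= cross (X - b) u ^+ 2 by exact: sqr_ge0.
    by move: h opp; nra.
  case: cV => c1 c2; set cX := cross (X - b) u in c1; set cVV := cross (V - b) u in c1 c2.
  have dn : cX - cVV != 0.
    rewrite subr_eq0; apply/eqP => h; move: c1; rewrite h -expr2.
    by rewrite leNgt exprn_even_gt0 ?c2.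
  pose lam := cX / (cX - cVV).
  have lam01 : 0 <= lam < 1.
    have sq : 0 < (cX - cVV) ^+ 2 by rewrite exprn_even_gt0.
    have lE : lam = cX * (cX - cVV) / (cX - cVV) ^+ 2 by rewrite /lam; field.
    have cV2 : 0 < cVV ^+ 2 by rewrite exprn_even_gt0.
    have cX2 := sqr_ge0 cX.
    rewrite lE; apply/andP; split; first by rewrite divr_ge0 ?(ltW sq) //; nra.
    rewrite ltr_pdivrMr // mul1r; nra.
  have [|t tE] := @cross0_line b u (X + lam *: (V - X)) u0.
    have -> : X + lam *: (V - X) - b = X - b + lam *: ((V - b) - (X - b)).
      by rewrite addrAC opprB addrA subrK.
    rewrite crossD crossZ (crossB (V - b)) -/cX -/cVV /lam; field; exact: dn.
  exists t; rewrite -tE; split.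
    by apply: convex_line => //; case/andP: lam01 => -> /ltW ->.
  rewrite height_line hV mulr0 addr0 mulr_gt0 // subr_gt0.
  by case/andP: lam01.
exists e1, e2, t1, t2; split => //; split => //; rewrite ?hit1 ?hit2 //.
have k1 := height_ge0 cT e2E Ts1; have k2 := height_ge0 cT e1E Ts2.
have k3 : height P e2 (b + t1 *: u) = (t2 - t1) * dot (nrm e2) u.
  by rewrite (line_shift b u t2 t1) height_shift z2E height_edge // dotZr -/T; ring.
have k4 : height P e1 (b + t2 *: u) = - (t2 - t1) * dot (nrm e1) u.
  by rewrite (line_shift b u t1 t2) height_shift z1E height_edge // dotZr -/T; ring.
have tt : 0 < t2 - t1 by rewrite subr_gt0.
rewrite k3 pmulr_rge0 // in k1; rewrite k4 mulNr oppr_ge0 pmulr_rle0 // in k2.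
by rewrite !lt_neqAle k1 k2 n10 eq_sym n20.
Qed.

Lemma chord_unique e f t : e \in E -> f \in E -> 0 < hit_param b u e < 1 ->
  0 < hit_param b u f < 1 ->
  seg_point e (hit_param b u e) = b + t *: u ->
    seg_point f (hit_param b u f) = b + t *: u -> e = f.
Proof.
move=> eE fE he hf hE fE'; apply/eqP; apply: contraT => ef.
have ce : closed_segment e (b + t *: u).
  by exists (hit_param b u e) => //; rewrite /= in_itv /=; case/andP: he => /ltW ->
    /ltW ->.
have cf : closed_segment f (b + t *: u).
  by exists (hit_param b u f) => //; rewrite /= in_itv /=; case/andP: hf => /ltW ->
    /ltW ->.
have on : cross (b + t *: u - b) u = 0.
  by rewrite addrAC subrr add0r crossZ crossxx mulr0.
have [g1 g2] := generic eE.
by have [[h|h] _] := edges_simple eE fE ef ce cf; move: on; rewrite h => /eqP on;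
  [rewrite on in g1|rewrite on in g2].
Qed.

(** Fundamental theorem of calculus on the chord, written as a sum over all edges in
order to be integrated over parallel lines. *)
Lemma section_sum (q : bipoly R) :
  (\int[lebesgue_measure]_t
    ((EFin \o horner (line_poly q b u)^`()) \_ [set t | T (b + t *: u)%R]) t =
   (\sum_(e <- E) crossing_term q b u e)%:E)%E.
Proof.
have [[t0 Tt0]|nT] := pselect (exists t, T (b + t *: u)); last first.
  rewrite -integral_mkcond (_ : [set t | _] = set0) ?integral_set0.
    rewrite big_seq big1 // => e eE; rewrite /crossing_term; case: ifP => // h.
    have [_ [t tE]] := hit_on h; case: nT; exists t; rewrite -tE.
    by apply: (edge_in eE _).1; case/andP: h => /ltW -> /ltW ->.
  by rewrite -subset0 => t /= Tt; apply: nT; exists t.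
have [e1 [e2 [t1 [t2 [e1E e2E t12 TP [h1 h2 z1 z2 /andP[n1 n2]]]]]]] := line_chord Tt0.
rewrite -integral_mkcond (_ : [set t | _] = `[t1, t2]%classic); last first.
  by apply/seteqP; split => t /=; rewrite in_itv /=; move/TP.
rewrite -[LHS]fineK; last by apply: integrable_fin_num => //; exact: pint_integrable.
congr (_%:E).
have -> : fine (\int[lebesgue_measure]_(x in `[t1,
  t2]) (EFin \o horner (line_poly q b u)^`()) x) =
  pint t1 t2 (line_poly q b u)^`() by [].
rewrite (pintE (ltW t12) erefl) !line_poly_eval -z1 -z2.
have e12 : e1 != e2.
  by apply/eqP => e12; move: n2; rewrite -e12 ltNge (ltW n1).
rewrite (bigD1_seq e2) ?uniq_edges //= (big_rem e1) /=; last first.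
  by [].
(* A further edge that crosses the line would contain one end of the chord,
   because the height above it has constant sign along the chord. *)
rewrite e12 [X in _ + (_ + X)]big1_seq ?addr0; last first.
  move=> e /andP[ee2 erem]; rewrite /crossing_term; case: ifP => // h.
  have eE : e \in E by exact: mem_rem erem.
  have [d0 [t tE]] := hit_on h.
  have Tt : T (b + t *: u).
    by rewrite -tE; apply: (edge_in eE _).1; case/andP: h => /ltW -> /ltW ->.
  have /TP/andP[tt1 tt2] := Tt.
  have hgt s : height P e (b + s *: u) = (t - s) * dot (nrm e) u.
    by rewrite (line_shift b u t s) height_shift -tE height_edge // dotZr -/T; ring.
  have n0 := normal_cross eE d0.
  have T1 : T (b + t1 *: u) by apply/TP; rewrite lexx ltW.
  have T2 : T (b + t2 *: u) by apply/TP; rewrite lexx ltW.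
  have k1 := height_ge0 cT eE T1; have k2 := height_ge0 cT eE T2.
  rewrite hgt in k1; rewrite hgt in k2.
  have [np|np] := ltP 0 (dot (nrm e) u).
    have tE2 : t = t2.
      by apply/eqP; rewrite eq_le tt2 /= -subr_ge0; rewrite pmulr_lge0 in k2.
    by move: ee2; rewrite (chord_unique eE e2E h h2 tE) ?eqxx // tE2.
  have np' : dot (nrm e) u < 0 by rewrite lt_neqAle n0.
  have tE1 : t = t1.
    apply/eqP; rewrite eq_le tt1 andbT -subr_le0.
    by rewrite nmulr_lge0 in k1.
  move: erem; rewrite (chord_unique eE e1E h h1 tE) ?tE1 //.
  by rewrite mem_rem_uniqF // uniq_edges.
by rewrite /crossing_term h1 h2 gtr0_sg // ltr0_sg // mul1r mulN1r.
Qed.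

End line_section.

(** * Integration by parts *)

Section crossing.
Variable R : realType.
Implicit Types (g : {poly R}) (a d x : R).

(** Change of variables from the parameter on an edge to the coordinate x that indexes
parallel lines; a and a + d are the coordinates of the two ends of the edge. For
d = 0 both sides vanish. *)
Lemma crossing_integral a d g
    (K := fun x => if 0 < (x - a) / d < 1 then g.[(x - a) / d] else 0) :
  (@lebesgue_measure R).-integrable setT (EFin \o K) /\
  (\int[lebesgue_measure]_x (K x)%:E = (`|d| * pint 0 1 g)%:E)%E.
Proof.
have [d0|d0] := eqVneq d 0.
  have -> : K = cst 0.
    by apply/funext => x; rewrite /K d0 invr0 mulr0 ltxx.
  split; last by rewrite d0 normr0 mul0r integral0_eq.
  exact: integrable0.
pose p := g \Po ((- (a / d))%:P + d^-1 *: 'X).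
have pE x : p.[x] = g.[(x - a) / d].
  by rewrite horner_comp !hornerE; congr (_.[_]); ring.
have intp lo hi : (@lebesgue_measure R).-integrable `]lo, hi[ (EFin \o horner p).
  apply: (integrableS _ _ _ (pint_integrable lo hi p)) => //.
  exact: subset_itv_oo_cc.
have [lo [hi [KE iE]]] : exists lo hi, (forall x,
  (0 < (x - a) / d < 1) = (lo < x < hi)) /\
    pint lo hi p = `|d| * pint 0 1 g.
  have comp : p \Po (a%:P + d *: 'X) = g.
    rewrite /p -comp_polyA -[RHS]comp_polyXr; congr (_ \Po _).
    rewrite comp_polyD comp_polyC comp_polyZ comp_polyX.
    rewrite scalerDr scalerA mulVf // scale1r addrA -mul_polyC -polyCM -polyCD.
    by rewrite mulrC addNr add0r.
  have [dp|dn] := ltP 0 d.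
    exists a, (a + d); split=> [x|].
      by rewrite ltr_pdivrMr // mul1r ltrBlDl pmulr_lgt0 ?invr_gt0 // subr_gt0.
    by rewrite pint_affine ?ltW // comp gtr0_norm.
  have dn' : d < 0 by rewrite lt_neqAle d0.
  exists (a + d), a; split=> [x|].
    by rewrite ltr_ndivrMr // mul1r ltrBrDl nmulr_lgt0 ?invr_lt0 // subr_lt0 andbC.
  by rewrite pint_affineN // comp ltr0_norm.
have KE' : EFin \o K = (EFin \o horner p) \_ (`]lo, hi[ : set R).
  apply/funext => x; rewrite patchE /= /K KE.
  have -> : (x \in (`]lo, hi[%classic : set R)) = (lo < x < hi).
    by apply/idP/idP; rewrite inE /= in_itv.
  by case: ifP; rewrite // pE.
split; first by rewrite KE'; apply/integrable_restrict => //; rewrite setTI.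
rewrite -/(comp EFin K).
have -> : (\int[lebesgue_measure]_x (K x)%:E =
  \int[lebesgue_measure]_(x in `]lo, hi[) (p.[x])%:E)%E.
  by rewrite [RHS]integral_mkcond -KE'.
rewrite -(fineK (integrable_fin_num _ (intp lo hi))) //; congr (_%:E).
have ioc : (@lebesgue_measure R).-integrable `]lo, hi] (EFin \o horner p).
  apply: (integrableS _ _ _ (pint_integrable lo hi p)) => //.
  exact: subset_itv_oc_cc.
rewrite -iE /pint -(Rintegral_itv_obnd_cbnd ioc).
by rewrite -(Rintegral_itv_bndo_bndc (intp lo hi)).
Qed.

End crossing.

Section green.
Variables (R : realType) (P : polygon R).
Let T := region P.
Let E := edges P.
Hypothesis cT : convex_set T.
Notation nrm e := (outward_normal T e).
Local Notation mR := (measurableTypeR R).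

Lemma measurable_region : measurable (T : set (mR * mR)).
Proof.
have -> : T = \bigcap_(e in [set` E]) [set x | 0 <= height P e x].
  by apply/seteqP; split => x /=; move/(regionE cT).
apply: fin_bigcap_measurable; first exact: finite_seq.
move=> e _.
have -> : [set x | 0 <= height P e x] =
    setT `&` (peval (affine_poly (dot (nrm e) e.1) (- nrm e))) @^-1` `[0, +oo[.
  rewrite setTI; apply/seteqP; split => x /=;
    by rewrite in_itv /= andbT affine_poly_eval dotNl /height dotBr.
exact: measurable_peval.
Qed.

(** The extent of an edge transversally to u is its length times the normal component
of u: this turns integrals over parallel lines into integrals over edges. *)
Lemma cross_normal e u : e \in E -> `|cross (dir e) u| = len e * `|dot (nrm e) u|.
Proof.
move=> eE; have [nn nd _] := outward_normalP cT eE; have l0 := len_gt0 (edge_ne eE).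
have lnE := normal_colinear cT eE (lnormal_dir e).
have ln1 := lnormal_unit (edge_ne eE).
rewrite lnE dotZl dotZr nn mulr1 in ln1.
set c := dot (lnormal e) (nrm e) in lnE ln1.
have c1 : `|c| = 1.
  by apply/eqP; rewrite -(@pexpr_eq1 _ _ 2) // -normrX expr2 ln1 normr1.
have -> : cross (dir e) u = len e * dot (lnormal e) u.
  by rewrite /lnormal dotZl mulrA divff ?gt_eqF // mul1r /cross /dot /=; ring.
by rewrite lnE dotZl !normrM c1 mul1r gtr0_norm.
Qed.

(** Integrate section_sum over the lines parallel to u, indexed by x; the lines through
a vertex form a null set. Horizontal and vertical u give the two components of
the divergence theorem. *)
Lemma integral_crossing_terms (q : bipoly R) (u : R * R) (b : R -> R * R)
    (a d : (R * R) * (R * R) -> R) (F : R -> \bar R) :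
  u != 0 ->
  (forall e x, hit_param (b x) u e = (x - a e) / d e) ->
  (forall e, `|d e| = `|cross (dir e) u|) ->
  (forall e x, x != a e -> cross (e.1 - b x) u != 0) ->
  (forall e x, x != a e + d e -> cross (e.2 - b x) u != 0) ->
  measurable_fun setT F ->
  (forall x, F x = \int[lebesgue_measure]_t
    ((EFin \o horner (line_poly q (b x) u)^`()) \_ [set t | T (b x + t *: u)%R]) t)%E ->
  (\int[lebesgue_measure]_x F x = (\sum_(e <- E) dot (nrm e) u *
     (len e * pint 0 1 (line_poly q e.1 (dir e))))%:E)%E.
Proof.
move=> u0 hitE dE g1 g2 mF FE.
pose K e x : R := if 0 < (x - a e) / d e < 1
  then (line_poly q e.1 (dir e)).[(x - a e) / d e] else 0.
have cE e x : crossing_term P q (b x) u e = Num.sg (dot (nrm e) u) * K e x.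
  rewrite /crossing_term /K hitE; case: ifP => _; last by rewrite mulr0.
  by rewrite line_poly_eval.
have iK e : (@lebesgue_measure R).-integrable setT
    (fun x => (Num.sg (dot (nrm e) u))%:E * (K e x)%:E)%E.
  by apply: integrableZl => //; exact: (crossing_integral _ _ _).1.
pose G x := (\sum_(e <- E) ((Num.sg (dot (nrm e) u))%:E * (K e x)%:E))%E.
transitivity (\int[lebesgue_measure]_x G x)%E; last first.
  rewrite integral_sum //.
  rewrite -sumEFin big_seq [RHS]big_seq; apply: eq_bigr => e eE.
  rewrite integralZl //; last exact: (crossing_integral _ _ _).1.
  rewrite (crossing_integral _ _ _).2 -EFinM dE (cross_normal _ eE); congr (_%:E).
  rewrite [in RHS](numEsg (dot (nrm e) u)); ring.
apply: ae_eq_integral => //.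
  by apply: (measurable_int (@lebesgue_measure R)); exact: integrable_sum.
(* the exceptional lines are those through a vertex *)
have cnt : countable (\bigcup_(e in [set` E]) [set a e; a e + d e]).
  apply: finite_set_countable; apply: bigcup_finite; first exact: finite_seq.
  by move=> e _; rewrite finite_setU; split; exact: finite_set1.
exists (\bigcup_(e in [set` E]) [set a e; a e + d e]); split.
- exact: countable_measurable.
- exact: countable_lebesgue_measure0.
move=> x /= h; apply: contrapT => hx; apply: h => _.
rewrite FE section_sum //.
  by rewrite /G -sumEFin; apply: eq_bigr => e _; rewrite cE EFinM.
move=> e eE; split.
  by apply: g1; apply/eqP => xa; apply: hx; exists e => //; left.
by apply: g2; apply/eqP => xa; apply: hx; exists e => //; right.
Qed.

(** Divergence theorem for (0, q), by integration over vertical lines. *)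
Lemma green_y q : integral_on T (peval (dy q)) =
  \sum_(e <- E) (nrm e).2 * (len e * pint 0 1 (line_poly q e.1 (dir e))).
Proof.
have [B HB] := region_bounded P.
have HB' x : T x -> `|x.1 - (0 : R * R).1| <= B /\ `|x.2 - (0 : R * R).2| <= B.
  by move=> /HB /=; rewrite !subr0.
have iT := set_integrable measurable_region HB' (dy q).
pose f := (EFin \o peval (dy q)) \_ T.
have iF : (@lebesgue_measure R \x @lebesgue_measure R)%E.-integrable setT f.
  by apply/integrable_restrict => //; [exact: measurable_region|rewrite setTI].
rewrite /integral_on /Rintegral integral_mkcond -/f -integral12_prod_meas1 //.
rewrite (@integral_crossing_terms q (0, 1) (fun x => (x,
  0)) (fun e => e.1.1) (fun e => (dir e).1)).
- by rewrite /=; apply: eq_bigr => e _; congr (_ * _); rewrite /dot /=; ring.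
- by apply/eqP => -[] /eqP; rewrite oner_eq0.
- by move=> e x; rewrite /hit_param /cross /=; congr (_ / _); ring.
- by move=> e; congr (`|_|); rewrite /cross /=; ring.
- by move=> e x; apply: contra_neq; rewrite /cross /= => h; lra.
- by move=> e x; apply: contra_neq; rewrite /cross /= => h; lra.
- exact: (measurable_fubini_F iF).
- move=> x; apply: eq_integral => y _; rewrite !patchE /=.
  have xy : (x, 0) + y *: (0, 1) = (x, y) :> R * R.
    by congr pair; rewrite /= /GRing.scale /=; ring.
  rewrite deriv_line_poly /= scale0r add0r scale1r line_poly_eval xy.
  congr (if _ then _ else _); apply/idP/idP; rewrite !inE /=.
    by rewrite xy.
  by rewrite xy.
Qed.

Lemma green_x q : integral_on T (peval (dx q)) =
  \sum_(e <- E) (nrm e).1 * (len e * pint 0 1 (line_poly q e.1 (dir e))).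
Proof.
have [B HB] := region_bounded P.
have HB' x : T x -> `|x.1 - (0 : R * R).1| <= B /\ `|x.2 - (0 : R * R).2| <= B.
  by move=> /HB /=; rewrite !subr0.
have iT := set_integrable measurable_region HB' (dx q).
pose f := (EFin \o peval (dx q)) \_ T.
have iF : (@lebesgue_measure R \x @lebesgue_measure R)%E.-integrable setT f.
  by apply/integrable_restrict => //; [exact: measurable_region|rewrite setTI].
rewrite /integral_on /Rintegral integral_mkcond -/f -integral21_prod_meas1 //.
rewrite (@integral_crossing_terms q (1, 0) (fun x => (0,
  x)) (fun e => e.1.2) (fun e => (dir e).2)).
- by rewrite /=; apply: eq_bigr => e _; congr (_ * _); rewrite /dot /=; ring.
- by apply/eqP => -[] /eqP; rewrite oner_eq0.
- move=> e x; rewrite /hit_param /cross /= !mulr0 !mulr1 !sub0r invrN mulrNN;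
    congr (_ / _).
- by move=> e; rewrite -normrN; congr (`|_|); rewrite /cross /=; ring.
- by move=> e x; apply: contra_neq; rewrite /cross /= => h; lra.
- by move=> e x; apply: contra_neq; rewrite /cross /= => h; lra.
- exact: (measurable_fubini_G iF).
- move=> x; apply: eq_integral => y _; rewrite !patchE /=.
  have xy : (0, x) + y *: (1, 0) = (y, x) :> R * R.
    by congr pair; rewrite /= /GRing.scale /=; ring.
  rewrite deriv_line_poly /= scale0r addr0 scale1r line_poly_eval xy.
  congr (if _ then _ else _); apply/idP/idP; rewrite !inE /=.
    by rewrite xy.
  by rewrite xy.
Qed.

End green.

(** * The weak gradient as a perturbation of the gradient *)

Section gram_system.
Variables (R : realType) (I L : bipoly R -> R) (j : nat).
Hypothesis addI : forall p q, I (p + q) = I p + I q.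
Hypothesis scaleI : forall a p, I (a *: p) = a * I p.
Hypothesis LD : forall p q, L (p + q) = L p + L q.
Hypothesis LZ : forall a p, L (a *: p) = a * L p.
Hypothesis L0 : forall p, deg_le j p -> I (p * p) = 0 -> L p = 0.

Let lin_sum (F : bipoly R -> R) : (forall p q, F (p + q) = F p + F q) ->
  (forall a p, F (a *: p) = a * F p) ->
  forall (A : Type) (r : seq A) (c : A -> R) (b : A -> bipoly R),
  F (\sum_(i <- r) c i *: b i) = \sum_(i <- r) c i * F (b i).
Proof.
move=> FD FZ A r c b; elim/big_rec2: _ => [|i y1 y2 _ <-]; last by rewrite FD FZ.
by rewrite -(scale0r 0) FZ mul0r.
Qed.

(** In the monomial basis the equation for w is a linear system with the Gram matrix of
I. It is solvable when the right-hand side vanishes on the kernel, and a kernel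
vector is the coordinate vector of a p with I (p * p) = 0. *)
Lemma riesz : exists2 w, deg_le j w & forall q, deg_le j q -> I (w * q) = L q.
Proof.
pose B : finType := bmultinom 2 j.+1.
pose b (i : 'I_#|B|) : bipoly R := mpolyX R (bmnm (enum_val i)).
have bdeg i : deg_le j (b i) by rewrite /deg_le msizeX ltnS -ltnS bmdeg.
have span q : deg_le j q -> q = \sum_i mcoeff (bmnm (enum_val i)) q *: b i.
  move=> qj; rewrite {1}(mpolywE qj) (reindex (@enum_val B predT)) //=.
  exact: (onW_bij _ (enum_val_bij B)).
pose G : 'M[R]_#|B| := \matrix_(i, k) I (b i * b k).
pose l : 'rV[R]_#|B| := \row_i L (b i).
have /submxP[c cG] : (l <= G)%MS.
  (* the columns of the cokernel are the coordinates of the p in the kernel *)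
  rewrite submxE; apply/eqP/rowP => k; rewrite !mxE.
  pose u i := cokermx G i k.
  have Gu i : \sum_a I (b i * b a) * u a = 0.
    have /matrixP/(_ i k) := mulmx_coker G; rewrite !mxE => GK.
    by rewrite -[RHS]GK; apply: eq_bigr => a _; rewrite mxE.
  pose p := \sum_a u a *: b a.
  have pdeg : deg_le j p by apply: deg_le_sum => a _; apply: deg_leZ.
  have Ibp i : I (b i * p) = 0.
    rewrite /p mulr_sumr -(Gu i).
    under eq_bigr do rewrite -scalerAr.
    by rewrite lin_sum //; apply: eq_bigr => a _; rewrite mulrC.
  have : L p = 0.
    apply: L0 => //; rewrite {1}/p mulr_suml.
    under eq_bigr do rewrite -scalerAl.
    by rewrite lin_sum // big1 // => a _; rewrite Ibp mulr0.
  move=> Lp; rewrite -[RHS]Lp /p lin_sum //; apply: eq_bigr => a _.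
  by rewrite [l _ _]mxE mulrC.
pose w := \sum_i c ord0 i *: b i.
exists w; first by apply: deg_le_sum => a _; apply: deg_leZ.
move=> q qj; rewrite (span q qj) lin_sum // mulr_sumr.
under eq_bigr do rewrite -scalerAr.
rewrite lin_sum //; apply: eq_bigr => k _; congr (_ * _).
have := cG => /rowP/(_ k); rewrite !mxE => ->.
rewrite /w mulr_suml.
under eq_bigr do rewrite -scalerAl.
by rewrite lin_sum //; apply: eq_bigr => a _; rewrite mxE.
Qed.
End gram_system.

Section weak_gradient_char.
Variables (R : realType) (P : polygon R).
Let T := region P.
Let E := edges P.
Hypothesis cT : convex_set T.
Notation nrm e := (outward_normal T e).
Notation I p := (integral_on T (peval p)).
Implicit Types (p : bipoly R) (v q : bipoly R * bipoly R).

Definition trace e p : {poly R} := line_poly p e.1 (dir e).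

(** The integral of g * (v . n) over the edge e. *)
Definition flux e (g : {poly R}) v : R :=
  len e * pint 0 1 (g * ((nrm e).1 *: trace e v.1 + (nrm e).2 *: trace e v.2)).

Lemma region_box : exists B, forall x, T x ->
  `|x.1 - (0 : R * R).1| <= B /\ `|x.2 - (0 : R * R).2| <= B.
Proof.
by have [B HB] := region_bounded P; exists B => x /HB; rewrite !subr0.
Qed.

Lemma region_intD p (q : bipoly R) : I (p + q) = I p + I q.
Proof. by have [B HB] := region_box; exact: (integralD (measurable_region cT) HB). Qed.
Lemma region_intZ a p : I (a *: p) = a * I p.
Proof. by have [B HB] := region_box; exact: (integralZ (measurable_region cT) HB). Qed.
Lemma region_int0 : I 0 = 0.
Proof. by rewrite -(scale0r (0 : bipoly R)) region_intZ mul0r. Qed.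
Lemma region_intN p : I (- p) = - I p.
Proof. by rewrite -scaleN1r region_intZ mulN1r. Qed.
Lemma region_intB p (q : bipoly R) : I (p - q) = I p - I q.
Proof. by rewrite region_intD region_intN. Qed.
Lemma le_region_int p (q : bipoly R) : (forall x, T x -> peval p x <= peval q x) ->
  I p <= I q.
Proof. by have [B HB] := region_box;
  exact: (le_integral_on (measurable_region cT) HB). Qed.
Lemma region_int_ge0 p : (forall x, T x -> 0 <= peval p x) -> 0 <= I p.
Proof.
by move=> p0; rewrite -region_int0; apply: le_region_int => x /p0; rewrite peval0.
Qed.
Lemma eq_region_int p (q : bipoly R) : (forall x, T x -> peval p x = peval q x) ->
  I p = I q.
Proof. by move=> pq; apply/eqP; rewrite eq_le !le_region_int // => x /pq ->. Qed.

Lemma fluxDl e g1 g2 v : flux e (g1 + g2) v = flux e g1 v + flux e g2 v.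
Proof. by rewrite /flux mulrDl pintD // mulrDr. Qed.

Lemma green (v0 : bipoly R) v :
  I (v0 * (dx v.1 + dy v.2)) + I (dx v0 * v.1 + dy v0 * v.2) =
  \sum_(e <- E) flux e (trace e v0) v.
Proof.
rewrite -region_intD.
have -> : v0 * (dx v.1 + dy v.2) + (dx v0 * v.1 + dy v0 * v.2) =
  dx (v0 * v.1) + dy (v0 * v.2) by rewrite /dx /dy !mderivM; ring.
rewrite region_intD green_x // green_y // -big_split /=; apply: eq_bigr => e _.
rewrite /flux mulrDr -!scalerAr pintD // !pintZ // /trace !line_polyM.
by rewrite /GRing.scale /=; ring.
Qed.

Variables (v0 : bipoly R) (vb : R * R -> R) (G : (R * R) * (R * R) -> {poly R}).
Hypothesis GP : forall e, e \in E -> forall t, 0 < t < 1 ->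
  vb (seg_point e t) = (G e).[t].

Lemma Rintegral_oo (f : R -> R) (p : {poly R}) : (forall t, 0 < t < 1 -> f t = p.[t]) ->
  \int[lebesgue_measure]_(t in `[0, 1]) f t = pint 0 1 p.
Proof.
move=> fp; rewrite /pint /Rintegral; congr fine.
have fE : {in (`]0, 1[%classic : set R), EFin \o f =1 EFin \o horner p}.
  by move=> t; rewrite inE /= in_itv /= => t01; rewrite fp.
have mp : measurable_fun (`]0, 1[%classic : set R) (EFin \o horner p).
  apply: (measurable_int (@lebesgue_measure R)).
  apply: (integrableS _ _ _ (pint_integrable 0 1 p)) => //.
  exact: subset_itv_oo_cc.
have mf : measurable_fun (`]0, 1[%classic : set R) (EFin \o f).
  by apply: (eq_measurable_fun (EFin \o horner p)) => // t tD; rewrite fE.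
rewrite (integral_itv_bndoo _ _ mf) (integral_itv_bndoo _ _ mp).
exact: eq_integral.
Qed.

Lemma flux_edge e v : e \in E -> edge_integral e
  (fun x => vb x * dot (peval v.1 x, peval v.2 x) (nrm e)) = flux e (G e) v.
Proof.
move=> eE; rewrite /edge_integral /flux; congr (_ * _).
apply: Rintegral_oo => t t01.
by rewrite GP // hornerM hornerD !hornerZ !line_poly_eval /dot /=; congr (_ * _); ring.
Qed.

Lemma gap_edge e : e \in E -> edge_integral e (fun x => (peval v0 x - vb x) ^+ 2) =
  len e * pint 0 1 ((G e - trace e v0) ^+ 2).
Proof.
move=> eE; rewrite /edge_integral; congr (_ * _); apply: Rintegral_oo => t t01.
by rewrite GP // horner_exp hornerD hornerN line_poly_eval; ring.
Qed.

Let g e := G e - trace e v0.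

(** Undoing the integration by parts in the definition: the weak gradient differs from
the gradient only through the jumps g e on the edges. All estimates start from
this identity. *)
Lemma weak_gradient_identity j w : is_weak_gradient j P v0 vb w <->
  [/\ deg_le j w.1, deg_le j w.2 & forall q : bipoly R * bipoly R, deg_le j q.1 ->
    deg_le j q.2 ->
    I (w.1 * q.1 + w.2 * q.2) =
    I (dx v0 * q.1 + dy v0 * q.2) + \sum_(e <- E) flux e (g e) q].
Proof.
have key q : - integral_on T (fun x => peval v0 x * (peval (dx q.1) x + peval (dy
  q.2) x)) +
    \sum_(e <- E) edge_integral e
         (fun x => vb x * dot (peval q.1 x, peval q.2 x) (nrm e)) =
    I (dx v0 * q.1 + dy v0 * q.2) + \sum_(e <- E) flux e (g e) q.
  have -> : integral_on T (fun x => peval v0 x * (peval (dx q.1) x + peval (dy q.2) x)) =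
      I (v0 * (dx q.1 + dy q.2)).
    by apply: eq_Rintegral => x _; rewrite pevalM pevalD.
  have -> : \sum_(e <- E) edge_integral e
         (fun x => vb x * dot (peval q.1 x, peval q.2 x) (nrm e)) =
      \sum_(e <- E) flux e (g e) q + \sum_(e <- E) flux e (trace e v0) q.
    rewrite -big_split /= big_seq [RHS]big_seq; apply: eq_bigr => e eE.
    by rewrite flux_edge // -fluxDl subrK.
  by rewrite -green; ring.
have lhs q : integral_on T (fun x => peval w.1 x * peval q.1 x + peval w.2 x * peval
  q.2 x) =
    I (w.1 * q.1 + w.2 * q.2).
  by apply: eq_Rintegral => x _; rewrite pevalD !pevalM.
by split=> -[w1 w2 H]; split => // q q1 q2; have := H q q1 q2;
  rewrite -/T lhs ?key // => ->; rewrite key.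
Qed.

Hypothesis sep : forall j p, deg_le j p -> I (p * p) = 0 -> forall x, T x ->
  peval p x = 0.

(** The two components are found separately. By sep, a polynomial of the kernel
vanishes on T, hence also on its edges, and the right-hand side is then 0. *)
Lemma weak_gradient_exists j : is_weak_gradient j P v0 vb (weak_gradient j P v0 vb).
Proof.
suff [w wP] : exists w, is_weak_gradient j P v0 vb w
  by exact: (xgetPex (0, 0) (ex_intro _ w wP)).
have trace0 p : (forall x, T x -> peval p x = 0) -> forall e t, e \in E ->
  0 <= t <= 1 -> (trace e p).[t] = 0.
  by move=> p0 e t eE t01; rewrite line_poly_eval; apply: p0; apply: (edge_in eE _).1.
have aux d (c : (R * R) * (R * R) -> R) : exists2 w, deg_le j w &
  forall q : bipoly R, deg_le j q ->
    I (w * q) = I (d * q) + \sum_(e <- E) len e * pint 0 1 (g e * (c e *: trace e q)).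
  apply: (@riesz R (fun p => I p)).
  - exact: region_intD.
  - exact: region_intZ.
  - move=> p q; rewrite mulrDr region_intD addrACA -big_split /=; congr (_ + _).
    apply: eq_bigr => e _.
    by rewrite /trace line_polyD scalerDr mulrDr pintD // mulrDr.
  - move=> a p; rewrite -scalerAr region_intZ mulrDr mulr_sumr; congr (_ + _).
    apply: eq_bigr => e _.
    rewrite /trace line_polyZ scalerA (mulrC (c e)) -scalerA -scalerAr pintZ //.
    by rewrite mulrCA.
  - move=> p pj p0; have pT := sep pj p0.
    have -> : I (d * p) = 0.
      by rewrite -region_int0; apply: eq_region_int => x Tx;
        rewrite pevalM pT // mulr0 peval0.
    rewrite add0r big_seq big1 // => e eE.
    have z t : 0 <= t <= 1 -> (g e * (c e *: trace e p)).[t] = 0.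
      by move=> t01; rewrite hornerM hornerZ (trace0 _ pT) // !mulr0.
    rewrite (_ : pint _ _ _ = 0) ?mulr0 //; apply/eqP; rewrite eq_le; apply/andP; split.
      rewrite -[leRHS](pint0 ler01).
      by apply: le_pint => t /z ->; rewrite horner0.
    by apply: pint_ge0 => t /z ->.
have [w1 w1j H1] := aux (dx v0) (fun e => (nrm e).1).
have [w2 w2j H2] := aux (dy v0) (fun e => (nrm e).2).
exists (w1, w2); apply/weak_gradient_identity; split => // q q1 q2.
rewrite /= region_intD H1 // H2 // addrACA -region_intD -big_split /=; congr (_ + _).
by apply: eq_bigr => e _; rewrite -mulrDr -pintD // -mulrDr.
Qed.
End weak_gradient_char.

(** * Estimates on one element *)

Section estimates.
Variables (R : realType) (m j : nat) (al0 th0 : R).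
Hypotheses (m3 : (3 <= m)%N) (al01 : 1 <= al0) (th00 : 0 < th0).
Implicit Types (p : bipoly R) (v q : bipoly R * bipoly R) (e f : (R * R) * (R * R)).

(** The diameter is at most ratio times the length of any edge. *)
Let ratio : R := 2 * m%:R * al0.
Let s := sin_bound th0.
(** Lower bound for the relative height of the midpoint of an edge above any other
edge. *)
Let kap := s / (2 * ratio).
(** Lower bound for all relative heights on a square deep inside the element, and for
those above the other edges on the middle half of an edge. *)
Let kap4 := kap / 4.
(** Lower bound there for a product of at most m relative heights. *)
Let low := kap4 ^+ m.
(** Constant of the inverse estimate on an element. *)
Let A0 := sup_const j (4 / kap + 1) ^+ 2 * 16 / (kap ^+ 2 * low).
(** Constant of the inverse estimate from the middle half of an edge to the values of
the edge parameter that its extension to the element takes. *)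
Let A1 := 2 * sup_const j (2 * ratio + 2) / low.

Let m0 : 0 < m%:R :> R. Proof. by rewrite ltr0n (leq_trans _ m3). Qed.
Let al00 : 0 < al0. Proof. exact: lt_le_trans al01. Qed.
Let ratio0 : 0 < ratio. Proof. by rewrite !mulr_gt0. Qed.
Let s0 : 0 < s. Proof. exact: sin_bound_gt0. Qed.
Let kap0 : 0 < kap. Proof. by rewrite divr_gt0 // mulr_gt0. Qed.
Let kap40 : 0 < kap4. Proof. by rewrite divr_gt0. Qed.
Let low0 : 0 < low. Proof. by rewrite exprn_gt0. Qed.
Let A00 : 0 < A0.
Proof.
have c0 : 0 < sup_const j (4 / kap + 1).
  by rewrite sup_const_gt0 // addr_ge0 // divr_ge0 // ltW.
by rewrite /A0 divr_gt0 // mulr_gt0 // exprn_gt0.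
Qed.
(** Constant in the bound of the jump on one edge by the energy of the weak gradient. *)
Let A4 := 64 * ratio ^+ 2 * A0 * A1 ^+ 2 / s ^+ 2.

Definition upper_const : R := 2 + 2 * (m%:R * A0).
(** The gradient by energy_lower, in which the jumps are replaced by their bound with
constant m * A4, plus the jumps. *)
Definition lower_const : R := (2 + 2 * (m%:R * A0) * (m%:R * A4) + m%:R * A4)^-1.

Let A10 : 0 < A1.
Proof.
have c0 : 0 < sup_const j (2 * ratio + 2).
  by rewrite sup_const_gt0 // addr_ge0 // mulr_ge0 // ltW.
by rewrite /A1 divr_gt0 // mulr_gt0.
Qed.

Let A40 : 0 < A4.
Proof.
apply: divr_gt0; last exact: exprn_gt0.
apply: mulr_gt0; last exact: exprn_gt0.
by apply: mulr_gt0 => //; apply: mulr_gt0 => //; exact: exprn_gt0.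
Qed.

Lemma upper_const_gt0 : 0 < upper_const.
Proof. by apply: ltr_wpDr => //; apply: mulr_ge0 => //; apply: mulr_ge0; apply: ltW. Qed.

Lemma lower_const_gt0 : 0 < lower_const.
Proof.
have c1 : 0 < m%:R * A4 by exact: mulr_gt0.
rewrite invr_gt0; apply: addr_gt0 => //; apply: addr_gt0 => //.
by apply: mulr_gt0 => //; apply: mulr_gt0 => //; exact: mulr_gt0.
Qed.

Section on_polygon.
Variable P : polygon R.
Let T := region P.
Let E := edges P.
Hypotheses (cT : convex_set T) (Em : (size E <= m)%N) (reg : shape_regular al0 th0 P).
Notation nrm e := (outward_normal T e).
Notation I p := (integral_on T (peval p)).
Let h := diam T.

Let some_edge : exists e, e \in E.
Proof.
have [/andP[s3 _] _ _ _ _] := polygonP P; exists (nth (0, 0) E 0).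
by rewrite mem_nth // size_edges_of (leq_trans _ s3).
Qed.

Let dist_h x y : T x -> T y -> enorm (x - y) <= h.
Proof. exact: (dist_diam al01 reg). Qed.

Let len_h e : e \in E -> len e <= h.
Proof. by move=> eE; have [T1 T2] := edge_end eE; exact: dist_h. Qed.

Let h_len e : e \in E -> h <= ratio * len e.
Proof. exact: (diam_len al01 reg Em). Qed.

Let h0 : 0 < h.
Proof. by have [e eE] := some_edge;
  exact: lt_le_trans (len_gt0 (edge_ne eE)) (len_h eE). Qed.

(** Height above e as an affine polynomial, scaled to take values in
[0, 1] on the element. *)
Definition rel_height e : bipoly R :=
  affine_poly (h^-1 * dot (nrm e) e.1) (- h^-1 *: nrm e).

Lemma rel_heightE e x : peval (rel_height e) x = h^-1 * height P e x.
Proof. by rewrite affine_poly_eval dotZl /height dotBr -/T; ring. Qed.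

Lemma rel_height_ge0 e x : e \in E -> T x -> 0 <= peval (rel_height e) x.
Proof.
by move=> eE Tx; rewrite rel_heightE mulr_ge0 ?invr_ge0 ?(ltW h0) // (height_ge0 cT).
Qed.

Lemma rel_height_le1 e x : e \in E -> T x -> peval (rel_height e) x <= 1.
Proof.
move=> eE Tx; rewrite rel_heightE mulrC ler_pdivrMr // mul1r.
have [nn _ _] := outward_normalP cT eE.
rewrite (le_trans (ler_norm _)) // (le_trans (cauchy_schwarz _ _)) //.
rewrite {1}/enorm nn sqrtr1 mul1r; apply: dist_h => //.
by case: (edge_end eE).
Qed.

Let l0 := h / ratio.
Let l00 : 0 <= l0. Proof. by rewrite divr_ge0 ?ltW. Qed.
Let l0_len e : e \in E -> l0 <= len e.
Proof. by move=> /h_len; rewrite ler_pdivrMr // mulrC. Qed.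

(** The geometric input in scale-invariant form. *)
Lemma rel_height_mid e f : e \in E -> f \in E -> f != e ->
  kap <= peval (rel_height e) (seg_point f 2^-1).
Proof.
move=> eE fE fe; rewrite rel_heightE mulrC ler_pdivlMr //.
apply: le_trans (mid_height cT th00 reg l00 l0_len eE fE fe).
rewrite /kap /l0 -/s le_eqVlt; apply/orP; left; apply/eqP; field.
by rewrite gt_eqF.
Qed.

Lemma inner_square : exists xc, T xc /\
  forall z, `|z.1 - xc.1| <= kap4 * h / 2 -> `|z.2 - xc.2| <= kap4 * h / 2 ->
  T z /\ forall e, e \in E -> kap4 <= peval (rel_height e) z.
Proof.
have [xc [Txc Hc]] := inner_center cT th00 reg l00 l0_len.
exists xc; split => // z z1 z2.
have dz : enorm (z - xc) <= kap4 * h.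
  by have := @enorm_le _ (z - xc) _ z1 z2; rewrite mulrC divfK // pnatr_eq0.
have hz e : e \in E -> kap4 * h <= height P e z.
  move=> eE; apply: le_trans (height_lip cT _ _ eE).
  have := Hc e eE.
  have -> : s * l0 / 4 = 2 * (kap4 * h).
    by rewrite /kap4 /kap /l0; field; rewrite gt_eqF.
  by move: dz; lra.
split; last by move=> e eE; rewrite rel_heightE mulrC ler_pdivlMr //; exact: hz.
apply/(regionE cT) => e eE; apply: le_trans (hz e eE).
by rewrite mulr_ge0 // ltW.
Qed.

Let kap4_le1 : kap4 <= 1.
Proof.
have [e eE] := some_edge; have [xc [Txc H]] := inner_square.
have r0 : 0 <= kap4 * h / 2 by rewrite divr_ge0 // mulr_ge0 // ltW.
have := H xc; rewrite !subrr normr0 => /(_ r0 r0) [_ /(_ e eE) k].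
exact: le_trans k (rel_height_le1 eE Txc).
Qed.

(** Inverse estimate on T: the weight Om may vanish on the boundary, as products of
relative heights do. *)
Lemma sup_region p Om : deg_le j p -> (forall z, T z -> 0 <= peval Om z) ->
  (forall z, T z -> (forall e, e \in E -> kap4 <= peval (rel_height e) z) ->
    low <= peval Om z) ->
  forall x, T x -> peval p x ^+ 2 * h ^+ 2 <= A0 * I (Om * p ^+ 2).
Proof.
move=> pj Om0 Oml x Tx; have [xc [Txc Hsq]] := inner_square.
have [B HB] := region_box P.
set r := kap4 * h / 2 in Hsq.
have r0 : 0 < r by rewrite divr_gt0 // mulr_gt0.
have lE : 2 * r = kap4 * h by rewrite /r mulrC divfK // pnatr_eq0.
have l00' : 0 < 2 * r by rewrite mulr_gt0.
have dx : enorm (x - xc) <= h by exact: dist_h.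
have M : (4 / kap + 1) * (2 * r) = h + 2 * r.
  by rewrite mulrDl mul1r lE /kap4; congr (_ + _); field; rewrite gt_eqF.
have [dx1 dx2] := enorm_coord (x - xc).
have := @sup_square _ _ _ _ (measurable_region cT) HB j (4 / kap + 1) (2 * r) (xc.1 - r)
  (xc.2 - r) p Om low x l00' pj (ltW low0) Om0.
rewrite -/T M => H.
have {}H : low * (peval p x ^+ 2 * (2 * r) ^+ 2) <=
   sup_const j (4 / kap + 1) ^+ 2 * I (Om * p ^+ 2).
  apply: H.
  - move=> z /andP[z1 z2] /andP[z3 z4].
    have [||Tz lz] := Hsq z; [rewrite ler_norml; lra..|].
    by split => //; exact: Oml.
  - have -> : x.1 - (xc.1 - r) = (x.1 - xc.1) + r by ring.
    rewrite (le_trans (ler_normD _ _)) // (gtr0_norm r0).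
    by move: dx1 => /=; lra.
  - have -> : x.2 - (xc.2 - r) = (x.2 - xc.2) + r by ring.
    rewrite (le_trans (ler_normD _ _)) // (gtr0_norm r0).
    by move: dx2 => /=; lra.
have c0 : 0 < kap ^+ 2 * low / 16 by rewrite divr_gt0 // mulr_gt0 // exprn_gt0.
rewrite -(ler_pM2l c0).
have -> : kap ^+ 2 * low / 16 * (peval p x ^+ 2 * h ^+ 2) =
  low * (peval p x ^+ 2 * (2 * r) ^+ 2) by rewrite lE /kap4; field.
apply: (le_trans H); rewrite le_eqVlt; apply/orP; left; apply/eqP.
by rewrite /A0; field; rewrite !gt_eqF // exprn_gt0.
Qed.

Lemma sup_region1 p x : deg_le j p -> T x -> peval p x ^+ 2 * h ^+ 2 <= A0 * I (p ^+ 2).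
Proof.
move=> pj Tx; rewrite -[p ^+ 2]mul1r; apply: sup_region => //.
  by move=> z _; rewrite peval1.
by move=> z _ _; rewrite peval1; apply: exprn_ile1 => //; exact: ltW.
Qed.

Lemma integral_sep p : deg_le j p -> I (p * p) = 0 -> forall x, T x -> peval p x = 0.
Proof.
move=> pj p0 x Tx; have := sup_region1 pj Tx; rewrite expr2 p0 mulr0 => h1.
apply/eqP; rewrite -sqrf_eq0 eq_le sqr_ge0 andbT.
by move: h1; rewrite pmulr_lle0 // exprn_gt0.
Qed.

Lemma prod_rel_height_bounds (S : seq ((R * R) * (R * R))) : {subset S <= E} ->
  forall x, T x -> 0 <= peval (\prod_(f <- S) rel_height f) x <= 1.
Proof.
move=> SE x Tx; rewrite peval_prod big_seq; apply/andP; split.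
  by apply: prodr_ge0 => f fS; apply: rel_height_ge0 => //; exact: SE.
by apply: prodr_ile1 => f /SE fE; rewrite rel_height_ge0 //= rel_height_le1.
Qed.

Lemma prod_rel_height_low (S : seq ((R * R) * (R * R))) x : {subset S <= E} ->
  (size S <= m)%N ->
  (forall f, f \in S -> kap4 <= peval (rel_height f) x) ->
    low <= peval (\prod_(f <- S) rel_height f) x.
Proof.
move=> SE Sm H; rewrite peval_prod; apply: (@le_trans _ _ (kap4 ^+ size S)).
  by apply: ler_wiXn2l => //; exact: ltW.
elim: S SE Sm H => [|f S IH] SE Sm H; first by rewrite big_nil expr0.
rewrite big_cons exprS; apply: ler_pM => //; [exact: ltW|exact/exprn_ge0/ltW| |].
  by apply: H; rewrite inE eqxx.
apply: IH; [by move=> g gS; apply: SE; rewrite inE gS orbT|exact: ltnW|].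
by move=> g gS; apply: H; rewrite inE gS orbT.
Qed.

(** Inverse estimate on an edge for the weight given by a product of relative heights
above other edges, which is bounded below on the middle half of e. *)
Lemma edge_sup (g : {poly R}) e (S : seq ((R * R) * (R * R))) t : (size g <= j.+1)%N ->
  e \in E -> {subset S <= E} -> e \notin S -> (size S <= m)%N -> `|t| <= ratio ->
  g.[t] ^+ 2 <= A1 * pint 0 1 (trace e (\prod_(f <- S) rel_height f) * g ^+ 2).
Proof.
move=> gj eE SE eS Sm tK; set L := trace _ _.
have L0 u : 0 <= u <= 1 -> 0 <= L.[u].
  move=> u01; rewrite line_poly_eval; have Tu := (edge_in eE u01).1.
  by have /andP[] := prod_rel_height_bounds SE Tu.
have Ll u : 4^-1 <= u <= 4^-1 + 2^-1 -> low <= L.[u].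
  move=> /andP[u1 u2]; have u01 : 0 <= u <= 1 by lra.
  rewrite line_poly_eval; apply: prod_rel_height_low => // f fS.
  have fE := SE f fS; have ef : e != f by apply: contraNneq eS => ->.
  have hm := rel_height_mid fE eE ef.
  have Tu t' : 0 <= t' <= 1 -> 0 <= peval (rel_height f) (seg_point e t').
    by move=> t01; apply: rel_height_ge0 => //; exact: (edge_in eE t01).1.
  have E1 : (0 : R) <= (0 : R) <= 1 by rewrite lexx ler01.
  have E2 : (0 : R) <= (1 : R) <= 1 by rewrite lexx ler01.
  have := Tu _ E1; have := Tu _ E2; move: hm; rewrite seg_point0 seg_point1.
  rewrite -/(seg_point e u) !rel_heightE /seg_point /dir !height_line /kap4.
  set a := height P f e.1; set b := height P f e.2; set c := h^-1; move: kap0.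
  move=> k0 h1 h2 h3; have [uu|uu] := leP u 2^-1.
    have : 0 <= (2^-1 - u) * (c * a) by rewrite mulr_ge0 // subr_ge0.
    have : 0 <= (u - 4^-1) * kap by rewrite mulr_ge0 ?subr_ge0 // ltW.
    have : 0 <= u * (c * ((1 - 2^-1) * a + 2^-1 * b) - kap).
      by rewrite mulr_ge0 ?subr_ge0 //; lra.
    lra.
  have : 0 <= (u - 2^-1) * (c * b) by rewrite mulr_ge0 // subr_ge0 ltW.
  have : 0 <= (4^-1 + 2^-1 - u) * kap by rewrite mulr_ge0 ?subr_ge0 // ltW.
  have : 0 <= (1 - u) * (c * ((1 - 2^-1) * a + 2^-1 * b) - kap).
    by rewrite mulr_ge0 ?subr_ge0 //; lra.
  lra.
have half0 : (0 : R) < 2^-1 by rewrite invr_gt0.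
(* poly_sup on the middle half of the edge *)
have tM : `|t - 4^-1| <= (2 * ratio + 2) * 2^-1.
  rewrite (le_trans (ler_normB _ _)) // (gtr0_norm (_ : 0 < 4^-1)) ?invr_gt0 //.
  by move: tK; lra.
have := @poly_sup _ j (2 * ratio + 2) g 4^-1 2^-1 t gj half0 tM.
have g2 u : 0 <= (g ^+ 2).[u] by rewrite horner_exp sqr_ge0.
have le1 : low * pint 4^-1 (4^-1 + 2^-1) (g ^+ 2) <= pint 0 1 (L * g ^+ 2).
  apply: (@le_trans _ _ (pint 4^-1 (4^-1 + 2^-1) (L * g ^+ 2))).
    rewrite -pintZ; last by rewrite lerDl ltW.
    by apply: le_pint => u /Ll hu; rewrite hornerZ (hornerM L) ler_wpM2r.
  apply: pint_sub; [by lra|by rewrite lerDl ltW|by lra|].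
  by move=> u /L0 hu; rewrite (hornerM L) mulr_ge0.
have C0 : 0 < sup_const j (2 * ratio + 2).
  by rewrite sup_const_gt0 // addr_ge0 // mulr_ge0 // ltW.
move=> h1; rewrite -(ler_pM2r half0); apply: (le_trans h1).
rewrite -(ler_pM2l low0) /A1.
have -> : low * (2 * sup_const j (2 * ratio + 2) / low * pint 0 1 (L * g ^+ 2) * 2^-1) =
   sup_const j (2 * ratio + 2) * pint 0 1 (L * g ^+ 2).
  by field; rewrite !gt_eqF.
by rewrite mulrCA ler_pM2l.
Qed.

Definition energy v : R := I (v.1 ^+ 2 + v.2 ^+ 2).

Lemma energy_ge0 v : 0 <= energy v.
Proof. by apply: (region_int_ge0 cT) => x _;
  rewrite pevalD !pevalX addr_ge0 ?sqr_ge0. Qed.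

Lemma sup_vector v x : deg_le j v.1 -> deg_le j v.2 -> T x ->
  (peval v.1 x ^+ 2 + peval v.2 x ^+ 2) * h ^+ 2 <= A0 * energy v.
Proof.
move=> v1 v2 Tx; rewrite mulrDl /energy (region_intD cT) mulrDr.
by apply: lerD; exact: sup_region1.
Qed.

(** Young's inequality together with the bound of v on the edge by its L2 norm on T. *)
Lemma flux_bound e (g : {poly R}) v b : e \in E -> deg_le j v.1 -> deg_le j v.2 ->
  0 < b ->
  flux P e g v <= len e * (b * pint 0 1 (g ^+ 2) + A0 * energy v / h ^+ 2 / (4 * b)).
Proof.
move=> eE v1 v2 b0; rewrite /flux ler_pM2l ?len_gt0 ?(edge_ne eE) //.
set c := _ / (4 * b); have -> : b * pint 0 1 (g ^+ 2) + c = pint 0 1 (b *: g ^+ 2 + c%:P).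
  by rewrite pintD ?ler01 // pintZ ?ler01 // pint_const.
apply: le_pint => t t01.
rewrite hornerM !hornerD !hornerZ hornerC horner_exp !line_poly_eval -!seg_pointE.
have [nn _ _] := outward_normalP cT eE.
have Tx := (edge_in eE t01).1; set x := seg_point e t in Tx *.
apply: (le_trans (young _ _ b0)); rewrite lerD2l /c ler_pM2r ?invr_gt0 ?mulr_gt0 //.
rewrite ler_pdivlMr ?exprn_gt0 //.
apply: le_trans (sup_vector v1 v2 Tx); rewrite ler_pM2r ?exprn_gt0 //.
move: nn; rewrite /dot -/T; set n1 := (nrm e).1; set n2 := (nrm e).2 => nn.
set a1 := peval v.1 x; set a2 := peval v.2 x.
have -> : a1 ^+ 2 + a2 ^+ 2 = (n1 * n1 + n2 * n2) * (a1 ^+ 2 + a2 ^+ 2)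
  by rewrite nn mul1r.
by rewrite -subr_ge0 (_ : _ - _ = (n1 * a2 - n2 * a1) ^+ 2) ?sqr_ge0 //; ring.
Qed.

(** The boundary part of the squared discrete H1 norm on one element. *)
Definition jump (g : (R * R) * (R * R) -> {poly R}) : R :=
  h^-1 * \sum_(e <- E) len e * pint 0 1 (g e ^+ 2).

Lemma jump_ge0 g : 0 <= jump g.
Proof.
apply: mulr_ge0; first by rewrite invr_ge0 ltW.
rewrite big_seq; apply: sumr_ge0 => e eE; apply: mulr_ge0.
  by rewrite ltW // len_gt0 // (edge_ne eE).
by apply: pint_ge0 => u _; rewrite horner_exp sqr_ge0.
Qed.

Lemma sum_flux_bound g v : deg_le j v.1 -> deg_le j v.2 ->
  \sum_(e <- E) flux P e (g e) v <= m%:R * A0 * jump g + energy v / 4.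
Proof.
move=> v1 v2; (* this weight makes the energies of the at most m edges add up to a
  quarter *)
pose b := m%:R * A0 / h.
have b0 : 0 < b.
  apply: divr_gt0; last by [].
  by apply: mulr_gt0.
have Qv := energy_ge0 v.
apply: (@le_trans _ _ (\sum_(e <- E) (m%:R * A0 * (h^-1 * (len e * pint 0 1 (g e ^+ 2))) +
   energy v / (4 * m%:R)))).
  rewrite big_seq [leRHS]big_seq; apply: ler_sum => e eE.
  apply: (le_trans (flux_bound _ eE v1 v2 b0)); rewrite mulrDr; apply: lerD.
    by rewrite le_eqVlt; apply/orP; left; apply/eqP; rewrite /b; ring.
  have -> : len e * (A0 * energy v / h ^+ 2 / (4 * b)) =
    (energy v / (4 * m%:R)) * (len e / h).
    by rewrite /b; field; rewrite !gt_eqF.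
  rewrite ler_piMr ?divr_ge0 ?mulr_ge0 //.
  by rewrite ler_pdivrMr // mul1r len_h.
rewrite big_split /= -mulr_sumr -mulr_sumr lerD2l.
rewrite big_const_seq count_predT iter_addr_0.
have -> : energy v / 4 = (energy v / (4 * m%:R)) *+ m.
  by rewrite -mulr_natr; field; rewrite gt_eqF.
by apply: ler_wpMn2l; rewrite ?divr_ge0 ?mulr_ge0.
Qed.

Section weak_gradient.
Variables (k : nat) (v0 : bipoly R) (w : bipoly R * bipoly R).
Variable (g : (R * R) * (R * R) -> {poly R}).
Hypotheses (k1 : (1 <= k)%N) (kj : (k <= j)%N).
Hypotheses (v0k : deg_le k v0) (gk : forall e, e \in E -> (size (g e) <= k.+1)%N).
Hypotheses (w1j : deg_le j w.1) (w2j : deg_le j w.2).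
Hypothesis wE : forall q, deg_le j q.1 -> deg_le j q.2 ->
  I (w.1 * q.1 + w.2 * q.2) = I (dx v0 * q.1 + dy v0 * q.2) + \sum_(e <- E) flux P e
    (g e) q.

Let grad := (dx v0, dy v0).

Let grad1 : deg_le k.-1 grad.1. Proof. exact: deg_le_mderiv. Qed.
Let grad2 : deg_le k.-1 grad.2. Proof. exact: deg_le_mderiv. Qed.
Let k1j : (k.-1 <= j)%N. Proof. exact: leq_trans (leq_pred _) kj. Qed.
Let grad1j : deg_le j grad.1. Proof. exact: deg_leW grad1. Qed.
Let grad2j : deg_le j grad.2. Proof. exact: deg_leW grad2. Qed.

Let inner_bound v q : I (v.1 * q.1 + v.2 * q.2) <= energy v + energy q / 4.
Proof.
have -> : energy v + energy q / 4 =
    I ((v.1 ^+ 2 + v.2 ^+ 2) + 4^-1 *: (q.1 ^+ 2 + q.2 ^+ 2)).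
  by rewrite (region_intD cT) (region_intZ cT) mulrC.
apply: (le_region_int cT) => x _; rewrite !(pevalD, pevalZ, pevalM, pevalX).
have := young (peval v.1 x) (peval q.1 x) ltr01;
  have := young (peval v.2 x) (peval q.2 x) ltr01.
lra.
Qed.

(** Test the identity with the weak gradient itself. *)
Lemma energy_upper : energy w <= 2 * energy grad + 2 * (m%:R * A0) * jump g.
Proof.
have := wE w1j w2j; have -> : I (w.1 * w.1 + w.2 * w.2) = energy w by [].
have := inner_bound grad w; have := sum_flux_bound g w1j w2j.
rewrite /grad /=; lra.
Qed.

(** Test the identity with minus the gradient. *)
Lemma energy_lower : energy grad <= 2 * energy w + 2 * (m%:R * A0) * jump g.
Proof.
have n1 : deg_le j (- grad.1) by rewrite -scaleN1r; apply: deg_leZ.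
have n2 : deg_le j (- grad.2) by rewrite -scaleN1r; apply: deg_leZ.
have := @wE (- grad.1, - grad.2) n1 n2.
have := @sum_flux_bound g (- grad.1, - grad.2) n1 n2.
have -> : energy (- grad.1, - grad.2) = energy grad by rewrite /energy /= !sqrrN.
have -> : I (w.1 * (- grad.1, - grad.2).1 + w.2 * (- grad.1, - grad.2).2) =
   - I (w.1 * grad.1 + w.2 * grad.2).
  by rewrite -(region_intN cT); congr (integral_on _ (peval _)); rewrite /=; ring.
have -> :
    I (dx v0 * (- grad.1, - grad.2).1 + dy v0 * (- grad.1, - grad.2).2) = - energy grad.
  by rewrite -(region_intN cT); congr (integral_on _ (peval _)); rewrite /=; ring.
have := inner_bound w grad; lra.
Qed.

Hypothesis degs : (k + m - 2 <= j)%N \/ parallel_edges P /\ (k + m - 3 <= j)%N.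

Section one_edge.
Variables (e ep : (R * R) * (R * R)).
Hypotheses (eE : e \in E) (pE : ep \in E) (adj : (e, ep) \in zip E (rot 1 E)) (p12 :
  ep.1 = e.2).
Let t := (len ep)^-1 *: dir ep.
Let S := [seq f <- E | (f != e) && (cross (dir ep) (dir f) != 0)].
Let Lam := \prod_(f <- S) rel_height f.
Let D := t.1 *: dx v0 + t.2 *: dy v0.
Let wt := t.1 *: w.1 + t.2 *: w.2.
Let lp0 : 0 < len ep. Proof. exact: len_gt0 (edge_ne pE). Qed.
Let le0 : 0 < len e. Proof. exact: len_gt0 (edge_ne eE). Qed.

Let tt1 : t.1 ^+ 2 + t.2 ^+ 2 = 1.
Proof.
have : dot t t = 1.
  by rewrite /t dotZl dotZr -enorm_sqr -/(len ep); field; rewrite gt_eqF.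
by rewrite /dot !expr2.
Qed.

Let comp_sq (a b : R) : (t.1 * a + t.2 * b) ^+ 2 <= a ^+ 2 + b ^+ 2.
Proof.
have -> : a ^+ 2 + b ^+ 2 = (t.1 ^+ 2 + t.2 ^+ 2) * (a ^+ 2 + b ^+ 2)
  by rewrite tt1 mul1r.
by rewrite -subr_ge0 (_ : _ - _ = (t.1 * b - t.2 * a) ^+ 2) ?sqr_ge0 //; ring.
Qed.

Let wt_sq x : peval wt x ^+ 2 <= peval (w.1 ^+ 2 + w.2 ^+ 2) x.
Proof.
rewrite (pevalD (t.1 *: w.1)) !pevalZ (pevalD (w.1 ^+ 2)) !pevalX.
exact: comp_sq.
Qed.

Let normal_t : s <= `|dot (nrm e) t|.
Proof.
have [nn nd _] := outward_normalP cT eE.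
have := normal_component (edge_ne eE) nn nd (ltW s0) (adjacent_dot th00 reg adj eE pE
  p12).
by rewrite /t dotZr normrM normfV (gtr0_norm lp0) [_^-1 * _]mulrC ler_pdivlMr.
Qed.

Let cross_pe : cross (dir ep) (dir e) != 0.
Proof.
apply/eqP => c0; have := cross_normal cT (dir ep) eE.
have -> : cross (dir e) (dir ep) = 0 by rewrite -[RHS]oppr0 -c0 /cross; ring.
rewrite normr0 => /esym/eqP; rewrite mulf_eq0 gt_eqF //= normr_eq0 => /eqP n0.
by move: normal_t; rewrite /t dotZr n0 mulr0 normr0 leNgt s0.
Qed.

Let SE : {subset S <= E}. Proof. by move=> f; rewrite mem_filter => /andP[]. Qed.
Let eS : e \notin S. Proof. by rewrite mem_filter eqxx. Qed.

Let sizeS (r : seq ((R * R) * (R * R))) : uniq r -> {subset r <= E} ->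
  (forall f, f \in r -> f \notin S) -> (size S + size r <= m)%N.
Proof.
move=> ur rE rS; apply: leq_trans Em; rewrite -size_cat; apply: uniq_leq_size.
  rewrite cat_uniq ur filter_uniq ?uniq_edges // andbT /=.
  by apply/hasPn => f /rS.
by move=> f; rewrite mem_cat => /orP[/SE|/rE].
Qed.

Let pS : ep \notin S. Proof. by rewrite mem_filter crossxx eqxx andbF. Qed.
Let ep_e : ep != e. Proof. by apply: contraNneq cross_pe => ->; rewrite crossxx. Qed.

Let sizeSk : (size S + k <= j)%N.
Proof.
have S2 : (size S + 2 <= m)%N.
  apply: (@sizeS [:: e; ep]).
  - by rewrite /= inE eq_sym ep_e.
  - by move=> f; rewrite !inE => /orP[] /eqP ->.
  - by move=> f; rewrite !inE => /orP[] /eqP ->.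
case: degs => [kmj|[par kmj]].
  apply: leq_trans kmj; rewrite addnC -addnBA ?leq_add2l; last exact: leq_trans m3.
  by rewrite -(leq_add2r 2) subnK // (leq_trans _ m3).
have [f [fE fp pf]] := par ep pE.
have fe : f != e by apply: contraNneq cross_pe => <-; apply/eqP.
have S3 : (size S + 3 <= m)%N.
  apply: (@sizeS [:: e; ep; f]).
  - by rewrite /= !inE (eq_sym e ep) (negbTE ep_e) (eq_sym e f) (negbTE fe) (eq_sym
      ep f) (negbTE fp).
  - by move=> f'; rewrite !inE => /or3P[] /eqP ->.
  - move=> f'; rewrite !inE => /or3P[] /eqP -> //.
    by rewrite mem_filter (_ : cross _ _ == 0) ?andbF //; apply/eqP.
apply: leq_trans kmj; rewrite addnC -addnBA // leq_add2l.
by rewrite -(leq_add2r 3) subnK.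
Qed.

Let sizeS1 : (size S < m)%N.
Proof.
have := @sizeS [:: e] isT; rewrite addn1; apply.
  by move=> f; rewrite inE => /eqP ->.
by move=> f; rewrite inE => /eqP ->.
Qed.

Let deg_Lam : deg_le (size S) Lam.
Proof. by apply: deg_le_prod => f; exact: deg_le_affine_poly. Qed.

(** Test with the field Lam * r directed along t, the direction of the edge ep that
follows e. Its flux through an edge parallel to ep is zero since it is tangent to
it, and its flux through any other edge but e is zero since Lam vanishes there.
Lam has at most m - 2 factors, and at most m - 3 when ep is parallel to a further
edge; this is what the bound on j is for. *)
Lemma tangential_test r : deg_le j (Lam * r) ->
  I (wt * (Lam * r)) = I (D * (Lam * r)) +
    len e * dot (nrm e) t * pint 0 1 (g e * trace e (Lam * r)).
Proof.
move=> rj; have := @wE (t.1 *: (Lam * r), t.2 *: (Lam * r)) (deg_leZ _ rj) (deg_leZ _ rj).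
have -> : forall v, v.1 * (t.1 *: (Lam * r), t.2 *: (Lam * r)).1 +
    v.2 * (t.1 *: (Lam * r), t.2 *: (Lam * r)).2 = (t.1 *: v.1 + t.2 *: v.2) * (Lam * r).
  by move=> v; rewrite mulrDl -!scalerAr -!scalerAl.
have -> : dx v0 * (t.1 *: (Lam * r), t.2 *: (Lam * r)).1 +
    dy v0 * (t.1 *: (Lam * r), t.2 *: (Lam * r)).2 = D * (Lam * r).
  by rewrite mulrDl -!scalerAr -!scalerAl.
move=> ->; congr (_ + _).
have fluxE f : flux P f (g f) (t.1 *: (Lam * r), t.2 *: (Lam * r)) =
    len f * dot (nrm f) t * pint 0 1 (g f * trace f (Lam * r)).
  rewrite /flux /trace /= !line_polyZ !scalerA -scalerDl -scalerAr pintZ ?ler01 //.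
  by rewrite mulrA.
under eq_bigr do rewrite fluxE.
rewrite (bigD1_seq e) ?uniq_edges //= big_seq_cond big1 ?addr0 // => f /andP[fE fe].
have [c0|c0] := eqVneq (cross (dir ep) (dir f)) 0.
  have := cross_normal cT (dir ep) fE.
  have -> : cross (dir f) (dir ep) = 0 by rewrite -[RHS]oppr0 -c0 /cross; ring.
  rewrite normr0 => /esym/eqP; rewrite mulf_eq0 normr_eq0 gt_eqF ?len_gt0 ?(edge_ne
    fE) //=.
  by move=> /eqP n0; rewrite /t dotZr n0 !mulr0 mul0r.
have fS : f \in S by rewrite mem_filter fe c0.
rewrite (_ : pint _ _ _ = 0) ?mulr0 // -[RHS](pint0 ler01); apply: eq_pint => u _.
rewrite horner0 hornerM line_poly_eval -seg_pointE pevalM peval_prod (big_rem f) //=.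
by rewrite rel_heightE (height_edge cT) // mulr0 !mul0r mulr0.
Qed.

Let Om := Lam * rel_height e.

Let OmE : Om = \prod_(f <- e :: S) rel_height f.
Proof. by rewrite big_cons mulrC. Qed.

Let consE : {subset e :: S <= E}.
Proof. by move=> f; rewrite inE => /predU1P[->|/SE]. Qed.

Let Om01 x : T x -> 0 <= peval Om x <= 1.
Proof. by move=> Tx; rewrite OmE; exact: prod_rel_height_bounds. Qed.

(** Take r = rel_height e * D, which also removes the flux through e. *)
Lemma tangential_weighted : I (Om * D ^+ 2) <= energy w.
Proof.
have dD : deg_le k.-1 D by apply: deg_leD; apply: deg_leZ.
have rj : deg_le j (Lam * (rel_height e * D)).
  apply: (@deg_leW R (size S + (1 + k.-1))).
    by rewrite add1n prednK.
  by apply: deg_leM => //; apply: deg_leM => //; exact: deg_le_affine_poly.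
have := tangential_test rj.
have -> : pint 0 1 (g e * trace e (Lam * (rel_height e * D))) = 0.
  rewrite -[RHS](pint0 ler01); apply: eq_pint => u _.
  by rewrite horner0 hornerM line_poly_eval -seg_pointE !pevalM rel_heightE
    (height_edge cT) // !(mulr0, mul0r).
rewrite mulr0 addr0.
have -> : D * (Lam * (rel_height e * D)) = Om * D ^+ 2 by rewrite /Om; ring.
have -> : wt * (Lam * (rel_height e * D)) = Om * (D * wt) by rewrite /Om; ring.
move=> h1.
have h2 : I (Om * (D * wt)) <= 2^-1 * I (Om * D ^+ 2) + 2^-1 * I (Om * wt ^+ 2).
  rewrite -!(region_intZ cT) -(region_intD cT); apply: (le_region_int cT) => x Tx.
  rewrite pevalD !pevalZ !(pevalM Om) (pevalM D wt) !pevalX; have /andP[Om0 _] := Om01 Tx.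
  have : 0 <= peval Om x * (peval D x - peval wt x) ^+ 2 by rewrite mulr_ge0 ?sqr_ge0.
  by lra.
have h3 : I (Om * wt ^+ 2) <= energy w.
  apply: (le_region_int cT) => x Tx; rewrite (pevalM Om) pevalX.
  have /andP[Om0 Om1] := Om01 Tx.
  apply: (@le_trans _ _ (peval wt x ^+ 2)); first by rewrite ler_piMl ?sqr_ge0.
  exact: wt_sq.
rewrite h1 in h2; move: h2 h3.
by move: (I (Om * D ^+ 2)) (I (Om * wt ^+ 2)) (energy w) => a b c; lra.
Qed.

Lemma tangential_sup x : T x -> peval D x ^+ 2 * h ^+ 2 <= A0 * energy w.
Proof.
move=> Tx; apply: (@le_trans _ _ (A0 * I (Om * D ^+ 2))).
  apply: sup_region => //.
  - by apply: (@deg_leW R k.-1) => //; apply: deg_leD; apply: deg_leZ.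
  - by move=> z /Om01/andP[].
  - move=> z Tz lz; rewrite OmE; apply: prod_rel_height_low => // f /consE fE; exact: lz.
by rewrite ler_pM2l //; exact: tangential_weighted.
Qed.

Let Jg := pint 0 1 (trace e Lam * g e ^+ 2).

Let Jg0 : 0 <= Jg.
Proof.
apply: pint_ge0 => u u01; rewrite hornerM horner_exp mulr_ge0 ?sqr_ge0 //.
rewrite line_poly_eval -seg_pointE; have Tu := (edge_in eE u01).1.
by have /andP[] := prod_rel_height_bounds SE Tu.
Qed.

Let ge_j : (size (g e) <= j.+1)%N.
Proof. by apply: leq_trans (gk eE) _; rewrite ltnS. Qed.

(** The edge parameter, extended to the plane by orthogonal projection on e. *)
Let tau := affine_poly (- (dot (dir e) e.1 / len e ^+ 2)) ((len e ^+ 2)^-1 *: dir e).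

Let tauE x : peval tau x = dot (dir e) (x - e.1) / len e ^+ 2.
Proof. by rewrite affine_poly_eval dotZl dotBr; ring. Qed.

Let tau_le x : T x -> `|peval tau x| <= ratio.
Proof.
move=> Tx; rewrite tauE normrM normfV (gtr0_norm (exprn_gt0 2 le0)).
rewrite ler_pdivrMr ?exprn_gt0 // (le_trans (cauchy_schwarz _ _)) //.
have [T1 _] := edge_end eE; have h2 := dist_h Tx T1; have h1 := h_len eE.
by rewrite -/(len e) expr2 mulrA [leRHS]mulrC ler_pM2l // (le_trans h2).
Qed.

Let tau_seg u : peval tau (seg_point e u) = u.
Proof. by rewrite tauE seg_pointB dotZr -enorm_sqr -/(len e) mulfK // expf_neq0 //
  gt_eqF. Qed.

Let gx := extend (g e) tau.

Let gx_sup x : T x -> peval gx x ^+ 2 <= A1 * Jg.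
Proof.
move=> Tx; rewrite peval_extend; apply: edge_sup => //; [exact: ltnW|exact: tau_le].
Qed.

(** Take for r the extension of g e along the normal of e. The flux through e becomes
len e * dot (nrm e) t, where the angle condition keeps the second factor away from 0,
times the weighted square of the jump; the rest involves only wt and D, both already
controlled by the energy of w. *)
Lemma weighted_jump_bound : Jg <= 64 * ratio ^+ 2 * A0 * A1 / s ^+ 2 * energy w.
Proof.
have rj : deg_le j (Lam * gx).
  apply: (deg_leW sizeSk); apply: deg_leM => //; apply: deg_le_extend; first exact: gk.
  exact: deg_le_affine_poly.
have := tangential_test rj.
have -> : pint 0 1 (g e * trace e (Lam * gx)) = Jg.
  apply: eq_pint => u _; rewrite !hornerM !line_poly_eval -!seg_pointE pevalM
    peval_extend tau_seg.
  by ring.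
move=> h1.
have h2 : len e * dot (nrm e) t * Jg = I (Lam * gx * (wt - D)).
  have -> : Lam * gx * (wt - D) = wt * (Lam * gx) - D * (Lam * gx) by ring.
  by rewrite (region_intB cT) h1; ring.
have Qw := energy_ge0 w.
have ptw b x : 0 < b -> T x ->
   `|peval (Lam * gx * (wt - D)) x| <= b * (A1 * Jg) + A0 * energy w / h ^+ 2 / b.
  move=> b0 Tx; have /andP[L0 L1] := prod_rel_height_bounds SE Tx.
  rewrite pevalM pevalM -mulrA normrM (ger0_norm L0).
  apply: (@le_trans _ _ `|peval gx x * peval (wt - D) x|).
    by rewrite ler_piMl.
  rewrite normrM; apply: (le_trans (young _ _ b0)); apply: lerD.
    by rewrite ler_pM2l // -normrX ger0_norm ?sqr_ge0 // gx_sup.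
  rewrite -normrX ger0_norm ?sqr_ge0 // ler_pdivrMr ?mulr_gt0 //.
  have -> : A0 * energy w / h ^+ 2 / b * (4 * b) = 4 * (A0 * energy w) / h ^+ 2.
    by field; rewrite !gt_eqF.
  rewrite ler_pdivlMr ?exprn_gt0 // pevalB.
  have k2 : peval wt x ^+ 2 * h ^+ 2 <= A0 * energy w.
    apply: le_trans (sup_vector w1j w2j Tx); rewrite ler_pM2r ?exprn_gt0 //.
    by apply: (le_trans (wt_sq x)); rewrite pevalD !pevalX.
  have k3 := tangential_sup Tx.
  have : 0 <= (peval wt x + peval D x) ^+ 2 * h ^+ 2 by rewrite mulr_ge0 ?sqr_ge0.
  by move: k2 k3; lra.
have [xc [Txc _]] := inner_square.
have hB x : T x -> `|x.1 - xc.1| <= h /\ `|x.2 - xc.2| <= h.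
  move=> Tx; have [c1 c2] := enorm_coord (x - xc); have dd := dist_h Tx Txc.
  by split; [exact: le_trans c1 dd|exact: le_trans c2 dd].
(* this weight lets half of the left-hand side absorb the term in Jg *)
pose b := s / (8 * ratio * A1 * h).
have b0 : 0 < b.
  apply: divr_gt0; first by [].
  by apply: mulr_gt0 => //; apply: mulr_gt0 => //; apply: mulr_gt0.
pose B := b * (A1 * Jg) + A0 * energy w / h ^+ 2 / b.
have B0 : 0 <= B.
  apply: addr_ge0; first by apply: mulr_ge0; [exact: ltW|exact: mulr_ge0 (ltW A10) Jg0].
  by apply: divr_ge0; [apply: divr_ge0;
    [exact: mulr_ge0 (ltW A00) Qw|exact: sqr_ge0]|exact: ltW].
have h3 : `|I (Lam * gx * (wt - D))| <= B * (4 * h ^+ 2).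
  rewrite ler_norml lerNl -(region_intN cT); apply/andP; split.
    apply: (integral_ub (measurable_region cT) hB (ltW h0) B0) => x Tx.
    by rewrite pevalN (le_trans _ (ptw b x b0 Tx)) // -normrN ler_norm.
  apply: (integral_ub (measurable_region cT) hB (ltW h0) B0) => x Tx.
  by rewrite (le_trans _ (ptw b x b0 Tx)) // ler_norm.
have h4 : s * h / ratio * Jg <= B * (4 * h ^+ 2).
  apply: le_trans h3; rewrite -h2 !normrM (gtr0_norm le0) (ger0_norm Jg0).
  apply: ler_wpM2r => //; rewrite [leRHS]mulrC -mulrA; apply: ler_pM => //.
  - exact: ltW.
  by rewrite ler_pdivrMr // mulrC h_len.
have h5 : B * (4 * h ^+ 2) = s * h / ratio / 2 * Jg + 32 * ratio * A0 * A1 * h / s *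
  energy w.
  by rewrite /B /b; field; rewrite !gt_eqF.
have c0 : 0 < s * h / ratio / 2 by rewrite !divr_gt0 // mulr_gt0.
rewrite -(ler_pM2l c0).
have -> : s * h / ratio / 2 * (64 * ratio ^+ 2 * A0 * A1 / s ^+ 2 * energy w) =
  32 * ratio * A0 * A1 * h / s * energy w by field; rewrite !gt_eqF.
by move: h4; rewrite h5; lra.
Qed.

Lemma edge_jump_bound :
  h^-1 * (len e * pint 0 1 (g e ^+ 2)) <=
    64 * ratio ^+ 2 * A0 * A1 ^+ 2 / s ^+ 2 * energy w.
Proof.
have ratio1 : 1 <= ratio.
  rewrite /ratio -[leLHS](mulr1 1); apply: ler_pM => //.
  by rewrite -natrM ler1n muln_gt0 /= (leq_trans _ m3).
have h1 : pint 0 1 (g e ^+ 2) <= A1 * Jg.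
  rewrite -(pint_const (A1 * Jg)); apply: le_pint => u /andP[u0 u1];
    rewrite horner_exp hornerC.
  apply: edge_sup => //; first exact: ltnW.
  by rewrite ger0_norm // (le_trans u1).
have J0 : 0 <= pint 0 1 (g e ^+ 2) by apply: pint_ge0 => u _; rewrite horner_exp sqr_ge0.
apply: (@le_trans _ _ (pint 0 1 (g e ^+ 2))).
  rewrite mulrA ler_piMl // mulrC ler_pdivrMr // mul1r; exact: len_h.
apply: (le_trans h1); have := weighted_jump_bound; rewrite -(ler_pM2l A10) => h2.
apply: (le_trans h2); rewrite le_eqVlt; apply/orP; left; apply/eqP.
by field; rewrite gt_eqF.
Qed.
End one_edge.

Lemma jump_bound : jump g <= m%:R * A4 * energy w.
Proof.
rewrite /jump mulr_sumr.
apply: (@le_trans _ _ (\sum_(e <- E) A4 * energy w)).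
  rewrite big_seq [leRHS]big_seq; apply: ler_sum => e eE.
  have [ep [pE adj p12]] := next_edge eE.
  exact: (edge_jump_bound eE pE adj p12).
rewrite big_const_seq count_predT iter_addr_0 -mulrA mulr_natl.
by apply: ler_wpMn2l => //; apply: mulr_ge0; [exact: ltW|exact: energy_ge0].
Qed.

(** The jumps are bounded by the weak gradient edge by edge, and the gradient is
recovered from the weak gradient and the jumps. *)
Lemma norm_equivalence :
  lower_const * (energy grad + jump g) <= energy w <=
    upper_const * (energy grad + jump g).
Proof.
have Jw := jump_bound; have J0 := jump_ge0 g.
have N0 := energy_ge0 grad; have mA : 0 <= m%:R * A0 by apply: mulr_ge0; exact: ltW.
apply/andP; split.
  rewrite mulrC ler_pdivrMr; last by rewrite -invr_gt0; exact: lower_const_gt0.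
  have := ler_wpM2l mA Jw; have := energy_lower; lra.
rewrite /upper_const; have := energy_upper; have := mulr_ge0 mA N0; lra.
Qed.
End weak_gradient.
End on_polygon.
End estimates.

(** * Equivalence of the two norms *)

Section local_norms.
Variables (R : realType) (k m j : nat) (al0 th0 : R).
Hypotheses (k1 : (1 <= k)%N) (m3 : (3 <= m)%N) (al01 : 1 <= al0) (th00 : 0 < th0).
Variable P : polygon R.
Let T := region P.
Let E := edges P.
Hypotheses (cT : convex_set T) (Em : (size E <= m)%N) (reg : shape_regular al0 th0 P).
Hypothesis degs : (k + m - 2 <= j)%N \/ parallel_edges P /\ (k + m - 3 <= j)%N.
Variables (v0 : bipoly R) (vb : R * R -> R).
Hypothesis v0k : deg_le k v0.
Hypothesis vbk : forall e, e \in E ->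
  exists p : {poly R}, (size p <= k.+1)%N /\ forall t, 0 < t < 1 ->
    vb (seg_point e t) = p.[t].

Let w := weak_gradient j P v0 vb.
Let n := integral_on T (fun x => peval (dx v0) x ^+ 2 + peval (dy v0) x ^+ 2) +
  (diam T)^-1 * \sum_(e <- E) edge_integral e (fun x => (peval v0 x - vb x) ^+ 2).

Lemma local_norm_equivalence :
  lower_const m j al0 th0 * n <=
  integral_on T (fun x => peval w.1 x ^+ 2 + peval w.2 x ^+ 2) <=
  upper_const m j al0 th0 * n.
Proof.
have kj : (k <= j)%N.
  have kkm : (k <= k + m - 3)%N by rewrite -addnBA // leq_addr.
  case: degs => [|[_]]; last exact: leq_trans kkm.
  by apply: leq_trans (leq_trans kkm _); apply: leq_sub2l.
(* choose the polynomial that represents vb on each edge *)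
have [G GP] : exists G : (R * R) * (R * R) -> {poly R}, forall e, e \in E ->
    (size (G e) <= k.+1)%N /\ forall t, 0 < t < 1 -> vb (seg_point e t) = (G e).[t].
  have aux e : exists p : {poly R}, e \in E ->
      (size p <= k.+1)%N /\ forall t, 0 < t < 1 -> vb (seg_point e t) = p.[t].
    have [/vbk[p pP]|eE] := boolP (e \in E); first by exists p.
    by exists 0.
  by have [G GP] := choice aux; exists G.
have GvE e (eE : e \in E) t (t01 : 0 < t < 1) := (GP e eE).2 t t01.
pose g e := G e - trace e v0.
have gk e : e \in E -> (size (g e) <= k.+1)%N.
  move=> eE; rewrite (leq_trans (size_polyD _ _)) // size_polyN geq_max (GP e eE).1 /=.
  exact: size_line_poly.
have sep i p := @integral_sep R m i al0 th0 m3 al01 th00 P cT Em reg p.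
have /(weak_gradient_identity cT v0 GvE)[w1 w2 wE] :=
  weak_gradient_exists cT v0 GvE sep j.
have := norm_equivalence m3 al01 th00 cT Em reg k1 kj v0k gk w1 w2 wE degs.
have -> : energy P (dx v0, dy v0) + jump P g = n.
  congr (_ + _ * _); last first.
    by rewrite big_seq [RHS]big_seq; apply: eq_bigr => e eE; rewrite (gap_edge v0 GvE).
  by apply: eq_Rintegral => x _; rewrite pevalD !pevalX.
have -> : energy P w = integral_on T (fun x => peval w.1 x ^+ 2 + peval w.2 x ^+ 2) => //.
by apply: eq_Rintegral => x _; rewrite pevalD !pevalX.
Qed.
End local_norms.

Theorem theorem2p2 (R : realType) (k m j : nat) (alpha0 theta0 : R) :
  (1 <= k)%N -> (3 <= m)%N -> 1 <= alpha0 -> 0 < theta0 ->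
  exists C1 C2 : R, [/\ 0 < C1, 0 < C2 &
    forall (Omega : set (R * R)) (N : nat) (Th : 'I_N -> polygon R),
      polygonal_domain Omega ->
      is_partition Omega Th ->
      (forall i, convex_set (region (Th i))) ->
      (forall i, (size (edges (Th i)) <= m)%N) ->
      (forall i, shape_regular alpha0 theta0 (Th i)) ->
      (j0 k m Th <= j)%N ->
      forall v : wg_function R N, in_Vh k Th v ->
        C1 * norm_1h Th v <= wg_norm j Th v <= C2 * norm_1h Th v].
Proof.
move=> k1 m3 al01 th00.
have c1 := lower_const_gt0 j m3 al01 th00; have c2 := upper_const_gt0 j m3 al01 th00.
exists (Num.sqrt (lower_const m j alpha0 theta0)),
  (Num.sqrt (upper_const m j alpha0 theta0)).
split; rewrite ?sqrtr_gt0 // => Omega N Th _ _ cT Em reg jj v [v0k vbk].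
have degs i : (k + m - 2 <= j)%N \/ parallel_edges (Th i) /\ (k + m - 3 <= j)%N.
  move: jj; rewrite /j0; case: asboolP => [par|_] jj; last by left.
  by right; split.
have eqv i := local_norm_equivalence k1 m3 al01 th00 (cT i) (Em i) (reg i) (degs i)
  (v0k i) (vbk i).
rewrite /norm_1h /wg_norm -(sqrtrM _ (ltW c1)) -(sqrtrM _ (ltW c2)); apply/andP;
  split; apply: ler_wsqrtr;
  rewrite mulr_sumr; apply: ler_sum => i _; by case/andP: (eqv i).
Qed.
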